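(* Consider inclusions $\mathcal{D}\subset\mathcal{A}\subset\mathcal{M}$, where $\mathcal{M}$ is a von Neumann algebra with a faithful normal state $\omega$ with $\mathcal{D}$ in its centralizer (that is, $\omega(dx)=\omega(xd)$ for all $d\in\mathcal{D}$, $x\in\mathcal{M}$), $\mathcal{A}$ is a weak* closed subalgebra of $\mathcal{M}$, and $\mathcal{D}$ is a von Neumann subalgebra containing the unit of $\mathcal{M}$. Let $\Phi:\mathcal{A}\to\mathcal{D}$ be a weak* continuous $\mathcal{D}$-character. Then there exists a normal conditional expectation $\Psi:\mathcal{M}\to\mathcal{D}$ extending $\Phi$. Indeed $\omega\circ\Phi$ extends to a normal state $\rho$ on $\mathcal{M}$ such that there exists a unique $\rho$-preserving normal conditional expectation $\Psi:\mathcal{M}\to\mathcal{D}$ extending $\Phi$.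
   Context: A $\mathcal{D}$-character is a unital contractive homomorphism $\Phi:\mathcal{A}\to\mathcal{D}$ which is a $\mathcal{D}$-bimodule map (equivalently, is the identity on $\mathcal{D}$). A conditional expectation $\Psi:\mathcal{M}\to\mathcal{D}$ is a unital positive idempotent $\mathcal{D}$-module map onto $\mathcal{D}$; normal means weak* continuous; $\rho$-preserving means $\rho\circ\Psi=\rho$. *)

(* Defs.v *)
From HB Require Import structures.
From mathcomp Require Import all_boot all_order all_algebra sesquilinear complex.
From mathcomp Require Import all_classical all_reals all_analysis.

Set Implicit Arguments.
Unset Strict Implicit.
Unset Printing Implicit Defensive.

Import Order.TTheory GRing.Theory Num.Theory numFieldNormedType.Exports.
Local Open Scope classical_set_scope.
Local Open Scope complex_scope.
Local Open Scope ring_scope.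

(* The inner product is linear in its first argument and conjugate-linear in
   the second one; it induces the norm, for which the space is complete. *)
HB.mixin Record NormedModule_isHilbert (R : realType) H
    & CompleteNormedModule R[i] H := {
  inner : {dot H for @Num.conj R[i]} ;
  innerE : forall u : H, `|u| ^+ 2 = inner u u
}.

#[short(type="hilbertType")]
HB.structure Definition Hilbert (R : realType) :=
  {H of CompleteNormedModule R[i] H & NormedModule_isHilbert R H}.

Section BoundedOperators.
Context {R : realType}.
Variable H : hilbertType R.

Definition bounded_op : {pred (H -> H)} :=
  [pred f : H -> H | `[< linear f /\ continuous f >]].

Lemma bounded_opP (f : H -> H) :
  reflect (linear f /\ continuous f) (f \in bounded_op).
Proof. exact: asboolP. Qed.

Lemma bounded_op_submod : submod_closed bounded_op.
Proof.
split.
  apply/bounded_opP; split=> [a x y|]; last exact: cst_continuous.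
  by rewrite /= scaler0 addr0.
move=> a f g /bounded_opP[fl fc] /bounded_opP[gl gc]; apply/bounded_opP; split.
  move=> b x y; rewrite !fctE.
  rewrite (fl b x y) (gl b x y) !scalerDr !scalerA -!addrA; congr (_ + _).
    by rewrite mulrC.
  by rewrite addrCA.
move=> x; apply: cvgD; last exact: gc.
by apply: cvgZl_tmp; exact: fc.
Qed.

HB.instance Definition _ :=
  GRing.isSubmodClosed.Build R[i] (H -> H) bounded_op bounded_op_submod.

Record BH := BoundedOp { BH_app :> H -> H ; _ : BH_app \in bounded_op }.

HB.instance Definition _ := [isSub for BH_app].
HB.instance Definition _ := [Choice of BH by <:].
HB.instance Definition _ := [SubChoice_isSubLmodule of BH by <:].

Lemma BH_linear (x : BH) : linear x.
Proof. by case: x => f fb; case/bounded_opP: (fb). Qed.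

Lemma BH_continuous (x : BH) : continuous x.
Proof. by case: x => f fb; case/bounded_opP: (fb). Qed.

Lemma BH_inj (x y : BH) : x =1 y -> x = y.
Proof. by move=> xy; apply: val_inj; apply: funext. Qed.

Fact BH_one_subproof : (id : H -> H) \in bounded_op.
Proof. by apply/bounded_opP; split=> // x; exact: cvg_id. Qed.

Fact BH_mul_subproof (x y : BH) : (x \o y : H -> H) \in bounded_op.
Proof.
apply/bounded_opP; split=> [a u v /=|u]; first by rewrite !BH_linear.
by apply: continuous_comp; exact: BH_continuous.
Qed.

Definition BH_one : BH := BoundedOp BH_one_subproof.
Definition BH_mul (x y : BH) : BH := BoundedOp (BH_mul_subproof x y).

Lemma BH_mulA : associative BH_mul.
Proof. by move=> x y z; apply: BH_inj. Qed.
Lemma BH_mul1 : left_id BH_one BH_mul.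
Proof. by move=> x; apply: BH_inj. Qed.
Lemma BH_mulr1 : right_id BH_one BH_mul.
Proof. by move=> x; apply: BH_inj. Qed.
Lemma BH_mulDl : left_distributive BH_mul +%R.
Proof. by move=> x y z; apply: BH_inj. Qed.
Lemma BH_mulDr : right_distributive BH_mul +%R.
Proof.
move=> x y z; apply: BH_inj => u.
by have := BH_linear x 1 (y u) (z u); rewrite !scale1r.
Qed.

(* B(H) is the zero ring when H = 0, hence not a [nzRingType]. *)
HB.instance Definition _ := GRing.Zmodule_isPzRing.Build BH
  BH_mulA BH_mul1 BH_mulr1 BH_mulDl BH_mulDr.

Definition opnorm (x : BH) : R :=
  sup [set complex.Re `|x u| | u in [set u : H | `|u| <= 1]].

Definition is_adjoint (x y : BH) := forall u v : H, inner (x u) v = inner u (y v).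

Definition positive_op (x : BH) := forall u : H, 0 <= inner (x u) u.

Definition square_summable (xi : nat -> H) :=
  cvgn (series (fun n => `|xi n| ^+ 2 : R[i]^o)).

(* The predual of B(H) consists of the functionals
   x |-> \sum_n <x (xi n), eta n> with xi and eta square summable. *)
Definition predual :=
  {p : (nat -> H) * (nat -> H) | square_summable p.1 /\ square_summable p.2}.

Definition predual_app (x : BH) (p : predual) : R[i]^o :=
  limn (series (fun n => inner (x ((sval p).1 n)) ((sval p).2 n) : R[i]^o)).

(* B(H) with its weak* (ultraweak) topology, the coarsest one for which every
   element of the predual is continuous. *)
Definition weakstar : Type :=
  @initial_topology BH {ptws predual -> R[i]^o} predual_app.

HB.instance Definition _ := Topological.on weakstar.

Definition wstar_closed (A : set BH) := closed (A : set weakstar).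

Definition wstar_continuous (A : set BH) (f : BH -> BH) :=
  {within (A : set weakstar), continuous (f : weakstar -> weakstar)}.

Definition wstar_continuous_functional (A : set BH) (f : BH -> R[i]) :=
  {within (A : set weakstar), continuous (f : weakstar -> R[i]^o)}.

Definition subalgebra (A : set BH) :=
  [/\ A 0,
      forall (a : R[i]) x y, A x -> A y -> A (a *: x + y) &
      forall x y, A x -> A y -> A (x * y)].

(* A von Neumann algebra acting on H, with unit the identity of H *)
Definition von_neumann_algebra (M : set BH) :=
  [/\ subalgebra M, M 1,
      forall x, M x -> exists2 y, M y & is_adjoint x y &
      wstar_closed M].

(* Maps and functionals on a set of operators are represented by total functions
   on B(H), only the values of which on this set are relevant. *)
Definition linear_on (V : lmodType R[i]) (A : set BH) (f : BH -> V) :=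
  forall (a : R[i]) x y, A x -> A y -> f (a *: x + y) = a *: f x + f y.

Definition bimodule_map_on (D A : set BH) (f : BH -> BH) :=
  forall d x, D d -> A x -> f (d * x) = d * f x /\ f (x * d) = f x * d.

Definition normal_state (M : set BH) (w : BH -> R[i]) :=
  [/\ linear_on M (w : BH -> R[i]^o),
      forall x, M x -> positive_op x -> 0 <= w x,
      w 1 = 1 &
      wstar_continuous_functional M w].

Definition faithful (M : set BH) (w : BH -> R[i]) :=
  forall x, M x -> positive_op x -> w x = 0 -> x = 0.

Definition in_centralizer (M D : set BH) (w : BH -> R[i]) :=
  forall d x, D d -> M x -> w (d * x) = w (x * d).

Definition D_character (A D : set BH) (Phi : BH -> BH) :=
  [/\ forall x, A x -> D (Phi x),
      linear_on A Phi,
      forall x y, A x -> A y -> Phi (x * y) = Phi x * Phi y,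
      Phi 1 = 1 &
      (forall x, A x -> opnorm (Phi x) <= opnorm x) /\ bimodule_map_on D A Phi].

Definition conditional_expectation (M D : set BH) (Psi : BH -> BH) :=
  [/\ Psi @` M = D /\ Psi 1 = 1,
      linear_on M Psi,
      forall x, M x -> positive_op x -> positive_op (Psi x),
      forall x, M x -> Psi (Psi x) = Psi x &
      bimodule_map_on D M Psi].

Definition normal_conditional_expectation (M D : set BH) (Psi : BH -> BH) :=
  conditional_expectation M D Psi /\ wstar_continuous M Psi.

End BoundedOperators.

(* Main.v *)
Require Import Defs.
From HB Require Import structures.
From mathcomp Require Import all_boot all_order all_algebra sesquilinear complex.
From mathcomp Require Import all_classical all_reals all_analysis.
From mathcomp Require Import zify ring lra.

Set Implicit Arguments.
Unset Strict Implicit.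
Unset Printing Implicit Defensive.

Import Order.TTheory GRing.Theory Num.Theory numFieldNormedType.Exports.
Import ComplexField.Normc.
Local Open Scope classical_set_scope.
Local Open Scope complex_scope.
Local Open Scope ring_scope.
Local Notation Re := complex.Re.

(* Normal functionals on M have the form x |-> <x xi, eta> on the amplification
   l2(H) of H, and omega is the vector functional of a vector Om separating for M.
   In particular omega o Phi is bounded by a multiple of the seminorm a |-> |a xi|
   on A. Approximating xi by the orbit of Om under the commutant of M bounds this
   seminorm by a sum of vector functionals, and a minimal norm argument over all
   such sums that dominate omega o Phi makes them invariant under the unitaries of
   D: this gives zeta, whose vector functional has D in its centralizer, with
   |omega (Phi a)| <= C |a zeta| on A.
     As in the Hoffman-Rossi theorem, subtract from zeta its projection on the
   closure of (ker Phi) zeta. The resulting vector xi still has D in the centralizer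
   of its vector functional, is separating for D, and satisfies
   <a xi, d xi> = <Phi(a) xi, d xi> for a in A and d in D. Since xi is a trace vector
   for D, the compression of M to the closure of D xi commutes with the commutant of
   D, hence lands in D by the double commutant theorem: this is the expectation Psi.
     Take rho = omega o Psi. A rho-preserving expectation Psi' satisfies
   omega (d Psi' x) = omega (d Psi x) for all d in D, so that Psi' = Psi because
   omega is faithful. *)

(** * Complex numbers and inner products *)

(** Centrality must come from averaging over the unitaries of D, a group that in general is not
    amenable; the uniqueness of a minimal norm element replaces the average. This requires
    functionals that sit in a Hilbert space. Those dominated by a multiple of omega do, in the form
    x |-> <x Om, g>, which is why xi is first approximated inside the commutant orbit of Om. A whole
    sequence of such functionals is minimized at once, because their sum need not be dominated by a
    multiple of omega. The amplification makes every sum of vector functionals a single vector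
    functional, and turns approximation on one vector into ultrastrong approximation. The final
    vector induces on D a trace that may differ from omega. It serves to construct Psi, but its own
    vector functional need not extend omega o Phi; this is why rho is omega o Psi. *)

Section ComplexNumbers.
Context {R : realType}.
Implicit Types (z w : R[i]) (a : R).

Lemma ReD z w : Re (z + w) = Re z + Re w. Proof. by case: z w => [? ?] []. Qed.
Lemma ReN z : Re (- z) = - Re z. Proof. by case: z. Qed.
Lemma ReB z w : Re (z - w) = Re z - Re w. Proof. by rewrite ReD ReN. Qed.
Lemma ReZ a z : Re (a%:C * z) = a * Re z.
Proof. by case: z => ? ? /=; rewrite mul0r subr0. Qed.
Lemma conjcE z : z^*%R = conjc z. Proof. by []. Qed.
Lemma complexRe_conj z : Re z^*%R = Re z. Proof. by rewrite conjcE; case: z. Qed.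
Lemma ReC a : Re a%:C = a. Proof. by []. Qed.

Lemma conj_real a : (a%:C)^*%R = a%:C. Proof. by rewrite conjcE conjc_real. Qed.

Lemma normcC z : `|z| = (normc z)%:C. Proof. by []. Qed.

Lemma normc_ge0 z : 0 <= normc z. Proof. by rewrite -ler0c -normcC. Qed.

Lemma Re_le_normc z : Re z <= normc z.
Proof. by rewrite -lecR -normcC (le_trans _ (normc_ge_Re z))// lecR ler_norm. Qed.

Lemma mulJc z : z * z^*%R = ((normc z) ^+ 2)%:C.
Proof. by rewrite rmorphXn/= -normcC normCK. Qed.

Lemma normc_conj z : normc z^*%R = normc z.
Proof. by apply: complexI; rewrite -!normcC norm_conjC. Qed.

Lemma normc_real a : normc a%:C = `|a|.
Proof. by rewrite /= expr0n/= addr0 sqrtr_sqr. Qed.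

Lemma ge0c_Re z : 0 <= z -> z = (Re z)%:C.
Proof. by case: z => a b; rewrite lecE/= => /andP[/eqP-> _]. Qed.

(** Common core of the Cauchy-Schwarz inequalities below, where the assumption is the nonnegativity
    of a form at u - a v. Taking [a] to be a real multiple of [z] leaves a real quadratic polynomial
    in the multiplier. *)
Lemma discriminant_bound (p q : R) z : 0 <= q ->
  (forall a : R[i], 0 <= p - 2 * Re (a^*%R * z) + normc a ^+ 2 * q) ->
  normc z ^+ 2 <= p * q.
Proof.
move=> q0 pq; have {}pq t : 0 <= p - 2 * t * normc z ^+ 2 + t ^+ 2 * normc z ^+ 2 * q.
  have := pq (t%:C * z); rewrite normcM exprMn rmorphM /=.
  have -> : ((t%:C)^*%R * z^*%R * z) = (t * normc z ^+ 2)%:C.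
    by rewrite conj_real -mulrA (mulrC z^*%R) mulJc -rmorphM.
  by rewrite ReC mulrA /= expr0n/= addr0 sqrtr_sqr real_normK// num_real.
have [q0'|] := ltP 0 q.
  have := pq q^-1.
  have -> : p - 2 * q^-1 * normc z ^+ 2 + q^-1 ^+ 2 * normc z ^+ 2 * q = p - normc z ^+ 2 / q.
    by field; rewrite gt_eqF.
  by rewrite subr_ge0 ler_pdivrMr.
move=> q0'; have {q0 q0'} q0 : q = 0 by apply/eqP; rewrite eq_le q0 q0'.
rewrite q0 mulr0; have := sqr_ge0 (normc z); rewrite le0r => /orP[/eqP->//|z0].
(* For [q = 0] the polynomial is affine in the multiplier; here [z] is nonzero and this multiplier
   gives the value -1. *)
have := pq ((p + 1) / (2 * normc z ^+ 2)); rewrite q0 mulr0 addr0.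
have -> : p - 2 * ((p + 1) / (2 * normc z ^+ 2)) * normc z ^+ 2 = - 1.
  by move: (normc z ^+ 2) z0 => n n0; field; rewrite gt_eqF.
by rewrite oppr_ge0 ler10.
Qed.

End ComplexNumbers.

Section InnerProduct.
Context {R : realType} {H : hilbertType R}.
Implicit Types (u v w : H) (a : R[i]).

Definition nm u : R := Re `|u|.

Lemma nmE u : `|u| = (nm u)%:C.
Proof. by rewrite /nm -ge0c_Re. Qed.

Lemma nm_ge0 u : 0 <= nm u.
Proof. by rewrite -ler0c -nmE. Qed.

Lemma nm0 : nm 0 = 0. Proof. by rewrite /nm normr0. Qed.

Lemma nm0_eq0 u : nm u = 0 -> u = 0.
Proof. by move=> u0; apply/eqP; rewrite -normr_eq0 nmE u0. Qed.

Lemma nmN u : nm (- u) = nm u. Proof. by rewrite /nm normrN. Qed.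

Lemma nmBC u v : nm (u - v) = nm (v - u). Proof. by rewrite /nm distrC. Qed.

Lemma nmD u v : nm (u + v) <= nm u + nm v.
Proof. by rewrite -lecR rmorphD/= -!nmE ler_normD. Qed.

Lemma nmZ a u : nm (a *: u) = normc a * nm u.
Proof. by apply: complexI; rewrite rmorphM/= -!nmE -normcC normrZ. Qed.

Lemma innerC u v : inner u v = (inner v u)^*%R.
Proof. by rewrite hermC /= mul1r. Qed.

Lemma innerDl u v w : inner (u + v) w = inner u w + inner v w.
Proof. exact: linearDl. Qed.
Lemma innerDr u v w : inner w (u + v) = inner w u + inner w v.
Proof. exact: linearDr. Qed.
Lemma innerZl a u v : inner (a *: u) v = a * inner u v.
Proof. exact: linearZl_LR. Qed.
Lemma innerZr a u v : inner u (a *: v) = a^*%R * inner u v.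
Proof. exact: linearZr_LR. Qed.
Lemma innerNl u v : inner (- u) v = - inner u v.
Proof. by rewrite -scaleN1r innerZl mulN1r. Qed.
Lemma innerNr u v : inner u (- v) = - inner u v.
Proof. by rewrite -scaleN1r innerZr rmorphN rmorph1 mulN1r. Qed.
Lemma innerBl u v w : inner (u - v) w = inner u w - inner v w.
Proof. by rewrite innerDl innerNl. Qed.
Lemma innerBr u v w : inner w (u - v) = inner w u - inner w v.
Proof. by rewrite innerDr innerNr. Qed.
Lemma inner0l u : inner 0 u = 0.
Proof. by rewrite -(scale0r 0) innerZl mul0r. Qed.
Lemma inner0r u : inner u 0 = 0.
Proof. by rewrite innerC inner0l rmorph0. Qed.

Lemma inner_nm u : inner u u = (nm u ^+ 2)%:C.
Proof. by rewrite -innerE nmE rmorphXn. Qed.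

Lemma inner_eq0 u : inner u u = 0 -> u = 0.
Proof.
rewrite inner_nm => /complexI/eqP; rewrite sqrf_eq0 => /eqP; exact: nm0_eq0.
Qed.

Lemma nm_expand u v a :
  nm (u - a *: v) ^+ 2 = nm u ^+ 2 - 2 * Re (a^*%R * inner u v) + normc a ^+ 2 * nm v ^+ 2.
Proof.
apply: complexI; rewrite -inner_nm innerBl !innerBr !innerZl !innerZr.
have -> (x y z t : R) : (x - 2 * y + z * t)%:C = x%:C - 2 * y%:C + z%:C * t%:C.
  by apply/eqP; rewrite eq_complex/= ?addr0 ?subr0 ?mul0r ?mulr0 ?addr0 ?subr0 ?eqxx.
have := addcJ (a^*%R * inner u v); rewrite -conjcE rmorphM/= conjCK -innerC => <-.
by rewrite -mulJc -!inner_nm; ring.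
Qed.

Lemma inner_CS u v : normc (inner u v) <= nm u * nm v.
Proof.
rewrite -ler_sqr ?nnegrE ?normc_ge0 ?mulr_ge0 ?nm_ge0// exprMn.
apply: discriminant_bound => [|a]; first exact: sqr_ge0.
by rewrite -nm_expand sqr_ge0.
Qed.

Lemma parallelogram u v :
  nm (u + v) ^+ 2 + nm (u - v) ^+ 2 = 2 * (nm u ^+ 2 + nm v ^+ 2).
Proof.
have := nm_expand u v 1; have := nm_expand u v (-1).
rewrite scale1r scaleN1r opprK => -> ->.
rewrite rmorphN !rmorph1 mulN1r mul1r ReN.
have -> : normc (-1 : R[i]) = 1 by rewrite normcN normc1.
rewrite normc1; lra.
Qed.

Lemma inner_ext u v : (forall w, inner u w = inner v w) -> u = v.
Proof.
move=> uv; apply/eqP; rewrite -subr_eq0; apply/eqP/inner_eq0.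
by rewrite innerBl uv subrr.
Qed.

Lemma nmD_sqr u v : nm (u + v) ^+ 2 = nm u ^+ 2 + 2 * Re (inner u v) + nm v ^+ 2.
Proof.
have := nm_expand u v (-1); rewrite scaleN1r opprK => ->.
rewrite rmorphN rmorph1 mulN1r ReN normcN normc1; lra.
Qed.

End InnerProduct.

Lemma exists_invS {R : realType} (e : R) : 0 < e -> exists N : nat, N.+1%:R^-1 < e.
Proof. by rewrite -[e]add0r => /ltr_add_invr[k]; rewrite !add0r; exists k. Qed.

Lemma le_eps {R : realType} (a b : R) : (forall e : R, 0 < e -> a <= b + e) -> a <= b.
Proof. by move=> ab; apply/ler_addgt0Pr. Qed.

(** * Hilbert space geometry *)

Section HilbertGeometry.
Context {R : realType} {H : hilbertType R}.
Implicit Types (u v w : H) (a : R[i]) (S : set H).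

Lemma cvg_nm (u : nat -> H) l :
  u @ \oo --> l <-> forall e : R, 0 < e -> exists N, forall n, (N <= n)%N -> nm (u n - l) < e.
Proof.
split=> [/cvgrPdist_lt ul e e0|ul].
  have /ul[N _ uN] : 0 < e%:C by rewrite ltcR.
  by exists N => n Nn; have := uN n Nn; rewrite /= distrC nmE ltcR.
apply/cvgrPdist_lt => e e0; have e0' : 0 < Re e by move: e0; rewrite ltcE => /andP[].
have [N uN] := ul _ e0'; exists N => // n /= Nn.
by rewrite distrC nmE (ge0c_Re (ltW e0)) ltcR uN.
Qed.

Lemma complete_nm (u : nat -> H) :
  (forall e : R, 0 < e -> exists N, forall m n, (N <= m)%N -> (N <= n)%N -> nm (u m - u n) < e) ->
  exists l : H, u @ \oo --> l.
Proof.
move=> uc; apply/cvg_ex; apply: (@cauchy_cvg H); apply/cauchy_exP => e e0.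
have e0' : 0 < Re e by move: e0; rewrite ltcE => /andP[].
have [N uN] := uc _ e0'; exists (u N); exists N => // n /= Nn.
by rewrite -ball_normE/= nmE (ge0c_Re (ltW e0)) ltcR uN.
Qed.

Lemma closure_nm S u :
  closure S u <-> forall e : R, 0 < e -> exists2 s, S s & nm (u - s) < e.
Proof.
split=> [Su e e0|Su B /nbhs_ballP[e /= e0 eB]].
  have e0' : 0 < e%:C by rewrite ltcR.
  have [s [Ss]] := Su _ (nbhsx_ballx u _ e0').
  by rewrite -ball_normE/= nmE ltcR => us; exists s.
have e0' : 0 < Re e by move: e0; rewrite ltcE => /andP[].
have [s Ss us] := Su _ e0'; exists s; split=> //; apply: eB.
by rewrite -ball_normE/= nmE (ge0c_Re (ltW e0)) ltcR.
Qed.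

Lemma nm_le_closure S u (m : R) : closure S u -> (forall s, S s -> m <= nm s) -> m <= nm u.
Proof.
move=> /closure_nm Su mS; apply: le_eps => e e0.
have [s Ss us] := Su e e0; apply: le_trans (mS s Ss) _.
rewrite -[s](subrK u); apply: le_trans (nmD _ _) _.
by rewrite addrC lerD2l nmBC ltW.
Qed.

(** The part of convexity that the parallelogram law uses. *)
Definition midpoint_closed S := forall u v, S u -> S v -> S ((2^-1 : R)%:C *: (u + v)).

Lemma half_scaleDD u : (2^-1 : R)%:C *: (u + u) = u.
Proof.
have <- : (2^-1 : R)%:C *: u + (2^-1 : R)%:C *: u = (2^-1 : R)%:C *: (u + u) by rewrite scalerDr.
rewrite -scalerDl; have -> : (2^-1 : R)%:C + (2^-1 : R)%:C = 1.
  by apply/eqP; rewrite eq_complex/= addr0 eqxx andbT; apply/eqP; field.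
by rewrite scale1r.
Qed.

Lemma nm_half u : nm ((2^-1 : R)%:C *: u) = nm u / 2.
Proof.
rewrite nmZ; have -> : normc ((2^-1 : R)%:C) = 2^-1; last by rewrite mulrC.
by rewrite /= expr0n/= addr0 sqrtr_sqr ger0_norm.
Qed.

Lemma midpoint_dist S (m : R) u v : 0 <= m -> midpoint_closed S -> (forall s, S s -> m <= nm s) ->
  S u -> S v -> nm (u - v) ^+ 2 <= 2 * (nm u ^+ 2 + nm v ^+ 2) - 4 * m ^+ 2.
Proof.
move=> m0 Sm mS Su Sv; rewrite -parallelogram.
have : m ^+ 2 <= (nm (u + v) / 2) ^+ 2.
  by rewrite ler_sqr ?nnegrE// -?nm_half; [exact/mS/Sm|exact: nm_ge0].
rewrite expr_div_n => H1; have : m ^+ 2 * 4 <= nm (u + v) ^+ 2.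
  by rewrite -ler_pdivlMr//; apply: le_trans H1 _; rewrite -natrX.
lra.
Qed.

Lemma closure_midpoint S : midpoint_closed S -> midpoint_closed (closure S).
Proof.
move=> Sm u v /closure_nm Su /closure_nm Sv; apply/closure_nm => e e0.
have [s Ss us] := Su e e0; have [t St vt] := Sv e e0.
exists ((2^-1 : R)%:C *: (s + t)); first exact: Sm.
rewrite -scalerBr nm_half ltr_pdivrMr// opprD addrACA.
by apply: le_lt_trans (nmD _ _) _; lra.
Qed.

(** A minimizing sequence is Cauchy by the parallelogram law. The uniqueness clause is what later
    turns minimality into invariance under unitaries. *)
Lemma min_norm S : S !=set0 -> midpoint_closed S ->
  exists g, [/\ closure S g, forall s, closure S s -> nm g <= nm s &
    forall h, closure S h -> nm h <= nm g -> h = g].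
Proof.
move=> [s0 Ss0] Sm; pose m := inf [set nm s | s in S].
have inS : has_inf [set nm s | s in S].
  by split; [exists (nm s0), s0|exists 0 => _ [s _ <-]; exact: nm_ge0].
have mS s : S s -> m <= nm s by move=> Ss; apply: ge_inf; [exact: inS.2|exists s].
have m0 : 0 <= m by apply: lb_le_inf; [exact: inS.1|move=> _ [s _ <-]; exact: nm_ge0].
have /choice[u uS] : forall n : nat, exists u, S u /\ nm u < m + n.+1%:R^-1.
  move=> n; have [_ [u Su <-] um] := inf_adherent (ltac:(by rewrite invr_gt0) : 0 < n.+1%:R^-1 :> R) inS.
  by exists u.
have mcl s : closure S s -> m <= nm s by move=> /nm_le_closure; apply.
have ucl n : closure S (u n) by apply: subset_closure; exact: (uS n).1.
have [|g ug] := @complete_nm u.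
  move=> e e0.
  (* By [bnd], [midpoint_dist] leaves at most 4 (2m + 1) / (N + 1) for the squared distance. *)
  have [N NN] : exists N : nat, N.+1%:R^-1 < e ^+ 2 / (8 * m + 4).
    by apply: exists_invS; rewrite divr_gt0 ?exprn_gt0//; lra.
  exists N => p q Np Nq; rewrite -ltr_sqr ?nnegrE ?nm_ge0 ?(ltW e0)//.
  have bnd k : (N <= k)%N -> nm (u k) ^+ 2 <= m ^+ 2 + (2 * m + 1) * N.+1%:R^-1.
    move=> Nk; have uk : nm (u k) <= m + N.+1%:R^-1.
      apply/ltW/(lt_le_trans (uS k).2); rewrite lerD2l lef_pV2 ?posrE//.
      by rewrite ler_nat.
    apply: le_trans (_ : (m + N.+1%:R^-1) ^+ 2 <= _).
      by rewrite ler_sqr ?nnegrE ?nm_ge0// addr_ge0.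
    have i1 : 0 <= N.+1%:R^-1 :> R by [].
    have i2 : N.+1%:R^-1 <= 1 :> R by rewrite invf_le1// ler1n.
    by move: (_^-1) i1 i2 => i i1 i2; have := mulr_ge0 i1 (ltac:(lra) : 0 <= 1 - i); lra.
  have := midpoint_dist m0 Sm mS (uS p).1 (uS q).1.
  have := bnd p Np; have := bnd q Nq.
  move: NN; rewrite ltr_pdivlMr; last lra.
  move: (N.+1%:R^-1) => i; lra.
have gS : closure S g.
  apply/closure_nm => e e0; have /cvg_nm/(_ e e0)[N uN] := ug.
  by exists (u N); [exact: (uS N).1|rewrite nmBC; exact: uN].
have gm : nm g = m.
  apply/eqP; rewrite eq_le mcl// andbT; apply: le_eps => e e0.
  have e20 : 0 < e / 2 by lra.
  have /cvg_nm/(_ _ e20)[N uN] := ug.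
  have [M MM] := exists_invS e20.
  have := uN (maxn N M) (leq_maxl _ _); have := (uS (maxn N M)).2.
  have : (maxn N M).+1%:R^-1 <= M.+1%:R^-1 :> R.
    by rewrite lef_pV2 ?posrE// ler_nat ltnS leq_maxr.
  have := nmD (g - u (maxn N M)) (u (maxn N M)); rewrite subrK nmBC.
  move: MM; move: (M.+1%:R^-1) ((maxn N M).+1%:R^-1) => i j; lra.
exists g; split=> // [s Ss|h hS hg]; first by rewrite gm mcl.
apply/eqP; rewrite -subr_eq0; apply/eqP/nm0_eq0/eqP; rewrite -sqrf_eq0 eq_le sqr_ge0 andbT.
apply: le_trans (midpoint_dist m0 (closure_midpoint Sm) mcl hS gS) _.
have := hg; rewrite gm => hm.
have : nm h ^+ 2 <= m ^+ 2 by rewrite ler_sqr ?nnegrE ?nm_ge0.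
lra.
Qed.

(** First variation of the norm along [v]: this is [discriminant_bound] with constant term 0. *)
Lemma min_norm_orth S g v :
  (forall s, closure S s -> nm g <= nm s) -> closure S g ->
  (forall a s, S s -> S (s - a *: v)) -> inner g v = 0.
Proof.
move=> gmin gS Sv.
have gv a : closure S (g - a *: v).
  apply/closure_nm => e e0; have /closure_nm/(_ e e0)[s Ss gs] := gS.
  by exists (s - a *: v); [exact: Sv|rewrite opprB addrA subrK].
apply: eq0_normc; apply/eqP; rewrite -sqrf_eq0 eq_le sqr_ge0 andbT.
rewrite -[leRHS](mul0r (nm v ^+ 2)).
apply: discriminant_bound => [|a]; first exact: sqr_ge0.
have : nm g ^+ 2 <= nm (g - a *: v) ^+ 2 by rewrite ler_sqr ?nnegrE ?nm_ge0 ?gmin.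
rewrite nm_expand; lra.
Qed.

End HilbertGeometry.

(** * Bounded operators *)

Section Operators.
Context {R : realType} {H : hilbertType R}.
Implicit Types (u v w : H) (a : R[i]) (S : set H) (x y : BH H).

Lemma BH_apD x y u : (x + y) u = x u + y u. Proof. by []. Qed.
Lemma BH_apB x y u : (x - y) u = x u - y u. Proof. by []. Qed.
Lemma BH_apZ a x u : (a *: x) u = a *: x u. Proof. by []. Qed.
Lemma BH_apM x y u : (x * y) u = x (y u). Proof. by []. Qed.
Lemma BH_ap1 u : (1 : BH H) u = u. Proof. by []. Qed.
Lemma BH_ap0 u : (0 : BH H) u = 0. Proof. by []. Qed.
Lemma BH_lin x a u v : x (a *: u + v) = a *: x u + x v. Proof. exact: BH_linear. Qed.
Lemma BH_0 x : x 0 = 0.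
Proof. by have := BH_lin x 1 0 0; rewrite !scale1r addr0 => /esym/eqP; rewrite -subr_eq0 addrK => /eqP. Qed.
Lemma BH_D x u v : x (u + v) = x u + x v.
Proof. by rewrite -{1}[u]scale1r BH_lin scale1r. Qed.
Lemma BH_Z x a u : x (a *: u) = a *: x u.
Proof. by rewrite -[a *: u]addr0 BH_lin BH_0 addr0. Qed.
Lemma BH_N x u : x (- u) = - x u. Proof. by rewrite -scaleN1r BH_Z scaleN1r. Qed.
Lemma BH_B x u v : x (u - v) = x u - x v. Proof. by rewrite BH_D BH_N. Qed.

Definition bound_on x (B : R) := 0 <= B /\ forall u, nm (x u) <= B * nm u.

Lemma BH_bounded x : exists B, bound_on x B.
Proof.
have [d d0 dx] : exists2 d : R, 0 < d & forall u, nm u < d -> nm (x u) < 1.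
  have /cvgrPdist_lt/(_ 1 ltr01)/nbhs_ballP[e/= e0 ex] := @BH_continuous _ _ x 0.
  exists (Re e); first by move: e0; rewrite ltcE => /andP[].
  move=> u ue; have /ex/= : ball (0 : H) e u.
    by rewrite -ball_normE/= sub0r normrN nmE (ge0c_Re (ltW e0)) ltcR.
  by rewrite BH_0 sub0r normrN nmE -[1]/(1%:C) ltcR.
exists (2 / d); split=> [|u]; first by rewrite divr_ge0// ltW.
have [u0|u0] := eqVneq (nm u) 0; first by rewrite (nm0_eq0 u0) BH_0 nm0 mulr0.
have {}u0 : 0 < nm u by rewrite lt_def u0 nm_ge0.
pose t := d / (2 * nm u); have t0 : 0 < t by rewrite divr_gt0// mulr_gt0.
have nt : normc t%:C = t by rewrite /= expr0n/= addr0 sqrtr_sqr gtr0_norm.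
have : nm (x (t%:C *: u)) < 1.
  apply: dx; rewrite nmZ nt.
  have -> : t * nm u = d / 2 by rewrite /t; field; rewrite gt_eqF.
  lra.
rewrite BH_Z nmZ nt => /ltW; rewrite -ler_pdivlMl// => /le_trans; apply.
by rewrite mulr1 /t invf_div; have -> : 2 * nm u / d = 2 / d * nm u by field; rewrite gt_eqF.
Qed.

Lemma BH_of (f : H -> H) (B : R) : linear f -> (forall u, nm (f u) <= B * nm u) ->
  exists x, x =1 f.
Proof.
move=> fl fB; suff fb : f \in @bounded_op R H by exists (BoundedOp fb).
apply/bounded_opP; split=> // u; apply/cvgrPdist_lt => e e0.
have e0' : 0 < Re e by move: e0; rewrite ltcE => /andP[].
have d0 : 0 < Re e / (`|B| + 1) by rewrite divr_gt0// ltr_wpDl.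
apply/nbhs_ballP; exists (Re e / (`|B| + 1))%:C; first by rewrite /= ltcR.
move=> v; rewrite -ball_normE/= => uv.
have {}uv : nm (u - v) < Re e / (`|B| + 1) by rewrite -ltcR -nmE.
have -> : f u - f v = f (u - v).
  by have := fl (-1) v u; rewrite !scaleN1r addrC => <-; rewrite addrC.
rewrite nmE (ge0c_Re (ltW e0)) ltcR; apply: le_lt_trans (fB _) _.
move: uv; rewrite ltr_pdivlMr ?ltr_wpDl//; apply: le_lt_trans.
rewrite mulrC ler_wpM2l ?nm_ge0//; have := ler_norm B; lra.
Qed.

Lemma BH_cvg x (u : nat -> H) l : u @ \oo --> l -> x \o u @ \oo --> x l.
Proof. by move=> ul; apply: continuous_cvg => //; exact: BH_continuous. Qed.

Definition subspace (V : lmodType R[i]) (S : set V) :=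
  S 0 /\ forall a (u v : V), S u -> S v -> S (a *: u + v).

Lemma subspace_closure S : subspace S -> subspace (closure S).
Proof.
move=> [S0 Sl]; split; first exact: subset_closure.
move=> a u v /closure_nm Su /closure_nm Sv; apply/closure_nm => e e0.
have d0 : 0 < e / (2 * (normc a + 1)).
  by rewrite divr_gt0// mulr_gt0// ltr_wpDl// normc_ge0.
have e20 : 0 < e / 2 by lra.
have [s Ss us] := Su _ d0; have [t St vt] := Sv _ e20.
exists (a *: s + t); first exact: Sl.
rewrite opprD addrACA -scalerBr; apply: le_lt_trans (nmD _ _) _; rewrite nmZ.
move: us; rewrite ltr_pdivlMr; last by rewrite mulr_gt0// ltr_wpDl// normc_ge0.
have := nm_ge0 (u - s); have := normc_ge0 a; lra.
Qed.

Lemma subspaceZ (V : lmodType R[i]) (S : set V) a (v : V) : subspace S -> S v -> S (a *: v).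
Proof. by move=> [S0 Sl] Sv; rewrite -[_ *: _]addr0; apply: Sl. Qed.
Lemma subspaceD (V : lmodType R[i]) (S : set V) (u v : V) : subspace S -> S u -> S v -> S (u + v).
Proof. by move=> [S0 Sl] Su Sv; rewrite -[u]scale1r; apply: Sl. Qed.
Lemma subspaceN (V : lmodType R[i]) (S : set V) (v : V) : subspace S -> S v -> S (- v).
Proof. by move=> Sl Sv; rewrite -scaleN1r; apply: subspaceZ. Qed.
Lemma subspaceB (V : lmodType R[i]) (S : set V) (u v : V) : subspace S -> S u -> S v -> S (u - v).
Proof. by move=> Sl Su Sv; apply: subspaceD => //; apply: subspaceN. Qed.

Lemma orth_closure S u v : (forall s, S s -> inner u s = 0) -> closure S v -> inner u v = 0.
Proof.
move=> uS /closure_nm Sv; apply: eq0_normc; apply/eqP; rewrite eq_le normc_ge0 andbT.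
apply: le_eps => e e0; rewrite add0r.
have [s Ss vs] := Sv (e / (nm u + 1)) (ltac:(by rewrite divr_gt0// ltr_wpDl// nm_ge0)).
have -> : inner u v = inner u (v - s) by rewrite innerBr (uS s Ss) subr0.
apply: le_trans (inner_CS u (v - s)) _.
move: vs; rewrite ltr_pdivlMr ?ltr_wpDl ?nm_ge0//.
have := nm_ge0 (v - s); lra.
Qed.

Lemma closure_eq0 S v : subspace S -> closure S v -> (forall s, S s -> inner v s = 0) -> v = 0.
Proof. by move=> Ss Sv vS; apply: inner_eq0; apply: orth_closure Sv. Qed.

Lemma closure_ext S u v : subspace S -> closure S u -> closure S v ->
  (forall s, S s -> inner u s = inner v s) -> u = v.
Proof.
move=> Ss Su Sv uv; apply/eqP; rewrite -subr_eq0; apply/eqP; apply: (closure_eq0 Ss).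
  exact: (subspaceB (subspace_closure Ss)).
by move=> s Ss'; rewrite innerBl uv// subrr.
Qed.

Lemma cvg_closure S (u : nat -> H) l : (forall n, S (u n)) -> u @ \oo --> l -> closure S l.
Proof.
move=> uS /cvg_nm ul; apply/closure_nm => e e0; have [N uN] := ul e e0.
by exists (u N) => //; rewrite nmBC; exact: uN.
Qed.

Lemma closure_seq S l : closure S l -> exists u : nat -> H, (forall n, S (u n)) /\ u @ \oo --> l.
Proof.
move=> /closure_nm Sl; have /choice[u uS] : forall n : nat, exists s, S s /\ nm (l - s) < n.+1%:R^-1.
  by move=> n; have [|s Ss ls] := Sl (n.+1%:R^-1); [rewrite invr_gt0|exists s].
exists u; split=> [n|]; first exact: (uS n).1.
apply/cvg_nm => e e0; have [N NN] := exists_invS e0; exists N => n Nn.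
rewrite nmBC; apply: lt_trans (uS n).2 _; apply: le_lt_trans NN.
by rewrite lef_pV2 ?posrE// ler_nat.
Qed.

(** The range is the closure of [S], so that orbits can be used as they are, without being
    closed. *)
Definition projection_on S (Q : BH H) :=
  (forall u, closure S (Q u)) /\ forall u s, S s -> inner (u - Q u) s = 0.

Lemma projection_exists S : subspace S -> exists Q, projection_on S Q.
Proof.
move=> Ss; have Scl := subspace_closure Ss.
have /choice[q qS] : forall u, exists p, closure S p /\ forall s, S s -> inner (u - p) s = 0.
  move=> u; pose C := [set u - s | s in S].
  have C0 : C !=set0 by exists u, 0; [exact: Ss.1|rewrite subr0].
  have Cm : midpoint_closed C.
    move=> _ _ [s s1 <-] [t t1 <-]; exists ((2^-1 : R)%:C *: (s + t)).
      by apply: subspaceZ => //; exact: subspaceD.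
    rewrite addrACA -opprD scalerBr; congr (_ - _).
    by rewrite half_scaleDD.
  have [g [gC gmin _]] := min_norm C0 Cm; exists (u - g); split.
    apply/closure_nm => e e0; have /closure_nm/(_ e e0)[_ [s s1 <-] gs] := gC.
    by exists s => //; rewrite addrAC -opprB nmN.
  move=> s s1; rewrite subKr; apply: (min_norm_orth gmin) => // a _ [t t1 <-].
  exists (t + a *: s); last by rewrite opprD addrA.
  by apply: subspaceD => //; exact: subspaceZ.
have quniq u p : closure S p -> (forall s, S s -> inner (u - p) s = 0) -> q u = p.
  move=> pS up; apply: (closure_ext Ss) => //; first exact: (qS u).1.
  move=> s s1; have := up s s1; have := (qS u).2 s s1.
  by rewrite !innerBl => /eqP; rewrite subr_eq0 => /eqP <- /eqP; rewrite subr_eq0 => /eqP <-.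
have [|u|Q QE] := @BH_of q 1.
- move=> a u v; apply: quniq.
    by apply: Scl.2; exact: (qS _).1.
  move=> s s1; rewrite opprD addrACA -scalerBr innerDl innerZl.
  by rewrite !(qS _).2// mulr0 addr0.
- rewrite mul1r -ler_sqr ?nnegrE ?nm_ge0//.
  have : inner (u - q u) (q u) = 0 by apply: orth_closure (qS u).1; exact: (qS u).2.
  have := nmD_sqr (u - q u) (q u); rewrite subrK => -> ->.
  rewrite /= mulr0 addr0; have := sqr_ge0 (nm (u - q u)); lra.
by exists Q; split=> u; rewrite QE; [exact: (qS u).1|exact: (qS u).2].
Qed.

Section Projection.
Variables (S : set H) (Q : BH H).
Hypotheses (Ss : subspace S) (QS : projection_on S Q).

Lemma proj_in u : closure S (Q u). Proof. exact: QS.1. Qed.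

Lemma proj_orth u s : closure S s -> inner (u - Q u) s = 0.
Proof. by apply: orth_closure => t; exact: QS.2. Qed.

Lemma proj_uniq u p : closure S p -> (forall s, S s -> inner u s = inner p s) -> Q u = p.
Proof.
move=> pS up; apply: (closure_ext Ss) => //; first exact: proj_in.
move=> s s1; rewrite -up//; apply/eqP; rewrite eq_sym -subr_eq0 -innerBl.
by rewrite proj_orth//; exact: subset_closure.
Qed.

Lemma proj_id u : closure S u -> Q u = u.
Proof. by move=> Su; apply: proj_uniq. Qed.

Lemma proj_innerl u s : closure S s -> inner (Q u) s = inner u s.
Proof. by move=> Su; apply/eqP; rewrite eq_sym -subr_eq0 -innerBl proj_orth. Qed.

Lemma proj_selfadj u v : inner (Q u) v = inner u (Q v).
Proof.
rewrite -(proj_innerl u (@proj_in v)) innerC -(proj_innerl v (@proj_in u)).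
by rewrite -innerC.
Qed.

Lemma proj_0 u : (forall s, S s -> inner u s = 0) -> Q u = 0.
Proof.
move=> uS; apply: proj_uniq; first exact: (subspace_closure Ss).1.
by move=> s s1; rewrite uS// inner0l.
Qed.

End Projection.

Lemma closure_stable S x : (forall s, S s -> closure S (x s)) -> forall u, closure S u -> closure S (x u).
Proof.
move=> xS u /closure_seq[s [Sn su]]; apply: closed_closure.
by apply: (@cvg_closure _ (x \o s)) => [n|]; [exact/xS/Sn|exact: BH_cvg].
Qed.

Lemma proj_comm S Q x y : subspace S -> projection_on S Q -> is_adjoint x y ->
  (forall s, S s -> closure S (x s)) -> (forall s, S s -> closure S (y s)) ->
  Q * x = x * Q.
Proof.
move=> Ss QS xy xS yS; apply: BH_inj => u; rewrite !BH_apM; apply: (proj_uniq Ss QS).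
  by apply: closure_stable => //; exact: (proj_in QS).
by move=> s s1; rewrite !xy (proj_innerl QS)//; exact: yS.
Qed.

(** The functionals to represent are given on operators [a] and bounded by |a zeta|; the map [io]
    avoids having to factor them through the vectors a zeta. The representing vector is a multiple
    of the minimal norm element in the closure of the image of {f = 1}. *)
Lemma Riesz (V : lmodType R[i]) (S : set V) (io : V -> H) (f : V -> R[i]) (K : R) :
  subspace S -> (forall a (u v : V), S u -> S v -> io (a *: u + v) = a *: io u + io v) ->
  (forall a (u v : V), S u -> S v -> f (a *: u + v) = a * f u + f v) ->
  (forall v : V, S v -> normc (f v) <= K * nm (io v)) ->
  exists k, closure (io @` S) k /\ forall v : V, S v -> f v = inner (io v) k.
Proof.
move=> Ss iol fl fK.
have io0 : io 0 = 0.
  by have := iol 1 0 0 Ss.1 Ss.1; rewrite !scale1r addr0 => /esym/eqP; rewrite -subr_eq0 addrK => /eqP.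
have ioS : subspace (io @` S).
  split; first by exists 0 => //; exact: Ss.1.
  move=> a _ _ [u Su <-] [v Sv <-]; exists (a *: u + v); first exact: Ss.2.
  exact: iol.
have [f0|/existsNP[v0 /not_implyP[Sv0 fv0]]] := pselect (forall v : V, S v -> f v = 0).
  exists 0; split=> [|v Sv]; first exact: subset_closure ioS.1.
  by rewrite f0// inner0r.
pose C := io @` [set v | S v /\ f v = 1].
have fZ a (v : V) : S v -> f (a *: v) = a * f v.
  move=> Sv; have f0 : f 0 = 0.
    by have := fl 1 0 0 Ss.1 Ss.1; rewrite !scale1r addr0 mul1r => /esym/eqP; rewrite -subr_eq0 addrK => /eqP.
  by rewrite -[_ *: _]addr0 fl ?f0 ?addr0//; exact: Ss.1.
have ioZ a (v : V) : S v -> io (a *: v) = a *: io v.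
  by move=> Sv; rewrite -[_ *: _]addr0 iol ?io0 ?addr0//; exact: Ss.1.
have fv0' : f v0 != 0 by apply/eqP.
have C0 : C !=set0.
  exists (io ((f v0)^-1 *: v0)); exists ((f v0)^-1 *: v0) => //; split; first exact: subspaceZ.
  by rewrite fZ// mulVf.
have half2 : ((2^-1 : R)%:C * (1 + 1)) = 1 :> R[i].
  by apply/eqP; rewrite eq_complex/=; apply/andP; split; apply/eqP; field.
have Cm : midpoint_closed C.
  move=> _ _ [u [Su fu] <-] [v [Sv fv] <-].
  exists ((2^-1 : R)%:C *: (1 *: u + v)).
    split; first by apply: subspaceZ => //; exact: Ss.2.
    by rewrite fZ; [rewrite fl// fu fv mulr1|exact: Ss.2].
  by rewrite ioZ; [rewrite iol// scale1r|exact: Ss.2].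
have [g [gC gmin _]] := min_norm C0 Cm.
have gorth (v : V) : S v -> f v = 0 -> inner g (io v) = 0.
  move=> Sv fv; apply: (min_norm_orth gmin) => // a _ [u [Su fu] <-].
  exists ((- a) *: v + u); last by rewrite iol// scaleNr addrC.
  by split; [exact: Ss.2|rewrite fl// fv mulr0 add0r].
have gS : closure (io @` S) g.
  by move: gC; apply: closure_subset => _ [u [Su fu] <-]; exists u.
pose v1 := (f v0)^-1 *: v0; have Sv1 : S v1 by exact: subspaceZ.
have fv1 : f v1 = 1 by rewrite fZ// mulVf.
have gg : inner g (g - io v1) = 0.
  apply: (@orth_closure [set c - io v1 | c in C]) => [_ [_ [u [Su fu] <-] <-]|].
    have -> : io u - io v1 = io ((- 1) *: v1 + u) by rewrite iol// scaleN1r addrC.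
    by apply: gorth; [exact: Ss.2|rewrite fl// fu fv1 mulr1 addNr].
  apply/closure_nm => e e0; have /closure_nm/(_ e e0)[c Cc gc] := gC.
  by exists (c - io v1); [exists c|rewrite opprD addrACA opprK addNr addr0].
(* The minimal vector is nonzero: [f u = 1] forces 1 <= K |io u|, which keeps the image of {f = 1}
   away from 0. *)
have g0 : inner g g != 0.
  apply/eqP => /inner_eq0 g0; have K0 : 0 < `|K| + 1 by rewrite ltr_wpDl.
  have [|_ [u [Su fu] <-]] := (closure_nm _ _).1 gC (`|K| + 1)^-1; first by rewrite invr_gt0.
  rewrite g0 sub0r nmN => ul; have := fK u Su; rewrite fu normc1.
  move: ul; rewrite -[_^-1]mul1r ltr_pdivlMr// mulrC.
  by have := nm_ge0 (io u); have := ler_norm K; nra.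
have gv1 : inner (io v1) g = inner g g.
  by rewrite innerC [RHS]innerC; congr (_^*%R); apply/eqP; rewrite eq_sym -subr_eq0 -innerBr gg.
exists ((inner g g)^-1 *: g); split; first exact: subspaceZ (subspace_closure ioS) gS.
move=> v Sv; rewrite innerZr; have -> : (inner g g)^-1^*%R = (inner g g)^-1.
  by rewrite inner_nm -fmorphV conj_real.
have : inner (io v - f v *: io v1) g = 0.
  have -> : io v - f v *: io v1 = io ((- f v) *: v1 + v) by rewrite iol// scaleNr addrC.
  rewrite innerC gorth ?rmorph0//; first exact: Ss.2.
  by rewrite fl// fv1 mulr1 addNr.
rewrite innerBl innerZl gv1 => /eqP; rewrite subr_eq0 => /eqP ->.
by rewrite mulrCA mulVf// mulr1.
Qed.

Lemma adjoint_exists x : exists y, is_adjoint x y.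
Proof.
have [B [B0 xB]] := BH_bounded x.
have /choice[f fE] v : exists k, forall u, inner (x u) v = inner u k.
  have [|a u w _ _|a u w _ _|u _|k [_ kE]] :=
    @Riesz H setT id (fun u => inner (x u) v) (B * nm v).
  - by split.
  - by [].
  - by rewrite BH_lin innerDl innerZl.
  - apply: le_trans (inner_CS _ _) _; rewrite mulrAC.
    by rewrite ler_wpM2r ?nm_ge0.
  - by exists k => u; exact: kE.
have [|v|y yE] := @BH_of f B.
- move=> a u v; apply: inner_ext => w; rewrite innerC -fE [RHS]innerC.
  by congr (_^*%R); rewrite !innerDr !innerZr !fE.
- have [->|f0] := eqVneq (nm (f v)) 0; first by rewrite mulr_ge0 ?nm_ge0.
  have {}f0 : 0 < nm (f v) by rewrite lt_def f0 nm_ge0.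
  rewrite -(ler_pM2r f0) -expr2; have := fE v (f v); rewrite inner_nm => H1.
  have := inner_CS (x (f v)) v; rewrite H1 normc_real ger0_norm ?sqr_ge0 => // /le_trans; apply.
  by rewrite mulrAC ler_wpM2r ?nm_ge0.
by exists y => u v; rewrite yE.
Qed.

(** [T] is the adjoint of the operator sending [w] to the vector that represents v |-> <ka v, w>.
    This replaces an extension by continuity, and since these vectors lie in the closure of the
    image of [io], [T] vanishes on the orthogonal complement. *)
Lemma operator_extension (V : lmodType R[i]) (S : set V) (io ka : V -> H) (K : R) :
  subspace S -> (forall a (u v : V), S u -> S v -> io (a *: u + v) = a *: io u + io v) ->
  (forall a (u v : V), S u -> S v -> ka (a *: u + v) = a *: ka u + ka v) ->
  (forall v : V, S v -> nm (ka v) <= K * nm (io v)) ->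
  exists T : BH H, (forall v : V, S v -> T (io v) = ka v) /\
    (forall u, (forall v : V, S v -> inner u (io v) = 0) -> T u = 0).
Proof.
move=> Ss iol kal kaK.
have io0 : io 0 = 0.
  by have := iol 1 0 0 Ss.1 Ss.1; rewrite !scale1r addr0 => /esym/eqP; rewrite -subr_eq0 addrK => /eqP.
have ioS : subspace (io @` S).
  split; first by exists 0 => //; exact: Ss.1.
  move=> a _ _ [u Su <-] [v Sv <-]; exists (a *: u + v); first exact: Ss.2.
  exact: iol.
have /choice[f fE] w : exists k, closure (io @` S) k /\ forall v : V, S v -> inner (ka v) w = inner (io v) k.
  have [//|//|a u v Su Sv|v Sv|k kE] := @Riesz V S io (fun v : V => inner (ka v) w) (K * nm w).
  - by rewrite kal// innerDl innerZl.
  - apply: le_trans (inner_CS _ _) _; rewrite mulrAC.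
    by rewrite ler_wpM2r ?nm_ge0// kaK.
  by exists k.
have [|w|y yE] := @BH_of f `|K|.
- move=> a u v; apply: (closure_ext ioS); first exact: (fE _).1.
    by apply: (subspace_closure ioS).2; exact: (fE _).1.
  move=> _ [s s1 <-]; rewrite innerC [RHS]innerC -(fE _).2//.
  by congr (_^*%R); rewrite !innerDr !innerZr !(fE _).2.
- have [->|f0] := eqVneq (nm (f w)) 0; first by rewrite mulr_ge0 ?nm_ge0.
  have {}f0 : 0 < nm (f w) by rewrite lt_def f0 nm_ge0.
  rewrite -(ler_pM2r f0) -expr2; apply: le_eps => e e0.
  have [_ [s s1 <-] fs] := (closure_nm _ _).1 (fE w).1 (e / (nm (f w) + `|K| * nm w + 1))
    (ltac:(by rewrite divr_gt0// ltr_wpDl// addr_ge0 ?mulr_ge0 ?nm_ge0)).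
  move: fs; rewrite ltr_pdivlMr ?ltr_wpDl// ?addr_ge0 ?mulr_ge0 ?nm_ge0// => fs.
  have -> : nm (f w) ^+ 2 = Re (inner (f w - io s) (f w)) + Re (inner (io s) (f w)).
    by rewrite -ReD -innerDl subrK inner_nm.
  have h1 : Re (inner (f w - io s) (f w)) <= nm (f w - io s) * nm (f w).
    by apply: le_trans (Re_le_normc _) _; exact: inner_CS.
  have h2 : Re (inner (io s) (f w)) <= `|K| * nm (io s) * nm w.
    rewrite -(fE w).2//; apply: le_trans (Re_le_normc _) _.
    apply: le_trans (inner_CS _ _) _; rewrite ler_wpM2r ?nm_ge0//.
    by apply: le_trans (kaK s s1) _; rewrite ler_wpM2r ?nm_ge0// ler_norm.
  have h3 : nm (io s) <= nm (f w) + nm (f w - io s).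
    by rewrite (nmBC (f w)); have := nmD (f w) (io s - f w); rewrite addrC subrK.
  have h4 : `|K| * nm (io s) * nm w <= `|K| * (nm (f w) + nm (f w - io s)) * nm w.
    by rewrite ler_wpM2r ?nm_ge0// ler_wpM2l.
  by have := nm_ge0 (f w - io s); lra.
have [T Ty] := adjoint_exists y; exists T; split.
  move=> v Sv; apply: inner_ext => w; rewrite innerC.
  have -> : inner w (T (io v)) = inner (y w) (io v) by rewrite Ty.
  by rewrite yE -innerC -(fE w).2.
move=> u uS; apply: inner_ext => w; rewrite inner0l innerC -Ty yE innerC conjCK.
apply: orth_closure (fE w).1 => _ [v Sv <-]; exact: uS.
Qed.

End Operators.

(** * Square roots of positive operators *)

Section Limits.
Context {R : realType} {H : hilbertType R}.
Implicit Types (u v w : nat -> H) (l m : H).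

Lemma cvg_uniq u l m : u @ \oo --> l -> u @ \oo --> m -> l = m.
Proof. by move=> ul um; apply: (cvg_unique (@norm_hausdorff _ H)) ul um. Qed.

Lemma nm_cvg_le u l (C : R) : u @ \oo --> l -> (forall n, nm (u n) <= C) -> nm l <= C.
Proof.
move=> /cvg_nm ul uC; apply: le_eps => e e0; have [N /(_ N (leqnn N)) uN] := ul e e0.
have := nmD (l - u N) (u N); rewrite subrK nmBC; have := uC N; lra.
Qed.

Lemma cvg_nm_bounded u l : u @ \oo --> l -> exists N, forall n, (N <= n)%N -> nm (u n) <= nm l + 1.
Proof.
move=> /cvg_nm/(_ 1 ltr01)[N uN]; exists N => n Nn; have := uN n Nn.
have := nmD (u n - l) l; rewrite subrK; lra.
Qed.

Lemma inner_cvg u v l m (e : R) : 0 < e -> u @ \oo --> l -> v @ \oo --> m ->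
  exists N, forall n, (N <= n)%N -> normc (inner (u n) (v n) - inner l m) < e.
Proof.
move=> e0 ul vm; have [N1 h1] := cvg_nm_bounded vm.
have A0 : 0 < nm m + 1 by rewrite ltr_wpDl ?nm_ge0.
have B0 : 0 < nm l + 1 by rewrite ltr_wpDl ?nm_ge0.
have d1 : 0 < e / 2 / (nm m + 1) by rewrite divr_gt0// divr_gt0.
have d2 : 0 < e / 2 / (nm l + 1) by rewrite divr_gt0// divr_gt0.
have /cvg_nm/(_ _ d1)[N2 h2] := ul; have /cvg_nm/(_ _ d2)[N3 h3] := vm.
exists (maxn N1 (maxn N2 N3)) => n; rewrite !geq_max => /and3P[n1 n2 n3].
have -> : inner (u n) (v n) - inner l m = inner (u n - l) (v n) + inner l (v n - m).
  by rewrite innerBl innerBr addrA subrK.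
apply: le_lt_trans (le_normcD _ _) _.
have := inner_CS (u n - l) (v n); have := inner_CS l (v n - m).
have := h1 n n1; have := h2 n n2; have := h3 n n3; rewrite !ltr_pdivlMr//.
have := nm_ge0 (u n - l); have := nm_ge0 (v n - m); have := nm_ge0 (v n); have := nm_ge0 l.
by move: (nm (u n - l)) (nm (v n - m)) (nm (v n)) (nm l) (nm m) => a b c d f; nra.
Qed.

Lemma inner_lim_eq u v u' v' l m l' m' :
  u @ \oo --> l -> v @ \oo --> m -> u' @ \oo --> l' -> v' @ \oo --> m' ->
  (forall n, inner (u n) (v n) = inner (u' n) (v' n)) -> inner l m = inner l' m'.
Proof.
move=> ul vm ul' vm' E; apply/eqP; rewrite -subr_eq0; apply/eqP/eq0_normc/eqP.
rewrite eq_le normc_ge0 andbT; apply: le_eps => e e0.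
have e20 : 0 < e / 2 by lra.
have [N hN] := inner_cvg e20 ul vm; have [M hM] := inner_cvg e20 ul' vm'.
have := hN (maxn N M) (leq_maxl _ _); have := hM (maxn N M) (leq_maxr _ _).
rewrite -E; move: (inner (u _) _) => z.
have := le_normcD (z - inner l' m') (- (z - inner l m)).
rewrite normcN; have -> : z - inner l' m' - (z - inner l m) = inner l m - inner l' m' by ring.
lra.
Qed.

Lemma inner_lim_ge0 u v l m : u @ \oo --> l -> v @ \oo --> m ->
  (forall n, 0 <= inner (u n) (v n)) -> 0 <= inner l m.
Proof.
move=> ul vm E; have key (e : R) : 0 < e -> `|complex.Im (inner l m)| <= e /\ - e <= Re (inner l m).
  move=> e0; have [N /(_ N (leqnn N))] := inner_cvg e0 ul vm.
  rewrite (ge0c_Re (E N)); move: (E N); rewrite lecE/= => /andP[_].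
  move: (Re (inner (u N) _)) (inner l m) => a [b c] a0 /=.
  rewrite sub0r sqrrN => /ltW h.
  have h1 : `|a - b| <= e.
    by rewrite -sqrtr_sqr; apply: le_trans h; rewrite ler_wsqrtr// lerDl sqr_ge0.
  split; last by move: h1; rewrite ler_norml => /andP[]; lra.
  by rewrite -sqrtr_sqr; apply: le_trans h; rewrite ler_wsqrtr// lerDr sqr_ge0.
rewrite lecE/=; apply/andP; split.
  rewrite -normr_eq0 eq_le normr_ge0 andbT; apply: le_eps => e e0.
  by rewrite add0r; exact: (key e e0).1.
by rewrite -oppr_le0; apply: le_eps => e e0; have := (key e e0).2; lra.
Qed.

End Limits.

Section SquareRoot.
Context {R : realType} {H : hilbertType R}.
Implicit Types (u v w : H) (a b c x y T : BH H).

Definition selfadj T := is_adjoint T T.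

(** The increments of a bounded increasing real sequence dominate those of the operators and make
    them strongly Cauchy. *)
Lemma op_limit (b : nat -> BH H) (r : nat -> R) (M : R) :
  (forall n, r n <= M) ->
  (forall n u, nm (b n.+1 u - b n u) <= (r n.+1 - r n) * nm u) ->
  (forall n u, nm (b n u) <= M * nm u) ->
  exists b' : BH H, forall u, (fun n => b n u) @ \oo --> b' u.
Proof.
move=> rM br bM.
(* The estimate yields the monotonicity of [r] only if [H] has a nonzero vector; the zero space is
   treated apart. *)
have rmon n : r n <= r n.+1 \/ forall u, nm u = 0.
  have [|h] := pselect (forall u, nm u = 0); first by right.
  left; have /existsNP[u u0] := h; have := br n u.
  have {}u0 : 0 < nm u by rewrite lt_def nm_ge0 andbT; apply/eqP.
  by move=> /(le_trans (nm_ge0 _)); rewrite pmulr_lge0// subr_ge0.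
have [triv|nt] := pselect (forall u, nm u = 0).
  exists 0 => u; apply/cvg_nm => e e0; exists 0%N => n _.
  by rewrite triv.
have {}rmon n : r n <= r n.+1 by have [] := rmon n.
have rmono m n : (m <= n)%N -> r m <= r n by move: m n; apply/nondecreasing_seqP.
have bmn m n u : (m <= n)%N -> nm (b n u - b m u) <= (r n - r m) * nm u.
  move=> /subnK<-; elim: (n - m)%N => [|k IH]; first by rewrite add0n !subrr nm0 mul0r.
  rewrite addSn.
  have -> : b (k + m).+1 u - b m u = (b (k + m).+1 u - b (k + m)%N u) + (b (k + m)%N u - b m u).
    by rewrite addrA subrK.
  apply: le_trans (nmD _ _) _; have := br (k + m)%N u; lra.
have /choice[f fE] u : exists l : H, (fun n => b n u) @ \oo --> l.
  apply: complete_nm => e e0.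
  have rs : has_sup (range r) by split; [exists (r 0), 0%N|exists M => _ [n _ <-]].
  have d0 : 0 < e / (2 * (nm u + 1)) by rewrite divr_gt0// mulr_gt0// ltr_wpDl ?nm_ge0.
  have [_ [N _ <-] rN] := sup_adherent d0 rs; exists N.
  have key k : (N <= k)%N -> nm (b k u - b N u) < e / 2.
    move=> Nk; apply: le_lt_trans (bmn _ _ _ Nk) _.
    have rk : r k <= sup (range r) by apply: ub_le_sup; [exact: rs.2|exists k].
    have : r k - r N < e / (2 * (nm u + 1)) by move: rN rk; lra.
    rewrite ltr_pdivlMr; last by rewrite mulr_gt0// ltr_wpDl ?nm_ge0.
    have := rmono _ _ Nk; have := nm_ge0 u; nra.
  move=> m n Nm Nn; have := nmD (b m u - b N u) (- (b n u - b N u)).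
  rewrite nmN opprB addrA subrK; have := key m Nm; have := key n Nn; lra.
have [||b' b'E] := @BH_of _ _ f M.
- move=> z u v; apply: (cvg_uniq (fE _)).
  have -> : (fun n => b n (z *: u + v)) = (fun n => z *: b n u + b n v).
    by apply/funext => n; rewrite BH_lin.
  by apply: cvgD; [apply: cvgZr; exact: fE|exact: fE].
- by move=> u; apply: (nm_cvg_le (fE u)) => n; exact: bM.
by exists b' => u; rewrite b'E; exact: fE.
Qed.

Section Contraction.
Variable a : BH H.
Hypotheses (a_sa : selfadj a) (a1 : forall u, nm (a u) <= nm u).

Let half : R[i] := (2^-1 : R)%:C.

(** With s = 1 - b, the equation s^2 = 1 - a reads b = (a + b^2) / 2; this is its fixed point
    iteration from 0. [sqrt_rad] is the same iteration with the number 1 in place of [a], and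
    majorizes the norms and the increments. *)
Fixpoint sqrt_iter n : BH H := if n is n'.+1 then half *: (a + sqrt_iter n' * sqrt_iter n') else 0.
Fixpoint sqrt_rad n : R := if n is n'.+1 then (1 + sqrt_rad n' ^+ 2) / 2 else 0.

Let iter0 : sqrt_iter 0 = 0. Proof. by []. Qed.
Let iterS n : sqrt_iter n.+1 = half *: (a + sqrt_iter n * sqrt_iter n). Proof. by []. Qed.
Let radS n : sqrt_rad n.+1 = (1 + sqrt_rad n ^+ 2) / 2. Proof. by []. Qed.

Lemma sqrt_rad_bnd n : 0 <= sqrt_rad n <= 1.
Proof. by elim: n => [|n /andP[h1 h2]]/=; rewrite ?lexx ?ler01//; apply/andP; split; nra. Qed.

Lemma sqrt_iter_bnd n u : nm (sqrt_iter n u) <= sqrt_rad n * nm u.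
Proof.
elim: n u => [|n IH] u; first by rewrite iter0 BH_ap0 nm0 mul0r.
rewrite iterS radS.
rewrite BH_apZ BH_apD BH_apM nm_half ler_pdivrMr//.
apply: le_trans (nmD _ _) _; have := a1 u; have := IH (sqrt_iter n u); have := IH u.
have := sqrt_rad_bnd n; move=> /andP[h1 _]; nra.
Qed.

Lemma sqrt_iter_diff n u :
  nm (sqrt_iter n.+1 u - sqrt_iter n u) <= (sqrt_rad n.+1 - sqrt_rad n) * nm u.
Proof.
elim: n u => [|n IH] u.
  rewrite iterS radS iter0 /sqrt_rad BH_ap0 subr0 BH_apZ BH_apD BH_apM BH_ap0 addr0 nm_half.
  have := a1 u; lra.
rewrite [sqrt_iter n.+2]iterS [sqrt_rad n.+2]radS.
set p := sqrt_iter n.+1; set r := sqrt_rad n.+1.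
rewrite -BH_apB; have -> : half *: (a + p * p) - p = half *: (p * (p - sqrt_iter n) + (p - sqrt_iter n) * sqrt_iter n).
  rewrite [X in _ - X](iterS n) -scalerBr; congr (_ *: _).
  by rewrite mulrBr mulrBl addrA subrK opprD addrACA subrr add0r.
have h1 := IH u; have h2 := IH (sqrt_iter n u).
have h3 := sqrt_iter_bnd n.+1 ((p - sqrt_iter n) u).
have h4 := sqrt_iter_bnd n u.
rewrite BH_apZ nm_half ler_pdivrMr// BH_apD !BH_apM.
apply: le_trans (nmD _ _) _.
have := sqrt_rad_bnd n => /andP[h5 h6]; have := sqrt_rad_bnd n.+1 => /andP[h7 h8].
rewrite -/p -/r in h1 h2 h3 h7 h8 *; rewrite -!BH_apB in h1 h2 *.
have hr : (1 + r ^+ 2) / 2 - r = (r + sqrt_rad n) * (r - sqrt_rad n) / 2.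
  by rewrite {2}/r radS; field.
have hm : sqrt_rad n <= r.
  by rewrite /r radS -subr_ge0; have := sqr_ge0 (1 - sqrt_rad n); lra.
rewrite hr; have := nm_ge0 u.
move: (nm (sqrt_iter n u)) h2 h4 => y h2 h4.
move: (nm ((p - sqrt_iter n) u)) h1 h3 => x h1 h3.
move: (nm (p _)) h3 => z h3; move: (nm ((p - _) _)) h2 => t h2.
move: (sqrt_rad n) (nm u) h1 h2 h3 h4 h5 hm => s U h1 h2 h3 h4 h5 hm U0.
have k1 : r * x <= r * ((r - s) * U) by rewrite ler_wpM2l.
have k2 : (r - s) * y <= (r - s) * (s * U) by rewrite ler_wpM2l// subr_ge0.
lra.
Qed.

Lemma sqrt_iter_selfadj n : selfadj (sqrt_iter n).
Proof.
elim: n => [|n IH] u v; first by rewrite iter0 !BH_ap0 inner0l inner0r.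
rewrite iterS !BH_apZ !BH_apD !BH_apM innerZl innerZr !innerDl !innerDr.
by rewrite a_sa !IH conj_real.
Qed.

Lemma sqrt_iter_comm c n : a * c = c * a -> sqrt_iter n * c = c * sqrt_iter n.
Proof.
move=> ac; elim: n => [|n IH]; first by rewrite iter0 mul0r mulr0.
apply: BH_inj => u; rewrite iterS !BH_apM !BH_apZ !BH_apD !BH_apM BH_Z BH_D.
have E x y : x * y = y * x -> forall v, x (y v) = y (x v).
  by move=> xy v; rewrite -!BH_apM xy.
by rewrite (E _ _ ac) (E _ _ IH) (E _ _ IH).
Qed.

Lemma sqrt_one_minus : exists s, [/\ selfadj s, s * s = 1 - a &
  forall c, a * c = c * a -> s * c = c * s].
Proof.
have [||n u|b bE] := @op_limit sqrt_iter sqrt_rad 1.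
- by move=> n; have /andP[] := sqrt_rad_bnd n.
- exact: sqrt_iter_diff.
- apply: le_trans (sqrt_iter_bnd n u) _; have /andP[_] := sqrt_rad_bnd n.
  by move=> h; rewrite ler_wpM2r// nm_ge0.
have bb : b = half *: (a + b * b).
  apply: BH_inj => u; apply: (cvg_uniq (bE u)).
  suff h : (fun n => sqrt_iter n (sqrt_iter n u)) @ \oo --> b (b u).
    rewrite -(cvg_shiftS (fun n => sqrt_iter n u)) BH_apZ BH_apD BH_apM.
    by apply: cvgZr; apply: cvgD => //; exact: cvg_cst.
  apply/cvg_nm => e e0; have e20 : 0 < e / 2 by lra.
  have [N1 h1] := (cvg_nm _ _).1 (bE u) _ e20.
  have [N2 h2] := (cvg_nm _ _).1 (bE (b u)) _ e20.
  exists (maxn N1 N2) => n; rewrite geq_max => /andP[n1 n2].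
  have -> : sqrt_iter n (sqrt_iter n u) - b (b u) =
      sqrt_iter n (sqrt_iter n u - b u) + (sqrt_iter n (b u) - b (b u)).
    by rewrite BH_B addrA subrK.
  apply: le_lt_trans (nmD _ _) _; have := h1 n n1; have := h2 n n2.
  have := sqrt_iter_bnd n (sqrt_iter n u - b u); have /andP[_] := sqrt_rad_bnd n.
  have := nm_ge0 (sqrt_iter n u - b u); nra.
exists (1 - b); split.
- move=> u v; rewrite !BH_apB !BH_ap1 innerBl innerBr; congr (_ - _).
  apply: (inner_lim_eq (bE u) (cvg_cst v) (cvg_cst u) (bE v)) => n.
  exact: sqrt_iter_selfadj.
- rewrite mulrBr mulr1 mulrBl mul1r.
  have : b + b = a + b * b.
    have hh : (half + half) *: (a + b * b) = a + b * b.
      have -> : half + half = 1; last by rewrite scale1r.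
      by apply/eqP; rewrite eq_complex/= addr0 eqxx andbT; apply/eqP; field.
    by rewrite -[RHS]hh scalerDl -bb.
  move=> E; have -> : b * b = b + b - a by rewrite E addrAC subrr add0r.
  have -> : b - (b + b - a) = a - b by rewrite opprB addrCA opprD addNKr.
  by rewrite opprB addrA subrK.
move=> c ac; rewrite mulrBl mulrBr mul1r mulr1; congr (_ - _).
apply: BH_inj => u; rewrite !BH_apM; apply: (cvg_uniq (bE _)).
have -> : (fun n => sqrt_iter n (c u)) = c \o (fun n => sqrt_iter n u).
  by apply/funext => n /=; rewrite -!BH_apM sqrt_iter_comm.
exact: BH_cvg.
Qed.

End Contraction.

Lemma positive_CS T u v : selfadj T -> positive_op T ->
  normc (inner (T u) v) ^+ 2 <= Re (inner (T u) u) * Re (inner (T v) v).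
Proof.
move=> Tsa Tpos; have pos w : 0 <= Re (inner (T w) w).
  by have := Tpos w; rewrite lecE/= => /andP[].
apply: discriminant_bound => // z.
have := pos (u - z *: v); rewrite BH_B BH_Z innerBl !innerBr !innerZl !innerZr.
have -> : inner (T v) u = (inner (T u) v)^*%R by rewrite Tsa -innerC.
rewrite !ReB [z * (z^*%R * _)]mulrA mulJc ReZ.
have -> : Re (z * (inner (T u) v)^*%R) = Re (z^*%R * inner (T u) v).
  by rewrite -(complexRe_conj (z * _)) rmorphM/= conjCK.
lra.
Qed.

(** After scaling by t = 1 / (B + 1), [sqrt_one_minus] applies to 1 - t T. This is a contraction
    because |T u|^2 <= (B + 1) <T u, u>, an instance of [positive_CS] at u and T u. *)
Lemma sqrt_exists T : selfadj T -> positive_op T ->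
  exists s, [/\ selfadj s, s * s = T & forall c, T * c = c * T -> s * c = c * s].
Proof.
move=> Tsa Tpos; have [B [B0 TB]] := BH_bounded T.
have C0 : 0 < B + 1 by rewrite ltr_wpDl.
have pos w : 0 <= Re (inner (T w) w) by have := Tpos w; rewrite lecE/= => /andP[].
pose t := (B + 1)^-1; have t0 : 0 < t by rewrite invr_gt0.
pose a : BH H := 1 - t%:C *: T.
have [|u|s [ssa ss sc]] := @sqrt_one_minus a.
- by move=> u v; rewrite !BH_apB !BH_apZ innerBl innerBr innerZl innerZr conj_real Tsa.
- rewrite -ler_sqr ?nnegrE ?nm_ge0// BH_apB BH_ap1 BH_apZ nm_expand conj_real ReZ normc_real ger0_norm ?(ltW t0)//.
  have h : nm (T u) ^+ 2 <= (B + 1) * Re (inner (T u) u).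
    have [->|Tu0] := eqVneq (nm (T u)) 0; first by rewrite expr0n/= mulr_ge0// ltW.
    have {}Tu0 : 0 < nm (T u) ^+ 2 by rewrite exprn_gt0// lt_def Tu0 nm_ge0.
    rewrite -(ler_pM2l Tu0) -expr2.
    have := positive_CS u (T u) Tsa Tpos; rewrite inner_nm normc_real ger0_norm ?sqr_ge0// => /le_trans; apply.
    have h1 : Re (inner (T (T u)) (T u)) <= (B + 1) * nm (T u) ^+ 2.
      apply: le_trans (Re_le_normc _) _; apply: le_trans (inner_CS _ _) _.
      have := TB (T u); have := nm_ge0 (T u); nra.
    by have := pos u; nra.
  have e : Re (inner u (T u)) = Re (inner (T u) u) by rewrite -Tsa.
  rewrite e; have t1 : t * (B + 1) = 1 by rewrite mulVf// gt_eqF.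
  have : t ^+ 2 * nm (T u) ^+ 2 <= t ^+ 2 * ((B + 1) * Re (inner (T u) u)).
    by rewrite ler_wpM2l// sqr_ge0.
  have -> : t ^+ 2 * ((B + 1) * Re (inner (T u) u)) = (t * (B + 1)) * (t * Re (inner (T u) u)) by ring.
  by rewrite t1 mul1r; have := mulr_ge0 (ltW t0) (pos u); lra.
pose q := (Num.sqrt (B + 1))%:C : R[i].
exists (q *: s); split.
- by move=> u v; rewrite !BH_apZ innerZl innerZr conj_real ssa.
- apply: BH_inj => u; rewrite BH_apM !BH_apZ BH_Z scalerA -BH_apM ss BH_apB BH_ap1 BH_apB BH_ap1.
  rewrite subKr BH_apZ scalerA; have -> : q * q * t%:C = 1; last by rewrite scale1r.
  rewrite /q -!rmorphM /= -expr2 sqr_sqrtr ?(ltW C0)//.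
  by apply/eqP; rewrite eq_complex/= eqxx andbT mulfV// gt_eqF.
move=> c Tc; have ac : a * c = c * a.
  apply: BH_inj => u; rewrite !BH_apM !BH_apB !BH_ap1 !BH_apZ BH_B BH_Z.
  by congr (_ - _ *: _); rewrite -!BH_apM Tc.
by apply: BH_inj => u; rewrite !BH_apM !BH_apZ BH_Z -!BH_apM sc.
Qed.

End SquareRoot.

(** * The Hilbert space l2(H) *)

Section ComplexSequences.
Context {R : realType}.
Implicit Types (z w : nat -> R[i]) (l m : R[i]).

Lemma cvg_normc z l : (z : nat -> R[i]^o) @ \oo --> (l : R[i]^o) <->
  forall e : R, 0 < e -> exists N, forall n, (N <= n)%N -> normc (z n - l) < e.
Proof.
split=> [/cvgrPdist_lt ul e e0|ul].
  have /ul[N _ uN] : 0 < e%:C by rewrite ltcR.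
  by exists N => n Nn; have := uN n Nn; rewrite /= distrC normcC ltcR.
apply/cvgrPdist_lt => e e0; have e0' : 0 < Re e by move: e0; rewrite ltcE => /andP[].
have [N uN] := ul _ e0'; exists N => // n /= Nn.
by rewrite distrC normcC (ge0c_Re (ltW e0)) ltcR uN.
Qed.

Lemma cvgC_uniq z l m : (z : nat -> R[i]^o) @ \oo --> (l : R[i]^o) ->
  (z : nat -> R[i]^o) @ \oo --> (m : R[i]^o) -> l = m.
Proof. by move=> zl zm; apply: (cvg_unique (@norm_hausdorff _ R[i]^o)) zl zm. Qed.

Lemma normc_le_ReIm l : normc l <= `|Re l| + `|complex.Im l|.
Proof.
case: l => a b /=; rewrite -ler_sqr ?nnegrE ?sqrtr_ge0 ?addr_ge0//.
rewrite sqr_sqrtr ?addr_ge0 ?sqr_ge0// -(real_normK (num_real a)) -(real_normK (num_real b)).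
have := normr_ge0 a; have := normr_ge0 b; nra.
Qed.

Lemma ReIm_le_normc l : `|Re l| <= normc l /\ `|complex.Im l| <= normc l.
Proof.
by case: l => a b /=; split; rewrite -sqrtr_sqr ler_wsqrtr// ?lerDl ?lerDr sqr_ge0.
Qed.

Lemma cvg_complex (a b : nat -> R) (c d : R) : a @ \oo --> c -> b @ \oo --> d ->
  (fun n => a n +i* b n : R[i]^o) @ \oo --> (c +i* d : R[i]^o).
Proof.
move=> /cvgrPdist_lt ac /cvgrPdist_lt bd; apply/cvg_normc => e e0.
have e20 : 0 < e / 2 by lra.
have [N _ hN] := ac _ e20; have [M _ hM] := bd _ e20.
exists (maxn N M) => n; rewrite geq_max => /andP[/hN n1 /hM n2].
apply: le_lt_trans (normc_le_ReIm _) _; rewrite /= in n1 n2 *; rewrite distrC [X in _ + X]distrC; lra.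
Qed.

Lemma series_complex z n :
  series z n = series (fun i => Re (z i)) n +i* series (fun i => complex.Im (z i)) n.
Proof.
rewrite /series /=; elim: n => [|n IH]; first by rewrite !big_geq.
by rewrite !big_nat_recr//= IH; case: (z n).
Qed.

Lemma series_real (a : nat -> R) n : series (fun i => (a i)%:C) n = (series a n)%:C.
Proof. by rewrite /series/= rmorph_sum. Qed.

Lemma nonneg_series_cvg (a : nat -> R) (M : R) : (forall n, 0 <= a n) ->
  (forall n, series a n <= M) -> cvgn (series a).
Proof.
move=> a0 aM; apply: nondecreasing_is_cvgn; first exact: nondecreasing_series.
by exists M => _ [n _ <-].
Qed.

Lemma series_le (a : nat -> R) (m n : nat) : (forall n, 0 <= a n) -> (m <= n)%N -> series a m <= series a n.
Proof. by move=> a0 mn; apply: nondecreasing_series. Qed.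

Lemma absolute_cvg z (c : nat -> R) (M : R) : (forall n, normc (z n) <= c n) ->
  (forall n, series c n <= M) -> cvgn (series z : nat -> R[i]^o).
Proof.
move=> zc cM.
have c0 n : 0 <= c n by apply: le_trans (zc n); exact: normc_ge0.
have cc := nonneg_series_cvg c0 cM.
have part (p : R[i] -> R) : (forall l, `|p l| <= normc l) -> cvgn (series (fun i => p (z i))).
  move=> pl; apply: normed_cvg; apply: (series_le_cvg _ c0 _ cc) => n //=.
  exact: le_trans (pl _) (zc n).
have /cvg_ex[r rc] := part _ (fun l => (ReIm_le_normc l).1).
have /cvg_ex[s sc] := part _ (fun l => (ReIm_le_normc l).2).
apply/cvg_ex; exists (r +i* s : R[i]^o).
have -> : series z = (fun n => series (fun i => Re (z i)) n +i* series (fun i => complex.Im (z i)) n).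
  by apply/funext => n; rewrite series_complex.
exact: cvg_complex.
Qed.

Lemma conj_cvg z l : (z : nat -> R[i]^o) @ \oo --> (l : R[i]^o) ->
  (fun n => (z n)^*%R : R[i]^o) @ \oo --> (l^*%R : R[i]^o).
Proof.
move=> /cvg_normc zl; apply/cvg_normc => e /zl[N hN]; exists N => n /hN.
by rewrite -rmorphB normc_conj.
Qed.

End ComplexSequences.

Section L2.
Context {R : realType} {H : hilbertType R}.
Implicit Types (f g : nat -> H).

Definition sqs f := exists M : R, forall n, series (fun i => nm (f i) ^+ 2) n <= M.

Lemma square_summableP f : square_summable f <-> sqs f.
Proof.
have E : series (fun n => `|f n| ^+ 2 : R[i]^o) = (fun n => (series (fun i => nm (f i) ^+ 2) n)%:C).
  apply/funext => n; rewrite -series_real; congr (series _ n).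
  by apply/funext => i; rewrite nmE rmorphXn.
have pos i : 0 <= nm (f i) ^+ 2 by exact: sqr_ge0.
rewrite /square_summable E; split.
  move=> /cvg_ex[l /cvg_normc/(_ 1 ltr01)[N hN]]; exists (normc l + 1) => n.
  apply: le_trans (series_le pos (leq_maxr N n)) _.
  have := hN _ (leq_maxl N n); have := le_normcD ((series (fun i => nm (f i) ^+ 2) (maxn N n))%:C - l) l.
  by rewrite subrK normc_real; have := ler_norm (series (fun i => nm (f i) ^+ 2) (maxn N n)); lra.
move=> [M fM]; have /cvg_ex[l lc] := nonneg_series_cvg pos fM.
apply/cvg_ex; exists (l%:C : R[i]^o); apply: cvg_complex => //; exact: cvg_cst.
Qed.

Lemma sqs_submod : submod_closed [pred f : nat -> H | `[< sqs f >]].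
Proof.
split; first by apply/asboolP; exists 0 => n; rewrite /series/= big1// => i _; rewrite nm0 expr0n.
move=> a f g /asboolP[M fM] /asboolP[N gN]; apply/asboolP.
exists (2 * (normc a ^+ 2 * M + N)) => n.
apply: le_trans (_ : 2 * (normc a ^+ 2 * series (fun i => nm (f i) ^+ 2) n + series (fun i => nm (g i) ^+ 2) n) <= _).
  rewrite /series/= mulr_sumr -big_split/= mulr_sumr; apply: ler_sum => i _.
  have := parallelogram (a *: f i) (g i); rewrite nmZ exprMn => <-.
  by rewrite lerDl sqr_ge0.
by rewrite ler_wpM2l// lerD// ler_wpM2l// sqr_ge0.
Qed.

Definition sqs_pred : {pred (nat -> H)} := [pred f : nat -> H | `[< sqs f >]].

HB.instance Definition _ := GRing.isSubmodClosed.Build R[i] (nat -> H) sqs_pred sqs_submod.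

Record L2 := MkL2 { L2_fun :> nat -> H; _ : L2_fun \in sqs_pred }.

HB.instance Definition _ := [isSub for L2_fun].
HB.instance Definition _ := [Choice of L2 by <:].
HB.instance Definition _ := [SubChoice_isSubLmodule of L2 by <:].

Implicit Types (u v w : L2).

Lemma L2P u : sqs u. Proof. by case: u => f fP; apply/asboolP. Qed.
Lemma L2_of f : sqs f -> exists u : L2, L2_fun u = f.
Proof. by move=> fP; have fP' : f \in sqs_pred by [apply/asboolP]; exists (MkL2 fP'). Qed.
Lemma L2_inj u v : u =1 v -> u = v. Proof. by move=> uv; apply: val_inj; apply: funext. Qed.

(** The same limit as in [predual_app], so that elements of the predual become inner products by
    unfolding. *)
Definition L2_inner u v : R[i] := limn (series (fun n => inner (u n) (v n) : R[i]^o)).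

Lemma L2_inner_cvg u v :
  (series (fun n => inner (u n) (v n)) : nat -> R[i]^o) @ \oo --> (L2_inner u v : R[i]^o).
Proof.
have [M uM] := L2P u; have [N vN] := L2P v.
apply: (@absolute_cvg _ _ (fun n => nm (u n) ^+ 2 + nm (v n) ^+ 2) (M + N)) => n.
  apply: le_trans (inner_CS _ _) _; have := sqr_ge0 (nm (u n) - nm (v n)).
  have := sqr_ge0 (nm (u n)); have := sqr_ge0 (nm (v n)); nra.
by have := lerD (uM n) (vN n); rewrite /series/= big_split.
Qed.

Arguments L2_inner_cvg : clear implicits.

Lemma L2_innerC u v : L2_inner u v = (-1) ^+ false * (L2_inner v u)^*%R.
Proof.
rewrite expr0 mul1r; apply: (cvgC_uniq (L2_inner_cvg u v)).
have -> : series (fun n => inner (u n) (v n)) = (fun n => (series (fun n => inner (v n) (u n)) n)^*%R).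
  apply/funext => n; rewrite /series/= rmorph_sum; apply: eq_bigr => i _; exact: innerC.
exact: conj_cvg (L2_inner_cvg v u).
Qed.

Lemma L2_innerl (a : R[i]) u v w : L2_inner (a *: u + v) w = a * L2_inner u w + L2_inner v w.
Proof.
apply: (cvgC_uniq (L2_inner_cvg _ _)).
have -> : series (fun n => inner ((a *: u + v) n) (w n)) =
    (fun n => a *: (series (fun n => inner (u n) (w n)) n : R[i]^o) + (series (fun n => inner (v n) (w n)) n : R[i]^o)).
  apply/funext => n; rewrite /series/= scaler_sumr -big_split/=; apply: eq_bigr => i _.
  by rewrite [X in inner X _](_ : _ = a *: u i + v i)// innerDl innerZl.
by apply: cvgD; [apply: cvgZr; exact: L2_inner_cvg|exact: L2_inner_cvg].
Qed.

Lemma L2_innerr (a : R[i]) u v w : L2_inner w (a *: u + v) = a^*%R * L2_inner w u + L2_inner w v.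
Proof.
by rewrite (L2_innerC w (a *: u + v)) (L2_innerC w u) (L2_innerC w v) !expr0 !mul1r L2_innerl rmorphD rmorphM.
Qed.

Fact L2_inner_bilinear : bilinear_for (GRing.Scale.Law.clone _ _ *%R _)
  (GRing.Scale.Law.clone _ _ (Num.conj \; *%R) _) L2_inner.
Proof. by split=> [w a u v|w a u v] /=; [exact: L2_innerl|exact: L2_innerr]. Qed.

HB.instance Definition _ := bilinear_isBilinear.Build R[i] L2 L2 R[i]
  (GRing.Scale.Law.clone _ _ *%R _) (GRing.Scale.Law.clone _ _ (Num.conj \; *%R) _)
  L2_inner L2_inner_bilinear.

HB.instance Definition _ := @isHermitianSesquilinear.Build R[i] L2 false Num.conj L2_inner L2_innerC.

Lemma L2_sqnorm_cvg u : series (fun i => nm (u i) ^+ 2) @ \oo --> Re (L2_inner u u).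
Proof.
have [M uM] := L2P u.
have /cvg_ex[l lc] := nonneg_series_cvg (fun i => sqr_ge0 (nm (u i))) uM.
suff -> : L2_inner u u = l%:C by [].
apply: (cvgC_uniq (L2_inner_cvg u u)).
have -> : series (fun n => inner (u n) (u n)) = (fun n => (series (fun i => nm (u i) ^+ 2) n)%:C).
  by apply/funext => n; rewrite -series_real; congr (series _ n); apply/funext => i; rewrite inner_nm.
apply: cvg_complex => //; exact: cvg_cst.
Qed.

Arguments L2_sqnorm_cvg : clear implicits.

Lemma L2_inner_real u : L2_inner u u = (Re (L2_inner u u))%:C.
Proof.
apply: (cvgC_uniq (L2_inner_cvg u u)).
have -> : series (fun n => inner (u n) (u n)) = (fun n => (series (fun i => nm (u i) ^+ 2) n)%:C).
  by apply/funext => n; rewrite -series_real; congr (series _ n); apply/funext => i; rewrite inner_nm.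
apply: cvg_complex; [exact: L2_sqnorm_cvg|exact: cvg_cst].
Qed.

Lemma L2_partial u n : series (fun i => nm (u i) ^+ 2) n <= Re (L2_inner u u).
Proof.
have [M uM] := L2P u; have h := nonneg_series_cvg (fun i => sqr_ge0 (nm (u i))) uM.
rewrite -(cvg_lim (@Rhausdorff R) (L2_sqnorm_cvg u)).
apply: nondecreasing_cvgn_le => //; apply: nondecreasing_series => i _ _; exact: sqr_ge0.
Qed.

Lemma L2_sqnorm_le u (M : R) : (forall n, series (fun i => nm (u i) ^+ 2) n <= M) -> Re (L2_inner u u) <= M.
Proof.
move=> uM; rewrite -(cvg_lim (@Rhausdorff R) (L2_sqnorm_cvg u)).
by apply: limr_le; [apply/cvg_ex; exists (Re (L2_inner u u)); exact: L2_sqnorm_cvg|exact: nearW].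
Qed.

Lemma L2_coord u n : nm (u n) ^+ 2 <= Re (L2_inner u u).
Proof.
apply: le_trans (L2_partial u n.+1); rewrite /series/= big_nat_recr//= lerDr.
by apply: sumr_ge0 => i _; exact: sqr_ge0.
Qed.

Lemma L2_inner_ge0 u : 0 <= Re (L2_inner u u).
Proof. by apply: le_trans (L2_coord u 0); exact: sqr_ge0. Qed.

Lemma L2_inner_eq0 u : Re (L2_inner u u) = 0 -> u = 0.
Proof.
move=> u0; apply: L2_inj => n; apply/nm0_eq0/eqP; rewrite -sqrf_eq0 eq_le sqr_ge0 andbT.
by rewrite -u0 L2_coord.
Qed.

Lemma L2_neq0_gt0 u : u != 0 -> 0 < L2_inner u u.
Proof.
move=> u0; rewrite L2_inner_real ltcR lt_def L2_inner_ge0 andbT.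
by apply: contra u0 => /eqP/L2_inner_eq0 ->.
Qed.

HB.instance Definition _ := @isDotProduct.Build R[i] L2 L2_inner L2_neq0_gt0.

Definition L2_norm u : R[i] := (Num.sqrt (Re (L2_inner u u)))%:C.

Lemma L2_expand u v (a : R[i]) :
  Re (L2_inner (u - a *: v) (u - a *: v)) =
  Re (L2_inner u u) - 2 * Re (a^*%R * L2_inner u v) + normc a ^+ 2 * Re (L2_inner v v).
Proof.
have E : u - a *: v = (- a) *: v + u by rewrite scaleNr addrC.
rewrite E L2_innerl !L2_innerr.
have -> : L2_inner v u = (L2_inner u v)^*%R by rewrite L2_innerC expr0 mul1r.
rewrite rmorphN !ReD.
have -> : - a * (- a^*%R * L2_inner v v + (L2_inner u v)^*%R) =
    ((normc a) ^+ 2)%:C * L2_inner v v - a * (L2_inner u v)^*%R.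
  by rewrite -mulJc; ring.
rewrite ReB ReZ !mulNr ReN.
have -> : Re (a * (L2_inner u v)^*%R) = Re (a^*%R * L2_inner u v).
  by rewrite -(complexRe_conj (a * _)) rmorphM/= conjCK.
ring.
Qed.

Lemma L2_norm_triangle u v : L2_norm (u + v) <= L2_norm u + L2_norm v.
Proof.
rewrite /L2_norm -rmorphD/= lecR.
have CS : normc (L2_inner u v) <= Num.sqrt (Re (L2_inner u u)) * Num.sqrt (Re (L2_inner v v)).
  rewrite -ler_sqr ?nnegrE ?normc_ge0 ?mulr_ge0 ?sqrtr_ge0// exprMn !sqr_sqrtr ?L2_inner_ge0//.
  apply: discriminant_bound => [|a]; first exact: L2_inner_ge0.
  by rewrite -L2_expand L2_inner_ge0.
rewrite -ler_sqr ?nnegrE ?addr_ge0 ?sqrtr_ge0// sqr_sqrtr ?L2_inner_ge0//.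
have -> : u + v = u - (-1) *: v by rewrite scaleN1r opprK.
rewrite L2_expand normcN normc1 rmorphN rmorph1 mulN1r ReN sqrrD !sqr_sqrtr ?L2_inner_ge0//.
have := Re_le_normc (L2_inner u v); lra.
Qed.

Lemma L2_normZ (a : R[i]) u : L2_norm (a *: u) = `|a| * L2_norm u.
Proof.
rewrite /L2_norm normcC -rmorphM/=; congr (_%:C).
have -> : Re (L2_inner (a *: u) (a *: u)) = normc a ^+ 2 * Re (L2_inner u u).
  have L0 w : L2_inner 0 w = 0.
    by have := L2_innerl 1 0 0 w; rewrite scale1r addr0 mul1r => /esym/eqP; rewrite -subr_eq0 addrK => /eqP.
  have := L2_expand 0 u (- a); rewrite sub0r scaleNr opprK => ->.
  by rewrite !L0 mulr0 mulr0 subr0 add0r normcN.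
by rewrite sqrtrM ?sqr_ge0// sqrtr_sqr ger0_norm ?normc_ge0.
Qed.

Lemma L2_norm_eq0 u : L2_norm u = 0 -> u = 0.
Proof.
move=> /complexI/eqP; rewrite sqrtr_eq0 => u0; apply: L2_inner_eq0.
by apply/eqP; rewrite eq_le u0 L2_inner_ge0.
Qed.

HB.instance Definition _ := @Lmodule_isNormed.Build R[i] L2 L2_norm
  L2_norm_triangle L2_normZ L2_norm_eq0.

Lemma L2_normE u : `|u| = (Num.sqrt (Re (L2_inner u u)))%:C. Proof. by []. Qed.

Lemma nm_cvg (h : nat -> H) (l : H) : h @ \oo --> l -> (fun n => nm (h n)) @ \oo --> nm l.
Proof.
move=> /cvg_nm hl; apply/cvgrPdist_lt => e /hl[N hN]; exists N => // n /hN.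
have := nmD (h n - l) l; have := nmD (l - h n) (h n); rewrite !subrK (nmBC l).
by move=> h1 h2 h3; rewrite ltr_norml; apply/andP; split; lra.
Qed.

Local Notation rn u := (Num.sqrt (Re (L2_inner u u))).

Lemma L2_rn_triangle u v : rn (u + v) <= rn u + rn v.
Proof. by have := L2_norm_triangle u v; rewrite /L2_norm -rmorphD/= lecR. Qed.

Lemma L2_rnN u : rn (- u) = rn u.
Proof. by apply: complexI; rewrite -!L2_normE normrN. Qed.

(** The filter is replaced by a sequence [x n] with small balls around it in [F]. The limit is taken
    coordinatewise, and the distance to it is controlled on finite partial sums. *)
Lemma L2_complete (F : set_system L2) : ProperFilter F -> cauchy F -> cvg F.
Proof.
move=> FF /cauchyP Fc.
have aux1 (p q r a b c : R) : r <= p + q -> p < a -> q < b -> a <= c -> b <= c -> r < 2 * c by lra.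
have aux2 (p q r a d : R) : r <= p + q -> a < d / 3 -> p < a -> q <= 2 * a -> r < d by lra.
have e0 n : 0 < (n.+1%:R^-1 : R) by rewrite invr_gt0.
have /choice[x xF] n : exists x : L2, F (ball x (n.+1%:R^-1 : R)%:C) by apply: Fc; rewrite ltcR.
have e2 (n m : nat) : (n <= m)%N -> m.+1%:R^-1 <= n.+1%:R^-1 :> R.
  by move=> nm_; rewrite lef_pV2 ?posrE// ler_nat.
have bE u v (r : R) : ball u r%:C v = (rn (u - v) < r) :> Prop.
  by rewrite -ball_normE/= L2_normE ltcR.
have xx N n m : (N <= n)%N -> (N <= m)%N -> rn (x n - x m) < 2 * N.+1%:R^-1.
  move=> Nn Nm; have /filter_ex[y [yn ym]] : F (ball (x n) (n.+1%:R^-1 : R)%:C `&` ball (x m) (m.+1%:R^-1 : R)%:C).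
    by apply: filterI; exact: xF.
  have h := L2_rn_triangle (x n - y) (- (x m - y)); rewrite L2_rnN opprB addrA subrK in h.
  rewrite !bE in yn ym; exact: aux1 h yn ym (e2 _ _ Nn) (e2 _ _ Nm).
have crd u n : nm (u n) <= rn u.
  by rewrite -ler_sqr ?nnegrE ?nm_ge0 ?sqrtr_ge0// sqr_sqrtr ?L2_inner_ge0// L2_coord.
have /choice[f fE] i : exists l : H, (fun n => x n i) @ \oo --> l.
  apply: complete_nm => e e1; have e20 : 0 < e / 2 by lra.
  have [N NN] := exists_invS e20; exists N => m n Nm Nn.
  apply: le_lt_trans (crd (x m - x n) i) _; apply: lt_trans (xx _ _ _ Nm Nn) _.
  by move: (N.+1%:R^-1) NN => a; lra.
(* For a fixed number [k] of terms one may let m tend to infinity in |x n - x m|; the bound does not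
   depend on [k]. *)
have tail N n k : (N <= n)%N -> series (fun i => nm (x n i - f i) ^+ 2) k <= (2 * N.+1%:R^-1) ^+ 2.
  move=> Nn.
  have lim : (fun m => series (fun i => nm (x n i - x m i) ^+ 2) k) @ \oo --> series (fun i => nm (x n i - f i) ^+ 2) k.
    elim: k => [|k IH].
      rewrite /series/= big_geq//.
      have -> : (fun m => \sum_(0 <= i < 0) nm (x n i - x m i) ^+ 2) = (fun=> 0 : R).
        by apply/funext => m; rewrite big_geq.
      exact: cvg_cst.
    rewrite /series/= big_nat_recr//=.
    have -> : (fun m => \sum_(0 <= i < k.+1) nm (x n i - x m i) ^+ 2) =
        (fun m => series (fun i => nm (x n i - x m i) ^+ 2) k + nm (x n k - x m k) ^+ 2).
      by apply/funext => m; rewrite big_nat_recr.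
    apply: cvgD; first exact: IH.
    apply: (@cvgM _ _ _ _ (fun m => nm (x n k - x m k)) (fun m => nm (x n k - x m k)));
      apply: nm_cvg; apply: cvgB; [exact: cvg_cst|exact: fE|exact: cvg_cst|exact: fE].
  rewrite -(cvg_lim (@Rhausdorff R) lim); apply: limr_le; first by apply/cvg_ex; eexists; exact: lim.
  exists N => // m /= Nm; apply: le_trans (L2_partial (x n - x m) k) _.
  rewrite -[leLHS]sqr_sqrtr ?L2_inner_ge0// ler_sqr ?nnegrE ?sqrtr_ge0 ?mulr_ge0 ?(ltW (e0 _))//.
  exact/ltW/xx.
(* [tail] controls only differences, so the limit is recovered as [x 0] minus the square summable
   sequence x 0 - f. *)
have [y yE] : exists y : L2, L2_fun y = (fun i => x 0 i - f i).
  by apply: L2_of; exists ((2 * 1%:R^-1) ^+ 2) => k; exact: tail.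
pose l := x 0 - y; have lE i : l i = f i.
  by rewrite [LHS](_ : _ = x 0 i - y i)// yE subKr.
apply/cvg_ex; exists l; apply/cvgrPdist_lt => e e1.
have e1' : 0 < Re e by move: e1; rewrite ltcE => /andP[].
have [N NN] : exists N : nat, N.+1%:R^-1 < Re e / 3 by apply: exists_invS; lra.
near=> z; rewrite L2_normE (ge0c_Re (ltW e1)) ltcR.
have h1 : rn (x N - z) < N.+1%:R^-1 by rewrite -bE; near: z; exact: xF.
have h2 : rn (x N - l) <= 2 * N.+1%:R^-1.
  rewrite -ler_sqr ?nnegrE ?sqrtr_ge0 ?mulr_ge0 ?(ltW (e0 _))// sqr_sqrtr ?L2_inner_ge0//.
  apply: L2_sqnorm_le => k; apply: le_trans (tail N N k (leqnn N)).
  rewrite /series/=; apply: ler_sum => i _.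
  by rewrite [X in nm X](_ : _ = x N i - l i)// lE.
have h := L2_rn_triangle (x N - z) (- (x N - l)).
rewrite L2_rnN opprB [_ + (l - _)]addrC addrA subrK in h.
exact: aux2 h NN h1 h2.
Unshelve. all: by end_near. Qed.

HB.instance Definition _ := Uniform_isComplete.Build L2 L2_complete.

Lemma L2_innerE u : `|u| ^+ 2 = L2_inner u u.
Proof. by rewrite L2_normE -rmorphXn/= sqr_sqrtr ?L2_inner_ge0// -L2_inner_real. Qed.

HB.instance Definition _ := @NormedModule_isHilbert.Build R L2 (Dot.clone _ _ _ L2_inner _) L2_innerE.

Lemma L2_inner_def u v : inner u v = limn (series (fun n => inner (u n) (v n) : R[i]^o)).
Proof. by []. Qed.

End L2.

Lemma cvgC_ge0 {R : realType} (z : nat -> R[i]) (l : R[i]) :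
  (z : nat -> R[i]^o) @ \oo --> (l : R[i]^o) -> (forall n, 0 <= z n) -> 0 <= l.
Proof.
move=> /cvg_normc zl z0.
have key (e : R) : 0 < e -> `|complex.Im l| <= e /\ - e <= Re l.
  move=> e0; have [N /(_ N (leqnn N))] := zl e e0.
  rewrite (ge0c_Re (z0 N)); move: (z0 N); rewrite lecE => /andP[_].
  rewrite /=; move: (Re (z N)) l {zl} => a [b c] a0 /=.
  rewrite sub0r sqrrN => /ltW h.
  have h1 : `|a - b| <= e by rewrite -sqrtr_sqr; apply: le_trans h; rewrite ler_wsqrtr// lerDl sqr_ge0.
  split; last by move: h1; rewrite ler_norml => /andP[]; lra.
  by rewrite -sqrtr_sqr; apply: le_trans h; rewrite ler_wsqrtr// lerDr sqr_ge0.
rewrite lecE/=; apply/andP; split.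
  rewrite -normr_eq0 eq_le normr_ge0 andbT; apply: le_eps => e e0.
  by rewrite add0r; exact: (key e e0).1.
by rewrite -oppr_le0; apply: le_eps => e e0; have := (key e e0).2; lra.
Qed.

(** * Operators on l2(H) and predual functionals *)

Section Amplification.
Context {R : realType} {H : hilbertType R}.
Local Notation K := (@L2 R H).
Implicit Types (x y : BH H) (xi eta u v : K).

Lemma L2_cvg xi eta :
  (series (fun n => inner (xi n) (eta n)) : nat -> R[i]^o) @ \oo --> (inner xi eta : R[i]^o).
Proof. exact: L2_inner_cvg. Qed.
Arguments L2_cvg : clear implicits.

Lemma L2_nm xi : nm xi ^+ 2 = Re (L2_inner xi xi).
Proof. by have := inner_nm xi; rewrite -[inner xi xi]/(L2_inner xi xi) => ->. Qed.

Lemma L2_series_le xi n : series (fun i => nm (xi i) ^+ 2) n <= nm xi ^+ 2.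
Proof. by rewrite L2_nm L2_partial. Qed.

Lemma L2_nm_le xi (M : R) : (forall n, series (fun i => nm (xi i) ^+ 2) n <= M) -> nm xi ^+ 2 <= M.
Proof. by rewrite L2_nm; exact: L2_sqnorm_le. Qed.

(** Comparing partial sums makes the bound meaningful for all sequences; the index [m] may exceed
    [n], as for matrix units, which read one coordinate and write another. *)
Lemma L2_operator (F : (nat -> H) -> nat -> H) (B : R) : 0 <= B -> linear F ->
  (forall (f : nat -> H) n, exists m, series (fun i => nm (F f i) ^+ 2) n <= B ^+ 2 * series (fun i => nm (f i) ^+ 2) m) ->
  exists T : BH K, forall xi, L2_fun (T xi) = F xi.
Proof.
move=> B0 Fl FB.
have FB' xi n : series (fun i => nm (F xi i) ^+ 2) n <= B ^+ 2 * nm xi ^+ 2.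
  have [m h] := FB xi n; apply: le_trans h _; rewrite ler_wpM2l ?sqr_ge0//; exact: L2_series_le.
have /choice[f fE] xi : exists eta : K, L2_fun eta = F xi by apply: L2_of; eexists; exact: FB'.
have [|xi|T TE] := @BH_of _ _ f B.
- move=> a u v; apply: L2_inj => n; rewrite fE [L2_fun (a *: u + v)](_ : _ = a *: L2_fun u + L2_fun v)//.
  by rewrite Fl -!fE.
- rewrite -ler_sqr ?nnegrE ?mulr_ge0 ?nm_ge0// exprMn; apply: L2_nm_le => n.
  by rewrite fE; exact: FB'.
by exists T => xi; rewrite TE.
Qed.

Lemma l2amp_exists x : exists T : BH K, forall xi, L2_fun (T xi) = x \o xi.
Proof.
have [B [B0 xB]] := BH_bounded x.
apply: (@L2_operator (fun f => x \o f) B B0) => [a u v|f n].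
  by apply/funext => n /=; rewrite BH_linear.
exists n; rewrite /series/= mulr_sumr; apply: ler_sum => i _.
by rewrite -exprMn ler_sqr ?nnegrE ?mulr_ge0 ?nm_ge0.
Qed.

Definition l2amp x : BH K := projT1 (cid (l2amp_exists x)).

Lemma l2amp_fun x xi : L2_fun (l2amp x xi) = x \o xi.
Proof. by rewrite /l2amp; case: cid. Qed.

Lemma l2ampE x xi n : l2amp x xi n = x (xi n).
Proof. by rewrite l2amp_fun. Qed.

Lemma l2amp_adjoint x y : is_adjoint x y -> is_adjoint (l2amp x) (l2amp y).
Proof.
move=> xy u v; apply: (cvgC_uniq (L2_cvg _ _)).
have -> : series (fun n => inner (l2amp x u n) (v n)) = series (fun n => inner (u n) (l2amp y v n)).
  by congr series; apply/funext => n; rewrite !l2ampE xy.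
exact: L2_cvg.
Qed.

Lemma l2amp_bound x (B : R) : bound_on x B -> bound_on (l2amp x) B.
Proof.
move=> [B0 xB]; split=> // u; rewrite -ler_sqr ?nnegrE ?mulr_ge0 ?nm_ge0//.
apply: L2_nm_le => n; rewrite exprMn; apply: le_trans (_ : B ^+ 2 * series (fun i => nm (u i) ^+ 2) n <= _).
  rewrite /series/= mulr_sumr; apply: ler_sum => i _.
  by rewrite l2ampE -exprMn ler_sqr ?nnegrE ?mulr_ge0 ?nm_ge0.
by rewrite ler_wpM2l ?sqr_ge0//; exact: L2_series_le.
Qed.

Lemma l2amp_positive x : positive_op x -> positive_op (l2amp x).
Proof.
move=> x0 u; apply: (cvgC_ge0 (L2_cvg _ _)) => n; rewrite /series/=; apply: sumr_ge0 => i _.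
by rewrite l2ampE.
Qed.

Lemma l2single_exists (k : nat) (h : H) : exists xi : K, forall n, xi n = if n == k then h else 0.
Proof.
have [|xi xiE] := @L2_of _ _ (fun n => if n == k then h else 0).
  exists (nm h ^+ 2) => n; rewrite /series/= big_mkord.
  have [kn|nk] := ltnP k n.
    rewrite (bigD1 (Ordinal kn))//= eqxx big1 ?addr0// => i ik.
    by rewrite ifN ?nm0 ?expr0n//; apply: contra ik => /eqP E; apply/eqP/val_inj.
  rewrite big1 ?sqr_ge0// => i _; rewrite ifN ?nm0 ?expr0n//.
  by apply/eqP => E; have := ltn_ord i; rewrite E ltnNge nk.
by exists xi => n; rewrite xiE.
Qed.

Definition l2single k h : K := projT1 (cid (l2single_exists k h)).
Lemma l2singleE k h n : l2single k h n = if n == k then h else 0.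
Proof. by rewrite /l2single; case: cid. Qed.

Lemma inner_l2single k h xi : inner (l2single k h) xi = inner h (xi k).
Proof.
apply: (cvgC_uniq (L2_cvg _ _)); apply/cvg_normc => e e0; exists k.+1 => n kn.
rewrite /series/= big_mkord (bigD1 (Ordinal kn))//= l2singleE eqxx big1 ?addr0 ?subrr ?normc0// => i ik.
rewrite l2singleE ifN ?inner0l//; by apply: contra ik => /eqP E; apply/eqP/val_inj.
Qed.

Lemma l2matrix_unit (i j : nat) : exists T : BH K, forall xi, T xi = l2single i (xi j).
Proof.
have [a f g|f n|T TE] := @L2_operator (fun f n => if n == i then f j else 0) 1 ler01.
- by apply/funext => n /=; rewrite !fctE; case: ifP => // _; rewrite scaler0 addr0.
- exists j.+1; rewrite expr1n mul1r.
  apply: le_trans (_ : nm (f j) ^+ 2 <= _).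
    have [M /(_ n)] := L2P (l2single i (f j)).
    have := @L2_series_le (l2single i (f j)) n.
    have -> : nm (l2single i (f j)) ^+ 2 = nm (f j) ^+ 2.
      by apply: complexI; rewrite -!inner_nm inner_l2single l2singleE eqxx.
    move=> h _; apply: le_trans h; rewrite /series/=; apply: ler_sum => k _.
    by rewrite l2singleE.
  by rewrite /series/= big_nat_recr//= lerDr sumr_ge0// => k _; exact: sqr_ge0.
by exists T => xi; apply: L2_inj => n; rewrite TE l2singleE.
Qed.

Lemma series_even (a : nat -> R[i]) (b : nat -> R[i]) :
  (forall n, b n.*2 = a n /\ b n.*2.+1 = 0) \/ (forall n, b n.*2 = 0 /\ b n.*2.+1 = a n) ->
  forall n, series b n.*2 = series a n.
Proof.
move=> ab; elim=> [|n IH]; first by rewrite /series/= !big_geq.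
rewrite /series/= doubleS !big_nat_recr//= -[\sum_(0 <= i < n.*2) _]/(series b n.*2) IH.
by case: ab => /(_ n)[-> ->]; rewrite ?addr0.
Qed.

Lemma series_even_real (a : nat -> R) (b : nat -> R) :
  (forall n, b n.*2 = a n /\ b n.*2.+1 = 0) \/ (forall n, b n.*2 = 0 /\ b n.*2.+1 = a n) ->
  (forall n, 0 <= b n) -> forall n, series b n <= series a n.
Proof.
move=> ab b0 n; have -> : series a n = series b n.*2.
  elim: n => [|n IH]; first by rewrite /series/= !big_geq.
  rewrite [RHS]/series/= doubleS !big_nat_recr//= -[\sum_(0 <= i < n.*2) _]/(series b n.*2) -IH.
  by rewrite /series/= big_nat_recr//=; case: ab => /(_ n)[-> ->]; rewrite ?addr0.
by apply: series_le => //; rewrite -addnn leq_addr.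
Qed.

Lemma interleave : exists S0 S1 : BH K,
  [/\ forall xi n, S0 xi n.*2 = xi n /\ S0 xi n.*2.+1 = 0 &
      forall xi n, S1 xi n.*2 = 0 /\ S1 xi n.*2.+1 = xi n].
Proof.
have [a f g|f n|S0 S0E] := @L2_operator (fun f n => if odd n then 0 else f n./2) 1 ler01.
- by apply/funext => n /=; rewrite !fctE; case: ifP => // _; rewrite scaler0 addr0.
- exists n; rewrite expr1n mul1r; apply: series_even_real => [|k]; last exact: sqr_ge0.
  by left=> k; rewrite /= odd_double/= doubleK nm0 expr0n.
have [a f g|f n|S1 S1E] := @L2_operator (fun f n => if odd n then f n./2 else 0) 1 ler01.
- by apply/funext => n /=; rewrite !fctE; case: ifP => // _; rewrite scaler0 addr0.
- exists n; rewrite expr1n mul1r; apply: series_even_real => [|k]; last exact: sqr_ge0.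
  by right=> k; rewrite /= odd_double/= uphalf_double nm0 expr0n.
exists S0, S1; split=> xi n; rewrite ?S0E ?S1E /= odd_double /=.
  by rewrite doubleK.
by rewrite uphalf_double.
Qed.

Lemma inner_even u v u' v' :
  (forall n, inner (u' n.*2) (v' n.*2) = inner (u n) (v n) /\ inner (u' n.*2.+1) (v' n.*2.+1) = 0) \/
  (forall n, inner (u' n.*2) (v' n.*2) = 0 /\ inner (u' n.*2.+1) (v' n.*2.+1) = inner (u n) (v n)) ->
  inner u' v' = inner u v.
Proof.
move=> E; apply: (@cvgC_uniq _ (series (fun n => inner (u n) (v n)))); last exact: L2_cvg.
have {}E := @series_even (fun n => inner (u n) (v n)) (fun n => inner (u' n) (v' n)) E.
apply/cvg_normc => e /((cvg_normc _ _).1 (L2_cvg u' v'))[N hN].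
exists N => n Nn; rewrite -E; apply: hN; apply: leq_trans Nn _; by rewrite -addnn leq_addr.
Qed.

(** V_i = S1^i S0, where [S0] and [S1] place a sequence on the even and on the odd indices. Common
    factors [S1] cancel in inner products until the orthogonal ranges of [S0] and [S1] meet. *)
Lemma l2isometries : exists V : nat -> BH K,
  (forall i j u v, inner (V i u) (V j v) = if i == j then inner u v else 0) /\
  (forall i x, l2amp x * V i = V i * l2amp x).
Proof.
have [S0 [S1 [S0E S1E]]] := interleave.
have S00 u v : inner (S0 u) (S0 v) = inner u v.
  by apply: inner_even; left => n; rewrite !(S0E _ _).1 !(S0E _ _).2 inner0l.
have S11 u v : inner (S1 u) (S1 v) = inner u v.
  by apply: inner_even; right => n; rewrite !(S1E _ _).1 !(S1E _ _).2 inner0l.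
have S01 u v : inner (S0 u) (S1 v) = 0.
  rewrite -(inner0l (0 : K)); apply: inner_even; left => n.
  have Z0 : inner ((0 : K) n) ((0 : K) n) = 0 by exact: (inner0l (0 : H)).
  by rewrite Z0 (S0E u n).2 (S1E v n).1 inner0l inner0r.
have par n : n = n./2.*2 \/ n = n./2.*2.+1 by rewrite -{1 3}(odd_double_half n); case: odd; [right|left].
have l2amp0' x : l2amp x * S0 = S0 * l2amp x.
  apply: BH_inj => u; apply: L2_inj => n; rewrite !BH_apM l2ampE.
  by have [->|->] := par n; rewrite ?(S0E _ _).1 ?(S0E _ _).2 ?l2ampE ?BH_0.
have l2amp1' x : l2amp x * S1 = S1 * l2amp x.
  apply: BH_inj => u; apply: L2_inj => n; rewrite !BH_apM l2ampE.
  by have [->|->] := par n; rewrite ?(S1E _ _).1 ?(S1E _ _).2 ?l2ampE ?BH_0.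
exists (fix V n := if n is n'.+1 then S1 * V n' else S0); split.
  elim=> [|i IH] [|j] u v; rewrite ?BH_apM.
  - by rewrite S00.
  - by rewrite S01.
  - by rewrite innerC S01 rmorph0.
  - by rewrite S11 IH eqSS.
elim=> [|i IH] x; first exact: l2amp0'.
by rewrite mulrA l2amp1' -mulrA IH mulrA.
Qed.

Lemma predual_l2amp (p : predual H) : exists xi eta : K,
  forall x, predual_app x p = inner (l2amp x xi) eta.
Proof.
case: p => [[f g] [/= f2 g2]].
have [xi xiE] := L2_of ((square_summableP f).1 f2).
have [eta etaE] := L2_of ((square_summableP g).1 g2).
exists xi, eta => y; rewrite /predual_app /= L2_inner_def; congr (limn _); congr series.
by apply/funext => n; rewrite l2ampE xiE etaE.
Qed.

Lemma l2amp_predual xi eta : exists p : predual H,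
  forall x, predual_app x p = inner (l2amp x xi) eta.
Proof.
have P : square_summable (xi, eta).1 /\ square_summable (xi, eta).2.
  by split; apply/square_summableP; exact: L2P.
exists (exist _ (L2_fun xi, L2_fun eta) P) => x.
rewrite /predual_app /= L2_inner_def; congr (limn _); congr series.
by apply/funext => n; rewrite l2ampE.
Qed.

Lemma L2_coord_nm xi n : nm (xi n) <= nm xi.
Proof.
rewrite -ler_sqr ?nnegrE ?nm_ge0//; apply: le_trans (L2_series_le xi n.+1).
by rewrite /series/= big_nat_recr//= lerDr sumr_ge0// => k _; exact: sqr_ge0.
Qed.

End Amplification.

(* The space l2(H) enters the sequel only through this interface; sealing it keeps
   its construction away from unification. [ampl_op x] is the operator x (x) 1; the
   isometries [ampl_iso k] have orthogonal ranges and commute with it, so that they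
   pack a sequence of vectors into a single one. *)
Record amplification (R : realType) (H : hilbertType R) := Amplification {
  ampl_space : hilbertType R;
  ampl_op : BH H -> BH ampl_space;
  ampl_coord : ampl_space -> nat -> H;
  ampl_single : nat -> H -> ampl_space;
  ampl_iso : nat -> BH ampl_space;
  ampl_coord_ext : forall u v, ampl_coord u =1 ampl_coord v -> u = v;
  ampl_coord_lin : forall (a : R[i]) u v n,
    ampl_coord (a *: u + v) n = a *: ampl_coord u n + ampl_coord v n;
  ampl_coord_nm : forall u n, nm (ampl_coord u n) <= nm u;
  ampl_opE : forall x u n, ampl_coord (ampl_op x u) n = x (ampl_coord u n);
  ampl_adjoint : forall x y, is_adjoint x y -> is_adjoint (ampl_op x) (ampl_op y);
  ampl_bound : forall x (B : R), bound_on x B -> bound_on (ampl_op x) B;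
  ampl_positive : forall x, positive_op x -> positive_op (ampl_op x);
  ampl_singleE : forall k h n, ampl_coord (ampl_single k h) n = if n == k then h else 0;
  ampl_inner_single : forall k h u, inner (ampl_single k h) u = inner h (ampl_coord u k);
  ampl_matrix_unit : forall i j : nat, exists T : BH ampl_space,
    forall u, T u = ampl_single i (ampl_coord u j);
  ampl_iso_inner : forall i j u v,
    inner (ampl_iso i u) (ampl_iso j v) = if i == j then inner u v else 0;
  ampl_iso_op : forall i x u, ampl_op x (ampl_iso i u) = ampl_iso i (ampl_op x u);
  ampl_of_predual : forall p : predual H, exists u v,
    forall x, predual_app x p = inner (ampl_op x u) v;
  ampl_to_predual : forall u v, exists p : predual H,
    forall x, predual_app x p = inner (ampl_op x u) v }.

Lemma amplification_exists (R : realType) (H : hilbertType R) : inhabited (amplification H).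
Proof.
have [V [Vi Va]] := @l2isometries R H; constructor.
apply: (@Amplification R H (@L2 R H) (@l2amp R H) (@L2_fun R H) (@l2single R H) V) => //.
- exact: L2_inj.
- exact: L2_coord_nm.
- exact: l2ampE.
- exact: l2amp_adjoint.
- exact: l2amp_bound.
- exact: l2amp_positive.
- exact: l2singleE.
- exact: inner_l2single.
- exact: l2matrix_unit.
- by move=> i x u; rewrite -!BH_apM Va.
- exact: predual_l2amp.
- exact: l2amp_predual.
Qed.

(** * The amplification *)

Section AmplificationTheory.
Context {R : realType} {H : hilbertType R}.

Fact amplification_key : amplification H.
Proof. by apply: (projT1 (cid _)); case: (@amplification_exists R H) => a; exists a. Qed.

Definition ell2 : hilbertType R := ampl_space amplification_key.
Local Notation K := ell2.
Implicit Types (x y : BH H) (xi eta u v : K).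

Definition amp : BH H -> BH K := @ampl_op _ _ amplification_key.
Definition coord : K -> nat -> H := @ampl_coord _ _ amplification_key.
Definition single : nat -> H -> K := @ampl_single _ _ amplification_key.
Definition Viso : nat -> BH K := @ampl_iso _ _ amplification_key.

Lemma coord_ext u v : coord u =1 coord v -> u = v. Proof. exact: ampl_coord_ext. Qed.
Lemma coord_lin (a : R[i]) u v n : coord (a *: u + v) n = a *: coord u n + coord v n.
Proof. exact: ampl_coord_lin. Qed.
Lemma coord_nm u n : nm (coord u n) <= nm u. Proof. exact: ampl_coord_nm. Qed.
Lemma ampE x u n : coord (amp x u) n = x (coord u n). Proof. exact: ampl_opE. Qed.
Lemma amp_adjoint x y : is_adjoint x y -> is_adjoint (amp x) (amp y).
Proof. exact: ampl_adjoint. Qed.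
Lemma amp_bound x (B : R) : bound_on x B -> bound_on (amp x) B. Proof. exact: ampl_bound. Qed.
Lemma amp_positive x : positive_op x -> positive_op (amp x). Proof. exact: ampl_positive. Qed.
Lemma singleE k h n : coord (single k h) n = if n == k then h else 0.
Proof. exact: ampl_singleE. Qed.
Lemma inner_single k h u : inner (single k h) u = inner h (coord u k).
Proof. exact: ampl_inner_single. Qed.
Lemma matrix_unit (i j : nat) : exists T : BH K, forall u, T u = single i (coord u j).
Proof. exact: ampl_matrix_unit. Qed.
Lemma Viso_inner i j u v : inner (Viso i u) (Viso j v) = if i == j then inner u v else 0.
Proof. exact: ampl_iso_inner. Qed.
Lemma Viso_amp i x u : amp x (Viso i u) = Viso i (amp x u).
Proof. exact: ampl_iso_op. Qed.
Lemma predual_amp (p : predual H) : exists xi eta, forall x, predual_app x p = inner (amp x xi) eta.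
Proof. exact: ampl_of_predual. Qed.
Lemma amp_predual xi eta : exists p : predual H, forall x, predual_app x p = inner (amp x xi) eta.
Proof. exact: ampl_to_predual. Qed.

Lemma amp_lin (a : R[i]) x y : amp (a *: x + y) = a *: amp x + amp y.
Proof.
apply: BH_inj => xi; apply: coord_ext => n.
by rewrite BH_apD BH_apZ coord_lin !ampE.
Qed.
Lemma ampM x y : amp (x * y) = amp x * amp y.
Proof. by apply: BH_inj => xi; apply: coord_ext => n; rewrite BH_apM !ampE. Qed.
Lemma amp1 : amp 1 = 1.
Proof. by apply: BH_inj => xi; apply: coord_ext => n; rewrite ampE. Qed.
Lemma amp0 : amp 0 = 0.
Proof.
have := amp_lin 1 0 0; rewrite !scale1r addr0 => /esym/eqP.
by rewrite -subr_eq0 addrK => /eqP.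
Qed.
Lemma ampD x y : amp (x + y) = amp x + amp y.
Proof. by rewrite -[x]scale1r amp_lin !scale1r. Qed.
Lemma ampZ (a : R[i]) x : amp (a *: x) = a *: amp x.
Proof. by rewrite -[a *: x]addr0 amp_lin amp0 addr0. Qed.
Lemma ampN x : amp (- x) = - amp x. Proof. by rewrite -scaleN1r ampZ scaleN1r. Qed.
Lemma ampB x y : amp (x - y) = amp x - amp y. Proof. by rewrite ampD ampN. Qed.

Lemma amp_single x k h : amp x (single k h) = single k (x h).
Proof.
by apply: coord_ext => n; rewrite ampE !singleE; case: ifP => // _; rewrite BH_0.
Qed.

Lemma amp_inj x y : amp x = amp y -> x = y.
Proof.
move=> xy; apply: BH_inj => h; have : coord (amp x (single 0 h)) 0%N = coord (amp y (single 0 h)) 0%N by rewrite xy.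
by rewrite !ampE singleE eqxx.
Qed.

Lemma amp_positive_inv x : positive_op (amp x) -> positive_op x.
Proof.
by move=> x0 h; have := x0 (single 0 h); rewrite amp_single inner_single singleE eqxx.
Qed.

End AmplificationTheory.
Arguments ell2 {R} H.

Lemma initial_cvg (S : choiceType) (T : topologicalType) (f : S -> T) (F : set_system S) (s : S) :
  Filter F -> f @ F --> f s -> F --> (s : initial_topology f).
Proof.
move=> FF fs A; rewrite nbhsE => -[B [[C oC <-] Cs] sBA]; apply: filterS sBA _.
by apply: fs; apply: open_nbhs_nbhs.
Qed.

Lemma lt_halves {R : realType} (p q r e : R) : r <= p + q -> p < e / 2 -> q < e / 2 -> r < e.
Proof. lra. Qed.

(** * Normal functionals *)

Section WeakStar.
Context {R : realType} {H : hilbertType R}.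
Local Notation K := (ell2 H).
Implicit Types (x y : BH H) (xi eta u v : K).

(** Ultrastrong convergence, which density arguments provide, implies weak* convergence. *)
Lemma weakstar_cvg (F : set_system (BH H)) y : Filter F ->
  (forall xi (e : R), 0 < e -> F [set x | nm (amp x xi - amp y xi) < e]) ->
  F --> (y : weakstar H).
Proof.
move=> FF Fy; apply: initial_cvg; apply/cvg_sup => p; apply: initial_cvg.
apply/cvgrPdist_lt => e e0; have e0' : 0 < Re e by move: e0; rewrite ltcE => /andP[].
have [xi [eta pE]] := predual_amp p.
have eta0 : 0 < nm eta + 1 by rewrite ltr_wpDl ?nm_ge0.
have d0 : 0 < Re e / (nm eta + 1) by rewrite divr_gt0.
suff : F [set x | `|predual_app y p - predual_app x p| < e] by [].
apply: filterS (Fy xi _ d0) => x h; rewrite /= !pE.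
have {}h : nm (amp x xi - amp y xi) * (nm eta + 1) < Re e by rewrite -ltr_pdivlMr.
rewrite distrC normcC (ge0c_Re (ltW e0)) ltcR -innerBl.
apply: le_lt_trans (inner_CS _ _) _; apply: le_lt_trans h.
by rewrite ler_wpM2l ?nm_ge0// lerDl.
Qed.

Lemma predual_continuous (p : predual H) :
  continuous ((fun x => predual_app x p) : weakstar H -> R[i]^o).
Proof.
move=> x B Bx; have h := @initial_continuous (BH H : choiceType) {ptws predual H -> R[i]^o} (@predual_app R H) x.
have ev : nbhs (predual_app x : {ptws predual H -> R[i]^o}) [set g | B (g p)].
  have /cvg_sup/(_ p) := @cvg_id _ (nbhs (predual_app x : {ptws predual H -> R[i]^o})).
  move=> hp; apply: (hp [set g | B (g p)]).
  exact: (@initial_continuous {ptws predual H -> R[i]^o} R[i]^o (fun f : {ptws predual H -> R[i]^o} => f p) (predual_app x) B Bx).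
exact: h ev.
Qed.

Lemma amp_functional_continuous xi eta :
  continuous ((fun x => inner (amp x xi) eta) : weakstar H -> R[i]^o).
Proof.
have [p pE] := amp_predual xi eta.
by have -> : (fun x => inner (amp x xi) eta) = (fun x => predual_app x p);
  [apply/funext => x; rewrite pE|exact: predual_continuous].
Qed.

Lemma within_functional (S : set (BH H)) (f : BH H -> R[i]) xi eta x :
  (forall x, S x -> f x = inner (amp x xi) eta) -> S x ->
  (f : weakstar H -> R[i]^o) @ within S (nbhs (x : weakstar H)) --> (f x : R[i]^o).
Proof.
move=> fE Sx; rewrite fE//.
apply: (@cvg_trans _ (((fun x => inner (amp x xi) eta) : weakstar H -> R[i]^o) @ within S (nbhs (x : weakstar H)))).
  apply: near_eq_cvg; near=> z; rewrite fE//; near: z; exact: withinT.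
apply: cvg_trans (@amp_functional_continuous xi eta x).
by apply: cvg_app; exact: cvg_within.
Unshelve. all: by end_near. Qed.

Lemma normal_functional (S : set (BH H)) (f : BH H -> R[i]) xi eta :
  (forall x, S x -> f x = inner (amp x xi) eta) -> wstar_continuous_functional S f.
Proof. by move=> fE; apply/subspace_continuousP => x Sx; exact: within_functional fE Sx. Qed.

Lemma normal_map (S : set (BH H)) (f : BH H -> BH H) :
  (forall xi eta, exists xi' eta', forall x, S x -> inner (amp (f x) xi) eta = inner (amp x xi') eta') ->
  wstar_continuous S f.
Proof.
move=> fE; apply/subspace_continuousP => x Sx.
apply: initial_cvg; apply/cvg_sup => p; apply: initial_cvg.
have [xi [eta pE]] := predual_amp p; have [xi' [eta' E]] := fE xi eta.
by apply: (@within_functional S (fun x => predual_app (f x) p) xi' eta') => // z Sz; rewrite pE E.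
Qed.

Lemma Viso_nm i u : nm (Viso i u) = nm u.
Proof.
have := Viso_inner i i u u; rewrite eqxx !inner_nm => /complexI/eqP.
by rewrite eqrXn2 ?nm_ge0// => /eqP.
Qed.

Lemma Viso_sum_inner (Z W : nat -> K) (m n : nat) :
  inner (\sum_(m <= k < n) Viso k (Z k)) (\sum_(m <= k < n) Viso k (W k)) =
  \sum_(m <= k < n) inner (Z k) (W k).
Proof.
have orth (Z' : nat -> K) (w : K) n' : inner (\sum_(m <= k < n') Viso k (Z' k)) (Viso n' w) = 0.
  have [mn|nm_] := leqP m n'; last by rewrite big_geq ?inner0l// ltnW.
  rewrite big_nat; elim/big_rec: _ => [|k u /andP[_ kn] IH]; first by rewrite inner0l.
  by rewrite innerDl IH Viso_inner ltn_eqF// addr0.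
elim: n => [|n IH]; first by rewrite !big_geq// inner0l.
have [mn|nm_] := leqP m n; last by rewrite !big_geq// inner0l.
rewrite !big_nat_recr//= innerDl !innerDr IH orth addr0.
by rewrite innerC orth rmorph0 add0r Viso_inner eqxx.
Qed.

Lemma Viso_sum_nm (Z : nat -> K) (m n : nat) :
  nm (\sum_(m <= k < n) Viso k (Z k)) ^+ 2 = \sum_(m <= k < n) nm (Z k) ^+ 2.
Proof.
apply: complexI; rewrite -inner_nm Viso_sum_inner rmorph_sum.
by apply: eq_bigr => k _; rewrite inner_nm.
Qed.

(** [z] is the orthogonal sum of copies of the vectors [Z k]. Since amplified operators commute with
    the isometries, the vector functional of [z] is the sum of those of the [Z k]. *)
Definition vsum (Z : nat -> K) (z : K) := series (fun k => Viso k (Z k)) @ \oo --> z.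

Lemma vsum_exists (Z : nat -> K) (M : R) :
  (forall n, series (fun k => nm (Z k) ^+ 2) n <= M) -> exists z, vsum Z z.
Proof.
move=> ZM; apply: complete_nm => e e0.
pose a := series (fun k => nm (Z k) ^+ 2).
have a_mono m n : (m <= n)%N -> a m <= a n by apply: series_le => k; exact: sqr_ge0.
have as_ : has_sup (range a) by split; [exists (a 0%N), 0%N|exists M => _ [n _ <-]].
have e20 : 0 < (e / 2) ^+ 2 by rewrite exprn_gt0//; lra.
have [_ [N _ <-] aN] := sup_adherent e20 as_.
have key n : (N <= n)%N -> nm (series (fun k => Viso k (Z k)) n - series (fun k => Viso k (Z k)) N) < e / 2.
  move=> Nn; rewrite sub_series_geq// -ltr_sqr ?nnegrE ?nm_ge0//; last lra.
  have -> : nm (\sum_(N <= k < n) Viso k (Z k)) ^+ 2 = a n - a N.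
    by rewrite /a sub_series_geq// Viso_sum_nm.
  have : a n <= sup (range a) by apply: ub_le_sup; [exact: as_.2|exists n].
  by move: aN; rewrite -/a; lra.
exists N => m n Nm Nn.
have h := nmD (series (fun k => Viso k (Z k)) m - series (fun k => Viso k (Z k)) N)
  (- (series (fun k => Viso k (Z k)) n - series (fun k => Viso k (Z k)) N)).
rewrite nmN opprB addrA subrK in h.
exact: lt_halves h (key m Nm) (key n Nn).
Qed.

Lemma vsum_amp (Z : nat -> K) z x : vsum Z z -> vsum (fun k => amp x (Z k)) (amp x z).
Proof.
move=> /(@BH_cvg _ _ (amp x)); rewrite /vsum.
suff -> : amp x \o series (fun k => Viso k (Z k)) = series (fun k => Viso k (amp x (Z k))) by [].
apply/funext => n; rewrite [LHS]/=.
by rewrite /series/=; elim/big_ind2: _ => [|u v u' v' <- <-|k _]; rewrite ?BH_0 ?BH_D ?Viso_amp.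
Qed.

Lemma vsum_inner (Z W : nat -> K) z w : vsum Z z -> vsum W w ->
  (series (fun k => inner (Z k) (W k)) : nat -> R[i]^o) @ \oo --> (inner z w : R[i]^o).
Proof.
move=> Zz Ww; apply/cvg_normc => e e0; have [N hN] := inner_cvg e0 Zz Ww.
by exists N => n /hN; rewrite Viso_sum_inner.
Qed.

Lemma vsum_coord (Z : nat -> K) z k w : vsum Z z -> inner z (Viso k w) = inner (Z k) w.
Proof.
move=> Zz; apply/eqP; rewrite -subr_eq0; apply/eqP/eq0_normc/eqP.
rewrite eq_le normc_ge0 andbT; apply: le_eps => e e0; rewrite add0r.
have [N hN] := inner_cvg e0 Zz (cvg_cst (Viso k w)).
have := hN (maxn N k.+1) (leq_maxl _ _); rewrite -normcN opprB /=.
suff -> : inner (series (fun k => Viso k (Z k)) (maxn N k.+1)) (Viso k w) = inner (Z k) w by move/ltW.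
have kn : (k < maxn N k.+1)%N by rewrite leq_max ltnSn orbT.
rewrite /series/= big_mkord (bigD1 (Ordinal kn))//= innerDl Viso_inner eqxx.
suff -> : inner (\sum_(i < maxn N k.+1 | i != Ordinal kn) Viso i (Z i)) (Viso k w) = 0 by rewrite addr0.
elim/big_rec: _ => [|i u ik IH]; first by rewrite inner0l.
by rewrite innerDl IH Viso_inner ifN ?addr0.
Qed.

Lemma vsum_nm (Z : nat -> K) z k : vsum Z z -> nm (Z k) <= nm z.
Proof.
move=> Zz; have [->|z0] := eqVneq (nm (Z k)) 0; first exact: nm_ge0.
have {}z0 : 0 < nm (Z k) by rewrite lt_def z0 nm_ge0.
rewrite -(ler_pM2r z0) -expr2; have := vsum_coord k (Z k) Zz.
rewrite inner_nm => E; have := inner_CS z (Viso k (Z k)).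
by rewrite E normc_real ger0_norm ?sqr_ge0// Viso_nm.
Qed.

(** The seminorms x |-> |x xi| are directed, which makes the sets where they are small a filter
    base. *)
Lemma merge xi eta : exists zeta : K, forall x, nm (amp x xi) <= nm (amp x zeta) /\ nm (amp x eta) <= nm (amp x zeta).
Proof.
pose Z k : K := if k is k'.+1 then (if k' is 0%N then eta else 0) else xi.
have [n|z Zz] := @vsum_exists Z (nm xi ^+ 2 + nm eta ^+ 2).
  case: n => [|[|n]].
  - by rewrite /series/= big_geq// addr_ge0 ?sqr_ge0.
  - by rewrite /series/= big_nat1 lerDl sqr_ge0.
  - rewrite /series/= big_nat_recl// big_nat_recl//= big1 ?addr0// => k _.
    by rewrite nm0 expr0n.
exists z => x; have zx : vsum _ _ := @vsum_amp _ _ x Zz; split.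
  exact: (vsum_nm 0 zx).
exact: (vsum_nm 1 zx).
Qed.

End WeakStar.

Lemma conj_imag {R : realType} : ('i%C)^*%R = - 'i%C :> R[i].
Proof. by apply/eqP; rewrite conjcE eq_complex/= oppr0 !eqxx. Qed.

(** * Von Neumann algebras *)

Section Adjoints.
Context {R : realType} {H : hilbertType R}.
Implicit Types (x y z : BH H).

Lemma is_adjoint_sym x y : is_adjoint x y -> is_adjoint y x.
Proof. by move=> xy u v; rewrite innerC -xy -innerC. Qed.

Lemma is_adjointM x y x' y' : is_adjoint x x' -> is_adjoint y y' -> is_adjoint (x * y) (y' * x').
Proof. by move=> xx yy u v; rewrite !BH_apM xx yy. Qed.

Lemma is_adjoint_lin (a : R[i]) x y x' y' : is_adjoint x x' -> is_adjoint y y' ->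
  is_adjoint (a *: x + y) (a^*%R *: x' + y').
Proof.
move=> xx yy u v; rewrite !BH_apD !BH_apZ innerDl innerDr innerZl innerZr conjCK.
by rewrite xx yy.
Qed.

Lemma is_adjoint1 : is_adjoint (1 : BH H) 1. Proof. by []. Qed.

Lemma is_adjoint_uniq x y z : is_adjoint x y -> is_adjoint x z -> y = z.
Proof.
move=> xy xz; apply: BH_inj => u; apply: inner_ext => w.
by rewrite innerC -xy xz -innerC.
Qed.

Lemma positive_sq x x' : is_adjoint x x' -> positive_op (x' * x).
Proof.
move=> xx u; rewrite BH_apM (is_adjoint_sym xx) inner_nm ler0c; exact: sqr_ge0.
Qed.

Lemma inner_sq x x' u : is_adjoint x x' -> inner ((x' * x) u) u = (nm (x u) ^+ 2)%:C.
Proof. by move=> xx; rewrite BH_apM (is_adjoint_sym xx) inner_nm. Qed.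

End Adjoints.

Section VonNeumann.
Context {R : realType} {H : hilbertType R}.
Local Notation K := (ell2 H).
Implicit Types (x y d : BH H) (xi eta u v : K) (D : set (BH H)).

(** If no seminorm |x xi| bounded [f], the sets where f = 1 and |x xi| < 1 would generate a proper
    filter converging weak* to 0, against the continuity of [f] at 0. Once [f] is bounded by such a
    seminorm, [Riesz] on the orbit of [xi] gives [eta], directly on [S]. *)
Lemma normal_rep (S : set (BH H)) (f : BH H -> R[i]) :
  subspace S -> linear_on S (f : BH H -> R[i]^o) -> wstar_continuous_functional S f ->
  exists xi eta, forall x, S x -> f x = inner (amp x xi) eta.
Proof.
move=> Ss fl fc.
have f0 : f 0 = 0.
  have := fl 1 0 0 Ss.1 Ss.1; rewrite !scale1r addr0 => /esym/eqP.
  by rewrite -subr_eq0 addrK => /eqP.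
have fZ (a : R[i]) x : S x -> f (a *: x) = a * f x.
  by move=> Sx; rewrite -[a *: x]addr0 fl ?f0 ?addr0//; exact: Ss.1.
have [xi xif] : exists xi, forall x, S x -> normc (f x) <= nm (amp x xi).
  apply: contrapT => /forallNP nxi.
  pose G xi := [set x | [/\ S x, f x = 1 & nm (amp x xi) < 1]].
  have G0 xi : G xi !=set0.
    have /existsNP[x /not_implyP[Sx /negP]] := nxi xi; rewrite -ltNge => xf.
    have fx : f x != 0 by apply: contraTneq xf => ->; rewrite normc0 -leNgt nm_ge0.
    exists ((f x)^-1 *: x); split; first exact: subspaceZ.
      by rewrite fZ// mulVf.
    rewrite ampZ BH_apZ nmZ normcV mulrC ltr_pdivrMr ?mul1r//.
    by rewrite lt_def normc_ge0 andbT; apply: contra fx => /eqP/eq0_normc/eqP.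
  pose F := filter_from [set: K] G.
  have FF : ProperFilter F.
    apply: filter_from_proper => //; apply: filter_from_filter; first by exists 0.
    move=> xi eta _ _; have [zeta zE] := merge xi eta; exists zeta => // x [Sx fx xz].
    by split; split=> //; apply: le_lt_trans xz; have [] := zE x.
  have FS : F S by exists 0 => // x [].
  have F0 : F --> (0 : weakstar H).
    apply: weakstar_cvg => xi e e0; exists ((e^-1)%:C *: xi) => // x [Sx _] /=.
    rewrite BH_Z nmZ normc_real ger0_norm ?invr_ge0 ?(ltW e0)// mulrC ltr_pdivrMr// mul1r.
    by rewrite amp0 BH_ap0 subr0.
  have Fw : F --> within S (nbhs (0 : weakstar H)).
    move=> B /F0 FB; apply: (@filterS _ F _ _ _ _ (filterI FB FS)) => x [/= h Sx]; exact: h.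
  move/subspace_continuousP : fc => /(_ 0 Ss.1)/(cvg_trans (cvg_app _ Fw)) h.
  have {h} : (f : BH H -> R[i]^o) @ F --> (f 0 : R[i]^o) by exact: h.
  rewrite f0 => /cvgrPdist_lt/(_ 1 ltr01) [zeta _ hz].
  by have [x Gx] := G0 zeta; have := hz x Gx; rewrite /= sub0r normrN (_ : f x = 1) ?normr1 ?ltxx//; case: Gx.
have [//|a x y Sx Sy|x y Sx Sy|x Sx|eta [_ etaE]] := @Riesz _ _ _ S (fun x => amp x xi) f 1.
- by rewrite amp_lin.
- by move=> Sy'; rewrite fl.
- by rewrite mul1r xif.
by exists xi, eta.
Qed.

Lemma vn_subspace D : von_neumann_algebra D -> subspace D.
Proof. by move=> [[D0 Dl _] _ _ _]; split. Qed.
Lemma vn_mul D x y : von_neumann_algebra D -> D x -> D y -> D (x * y).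
Proof. by move=> [[_ _ Dm] _ _ _]; exact: Dm. Qed.
Lemma vn_one D : von_neumann_algebra D -> D 1.
Proof. by case. Qed.
Lemma vn_adj D x : von_neumann_algebra D -> D x -> exists2 y, D y & is_adjoint x y.
Proof. by case=> _ _ h _; exact: h. Qed.

(** The commutant on K and not on H: it also contains the matrix units of l2. *)
Definition amp_comm D : set (BH K) := [set b | forall x, D x -> b * amp x = amp x * b].

Lemma amp_comm_subspace D : subspace (amp_comm D).
Proof.
split=> [x _|a b c bD cD x Dx]; first by rewrite mul0r mulr0.
apply: BH_inj => u; rewrite !BH_apM !BH_apD !BH_apZ BH_D BH_Z -!BH_apM.
by rewrite bD ?cD.
Qed.

Lemma amp_commM D b c : amp_comm D b -> amp_comm D c -> amp_comm D (b * c).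
Proof. by move=> bD cD x Dx; rewrite -mulrA cD// mulrA bD// mulrA. Qed.

Lemma amp_comm1 D : amp_comm D 1.
Proof. by move=> x _; rewrite mul1r mulr1. Qed.

Lemma amp_comm_ap D b x u : amp_comm D b -> D x -> b (amp x u) = amp x (b u).
Proof. by move=> bD Dx; rewrite -!BH_apM bD. Qed.

Lemma amp_comm_adj D b b' : von_neumann_algebra D -> amp_comm D b -> is_adjoint b b' -> amp_comm D b'.
Proof.
move=> vD bD bb x Dx; have [y Dy xy] := vn_adj vD Dx.
have xy' := amp_adjoint xy; apply: (is_adjoint_uniq (x := amp y * b)).
  by apply: is_adjointM => //; exact: is_adjoint_sym.
by rewrite -bD//; apply: is_adjointM => //; exact: is_adjoint_sym.
Qed.

Definition orbit_of D u : set K := [set amp x u | x in D].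

Lemma orbit_subspace D u : subspace D -> subspace (orbit_of D u).
Proof.
move=> Ds; split; first by exists 0; [exact: Ds.1|rewrite amp0 BH_ap0].
move=> a _ _ [x Dx <-] [y Dy <-]; exists (a *: x + y); first exact: Ds.2.
by rewrite amp_lin BH_apD BH_apZ.
Qed.

Lemma orbit_stable D u x s : von_neumann_algebra D -> D x -> orbit_of D u s -> orbit_of D u (amp x s).
Proof.
by move=> vD Dx [y Dy <-]; exists (x * y); [exact: vn_mul|rewrite ampM].
Qed.

Lemma orbit_self D u : von_neumann_algebra D -> orbit_of D u u.
Proof. by move=> vD; exists 1; [exact: vn_one|rewrite amp1]. Qed.

Lemma orbit_proj_comm D u Q : von_neumann_algebra D -> projection_on (orbit_of D u) Q -> amp_comm D Q.
Proof.
move=> vD QP x Dx; have [y Dy xy] := vn_adj vD Dx.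
apply: (proj_comm (orbit_subspace _ (vn_subspace vD)) QP (amp_adjoint xy)) => s Ss;
  by apply: subset_closure; exact: orbit_stable.
Qed.

(** The matrix units force [T] to be diagonal with a constant entry [y]. The projection on the
    closure of an orbit D u commutes with D, hence with [T], so that T u lies in that closure; as
    [u] ranges over K, this approximates [y] ultrastrongly by elements of D. *)
Lemma double_commutant D (T : BH K) : von_neumann_algebra D ->
  (forall b, amp_comm D b -> T * b = b * T) -> exists2 y, D y & T = amp y.
Proof.
move=> vD TD.
have single_lin (a : R[i]) g h : single 0 (a *: g + h) = a *: single 0 g + single 0 h :> K.
  apply: coord_ext => n; rewrite coord_lin !singleE.
  by case: ifP => // _; rewrite scaler0 addr0.
have single_nm h : nm (single 0 h : K) = nm h.
  apply/eqP; rewrite -(eqrXn2 (n := 2))// ?nm_ge0//; apply/eqP/complexI.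
  by rewrite -!inner_nm inner_single singleE eqxx.
have [y yE] : exists y : BH H, forall h, y h = coord (T (single 0 h)) 0%N.
  have [B [B0 TB]] := BH_bounded T.
  have [||y yE] := @BH_of _ _ (fun h => coord (T (single 0 h)) 0%N) B; last by exists y.
    by move=> a g h; rewrite single_lin BH_lin coord_lin.
  move=> h; apply: le_trans (coord_nm _ _) _; apply: le_trans (TB _) _.
  by rewrite single_nm.
have Ty : T = amp y.
  (* [m] moves coordinate [i] to place 0, where the entry [y] was read off. *)
  apply: BH_inj => w; apply: coord_ext => i; have [m mE] := @matrix_unit R H 0 i.
  have mD : amp_comm D m.
    by move=> x _; apply: BH_inj => v; rewrite !BH_apM !mE amp_single ampE.
  rewrite ampE yE -mE; have := TD m mD => /(congr1 (fun z : BH K => z w)); rewrite !BH_apM => ->.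
  by rewrite mE singleE eqxx.
exists y => //; have [_ _ _ cD] := vD; apply: cD => B yB.
pose G u := [set x | D x /\ nm (amp x u - amp y u) < 1].
have G0 u : G u !=set0.
  have [Q QP] := projection_exists (orbit_subspace u (vn_subspace vD)).
  have Qc := orbit_proj_comm vD QP.
  have : closure (orbit_of D u) (T u).
    have -> : T u = Q (T u).
      rewrite -BH_apM -TD// BH_apM (proj_id _ QP)//; first exact: orbit_subspace (vn_subspace vD).
      by apply: subset_closure; exact: orbit_self.
    exact: (proj_in QP).
  move=> /closure_nm/(_ 1 ltr01)[_ [x Dx <-] h]; exists x; split=> //.
  by rewrite -Ty nmBC.
pose F := filter_from [set: K] G.
have FF : ProperFilter F.
  apply: filter_from_proper => //; apply: filter_from_filter; first by exists 0.
  move=> xi eta _ _; have [zeta zE] := merge xi eta; exists zeta => // x [Dx].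
  rewrite -BH_apB -ampB => xz.
  by split; split=> //; rewrite -BH_apB -ampB; apply: le_lt_trans xz; have [] := zE (x - y).
have Fy : F --> (y : weakstar H).
  apply: weakstar_cvg => xi e e0; exists ((e^-1)%:C *: xi) => // x [Dx] /=.
  rewrite !BH_Z -scalerBr nmZ normc_real ger0_norm ?invr_ge0 ?(ltW e0)// mulrC.
  by rewrite ltr_pdivrMr// mul1r.
have [zeta _ hz] := Fy B yB; have [x Gx] := G0 zeta.
by exists x; split; [case: Gx|exact: hz].
Qed.

Definition separating D u := forall x, D x -> amp x u = 0 -> x = 0.

(** The projection on the closure of D' u, with D' the commutant, commutes with D', hence is the
    amplification of some [e] in D. As (1 - e) u = 0, separation gives e = 1. *)
Lemma separating_cyclic D u v : von_neumann_algebra D -> separating D u ->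
  closure [set b u | b in amp_comm D] v.
Proof.
move=> vD usep; set S := [set b u | b in amp_comm D].
have Ss : subspace S.
  split; first by exists 0; [exact: (amp_comm_subspace D).1|].
  move=> a _ _ [b bD <-] [c cD <-]; exists (a *: b + c) => //; exact: (amp_comm_subspace D).2.
have [Q QP] := projection_exists Ss.
have [|e De Qe] := @double_commutant D Q vD.
  move=> b bD; have [b' bb] := adjoint_exists b.
  have bD' := amp_comm_adj vD bD bb.
  apply: (proj_comm Ss QP bb) => _ [c cD <-]; apply: subset_closure.
    by exists (b * c) => //; exact: amp_commM.
  by exists (b' * c) => //; exact: amp_commM.
have e1 : 1 - e = 0.
  apply: usep; first by apply: (subspaceB (vn_subspace vD)) => //; exact: vn_one.
  rewrite ampB amp1 BH_apB BH_ap1 -Qe (proj_id Ss QP) ?subrr//.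
  by apply: subset_closure; exists 1 => //; exact: amp_comm1.
have -> : v = Q v by rewrite Qe; move/eqP: e1; rewrite subr_eq0 => /eqP <-; rewrite amp1.
exact: (proj_in QP).
Qed.

Lemma amp_adjoint_inv x y : is_adjoint (amp x) (amp y) -> is_adjoint x y.
Proof.
move=> xy g h; have := xy (single 0 g) (single 0 h).
by rewrite !amp_single !inner_single !singleE eqxx.
Qed.

Definition unitary_in D x y := [/\ D x, D y, is_adjoint x y, x * y = 1 & y * x = 1].

(** For a selfadjoint contraction g, the operators g + i k and g - i k with k = (1 - g^2)^(1/2) are
    mutually adjoint unitaries of sum 2 g; [h] is rescaled to such a g. *)
Lemma selfadj_unitary D h : von_neumann_algebra D -> D h -> is_adjoint h h ->
  exists (a : R[i]) x y, unitary_in D x y /\ h = a *: (x + y).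
Proof.
move=> vD Dh hh; have [B [B0 hB]] := BH_bounded h.
have C0 : 0 < B + 1 by rewrite ltr_wpDl.
pose t := (B + 1)^-1; have t0 : 0 < t by rewrite invr_gt0.
pose g := t%:C *: h; have Dg : D g by apply: subspaceZ => //; exact: vn_subspace.
have gg : is_adjoint g g by move=> u v; rewrite !BH_apZ innerZl innerZr conj_real hh.
have g1 : bound_on g 1.
  split=> // u; rewrite mul1r BH_apZ nmZ normc_real gtr0_norm// /t mulrC ler_pdivrMr// mulrC.
  by apply: le_trans (hB u) _; rewrite ler_wpM2r ?nm_ge0// lerDl.
have [_ ag1] := amp_bound g1.
have [|u|s [ssa ss sc]] := @sqrt_one_minus _ _ (amp (g * g)).
- by apply: amp_adjoint; exact: is_adjointM.
- rewrite ampM BH_apM; apply: le_trans (ag1 _) _; rewrite mul1r; apply: le_trans (ag1 _) _.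
  by rewrite mul1r.
(* The root is constructed on K; it commutes with everything that commutes with g^2, which brings it
   back into D. *)
have [|k Dk sk] := @double_commutant D s vD.
  by move=> b bD; apply: sc; rewrite bD//; exact: vn_mul.
have kk : is_adjoint k k by apply: amp_adjoint_inv; rewrite -sk.
have k2 : k * k = 1 - g * g by apply: amp_inj; rewrite ampM -sk ss ampB amp1.
have gk : k * g = g * k by apply: amp_inj; rewrite !ampM -sk sc// -!ampM mulrA.
have Ds := vn_subspace vD.
have gg2 : g * g + k * k = 1 by rewrite k2 addrC subrK.
have hE : h = ((2 * t)^-1)%:C *: (g + g).
  rewrite /g -scalerDl scalerA -rmorphD -rmorphM /=.
  have -> : (2 * t)^-1 * (t + t) = 1 by field; rewrite gt_eqF.
  by rewrite scale1r.
clearbody g.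
have Zl (a : R[i]) (x y : BH H) : (a *: x) * y = a *: (x * y) by apply: BH_inj.
have Zr (a : R[i]) (x y : BH H) : x * (a *: y) = a *: (x * y).
  by apply: BH_inj => u; rewrite !BH_apM !BH_apZ BH_Z.
have gX : g * ('i%C *: k) = ('i%C *: k) * g by rewrite Zr Zl gk.
have XX : ('i%C *: k) * ('i%C *: k) = - (k * k) by rewrite Zr Zl scalerA -expr2 sqr_i scaleN1r.
exists ((2 * t)^-1)%:C, (g + 'i%C *: k), (g - 'i%C *: k); split; last first.
  by rewrite addrACA subrr addr0.
split.
- by rewrite addrC; apply: Ds.2.
- by rewrite addrC -scaleNr; apply: Ds.2.
- rewrite -scaleNr ![g + _]addrC.
  rewrite -conj_imag.
  exact: is_adjoint_lin.
- by rewrite mulrBr !mulrDl gX opprD addrA addrK XX opprK.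
- by rewrite mulrDr !mulrBl gX addrA subrK XX opprK.
Qed.

(** Reduces centrality to invariance under conjugation by unitaries. The decomposition of [d] is
    into real and imaginary parts, then [selfadj_unitary]. *)
Lemma unitary_span D (P : set (BH H)) : von_neumann_algebra D -> subspace P ->
  (forall x y, unitary_in D x y -> P x) -> forall d, D d -> P d.
Proof.
move=> vD Ps PU; have Psa h : D h -> is_adjoint h h -> P h.
  move=> Dh hh; have [a [x [y [U ->]]]] := selfadj_unitary vD Dh hh.
  apply: subspaceZ => //; apply: subspaceD => //; first exact: PU U.
  by apply: (PU y x); case: U => *; split=> //; exact: is_adjoint_sym.
move=> d Dd; have [d' Dd' dd] := vn_adj vD Dd; have Ds := vn_subspace vD.
have dd' := is_adjoint_sym dd.
have -> : d = (2^-1 : R)%:C *: (d + d') + (2^-1 : R)%:C *: ((- 'i%C) *: ('i%C *: (d - d'))).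
  have -> : (- 'i%C) *: ('i%C *: (d - d')) = d - d' by rewrite scalerA mulNr -expr2 sqr_i opprK scale1r.
  rewrite -scalerDr addrACA subrr addr0.
  by apply: BH_inj => u; rewrite BH_apZ BH_apD half_scaleDD.
apply: subspaceD => //; apply: subspaceZ => //.
  apply: Psa; first exact: subspaceD.
  by move=> u v; rewrite !BH_apD innerDl innerDr dd dd' addrC.
apply: subspaceZ => //; apply: Psa; first by apply: subspaceZ => //; exact: subspaceB.
move=> u v; rewrite !BH_apZ !BH_apB innerZl innerZr innerBl innerBr dd dd'.
rewrite conj_imag.
by rewrite mulNr -mulrN opprB.
Qed.

End VonNeumann.

(** * Positive functionals *)

Section ClosureTools.
Context {R : realType} {K : hilbertType R}.
Implicit Types (u v w : K) (S : set K) (X Y : BH K).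

(** The norm of [w] is <w, w> / |w|, and the first [w] may be replaced by a nearby element of
    [S]. *)
Lemma closure_bound S w (A : R) : 0 <= A -> closure S w ->
  (forall s, S s -> normc (inner s w) <= A * nm s) -> nm w <= A.
Proof.
move=> A0 /closure_nm Sw sA; have [->//|w0] := eqVneq (nm w) 0.
have {}w0 : 0 < nm w by rewrite lt_def w0 nm_ge0.
rewrite -(ler_pM2r w0) -expr2; apply: le_eps => e e0.
have d0 : 0 < e / (nm w + A + 1) by rewrite divr_gt0// ltr_wpDl// addr_ge0// nm_ge0.
have [s Ss ws] := Sw _ d0.
have {}ws : nm (w - s) * (nm w + A + 1) < e.
  by rewrite -ltr_pdivlMr// ltr_wpDl// addr_ge0// nm_ge0.
have -> : nm w ^+ 2 = Re (inner (w - s) w) + Re (inner s w).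
  by rewrite -ReD -innerDl subrK inner_nm.
have h1 : Re (inner (w - s) w) <= nm (w - s) * nm w.
  by apply: le_trans (Re_le_normc _) _; exact: inner_CS.
have h2 : Re (inner s w) <= A * nm s by apply: le_trans (Re_le_normc _) _; exact: sA.
have h3 : nm s <= nm w + nm (w - s).
  by have := nmD w (s - w); rewrite addrC subrK (nmBC s).
have h4 : A * nm s <= A * (nm w + nm (w - s)) by rewrite ler_wpM2l.
by have := nm_ge0 (w - s); move: ws h1 h2 h4; clear; lra.
Qed.

Lemma op_eq_on_closure S X Y : (forall s, S s -> X s = Y s) -> forall u, closure S u -> X u = Y u.
Proof.
move=> XY u /closure_seq[s [sS su]]; apply: (cvg_uniq (BH_cvg su)).
have -> : X \o s = Y \o s by apply/funext => n /=; exact: XY.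
exact: BH_cvg.
Qed.

Lemma op_eq_split S X Y : subspace S -> (forall s, S s -> X s = Y s) ->
  (forall u, (forall s, S s -> inner u s = 0) -> X u = Y u) -> X = Y.
Proof.
move=> Ss XY XY0; have [Q QP] := projection_exists Ss; apply: BH_inj => u.
have E : u = (u - Q u) + Q u by rewrite subrK.
rewrite E (BH_D X (u - Q u)) (BH_D Y (u - Q u)); congr (_ + _).
  by apply: XY0 => s Ss'; rewrite (proj_orth QP)//; exact: subset_closure.
by apply: op_eq_on_closure XY _ _; exact: (proj_in QP).
Qed.

End ClosureTools.

Section PositiveFunctionals.
Context {R : realType} {H : hilbertType R}.
Local Notation K := (ell2 H).
Implicit Types (x y d : BH H) (xi eta zeta u v : K) (D M : set (BH H)) (f : BH H -> R[i]).

Definition positive_on M f := forall x, M x -> positive_op x -> 0 <= f x.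

Lemma linear_on_B M f x y : subspace M -> linear_on M (f : BH H -> R[i]^o) -> M x -> M y -> f (x - y) = f x - f y.
Proof.
move=> Ms fl Mx My; rewrite -scaleN1r addrC fl// addrC; congr (_ + _).
exact: mulN1r.
Qed.

Lemma linear_on_D M f x y : subspace M -> linear_on M (f : BH H -> R[i]^o) -> M x -> M y -> f (x + y) = f x + f y.
Proof. by move=> Ms fl Mx My; rewrite -[x]scale1r fl// !scale1r. Qed.

Lemma linear_on_Z M f (a : R[i]) x : subspace M -> linear_on M (f : BH H -> R[i]^o) -> M x -> f (a *: x) = a * f x.
Proof.
move=> Ms fl Mx; have f0 : f 0 = 0.
  by rewrite -(subrr x) (linear_on_B Ms fl)// subrr.
by rewrite -[a *: x]addr0 fl// ?f0 ?addr0//; exact: Ms.1.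
Qed.

Lemma sq_expand x x' y y' (a : R[i]) :
  (x' - a^*%R *: y') * (x - a *: y) =
  x' * x - a *: (x' * y) - a^*%R *: (y' * x) + (a * a^*%R) *: (y' * y).
Proof.
have Zl (b : R[i]) (z w : BH H) : (b *: z) * w = b *: (z * w) by apply: BH_inj.
have Zr (b : R[i]) (z w : BH H) : z * (b *: w) = b *: (z * w).
  by apply: BH_inj => u; rewrite !BH_apM !BH_apZ BH_Z.
rewrite mulrBr !mulrBl !Zr !Zl scalerA opprB addrA addrAC -!addrA; congr (_ + _).
by rewrite addrCA; congr (_ + _); rewrite addrC.
Qed.

Section CS.
Variables (M : set (BH H)) (f : BH H -> R[i]).
Hypotheses (vM : von_neumann_algebra M) (fl : linear_on M (f : BH H -> R[i]^o)) (fp : positive_on M f).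
Let Ms := vn_subspace vM.

Lemma func_sq_ge0 x x' : M x -> M x' -> is_adjoint x x' -> 0 <= f (x' * x).
Proof. by move=> Mx Mx' xx; apply: fp; [exact: vn_mul|exact: positive_sq]. Qed.

Lemma func_expand x x' y y' (a : R[i]) : M x -> M x' -> M y -> M y' -> is_adjoint x x' -> is_adjoint y y' ->
  0 <= f (x' * x) - a * f (x' * y) - a^*%R * f (y' * x) + a * a^*%R * f (y' * y).
Proof.
move=> Mx Mx' My My' xx yy.
have m z w : M z -> M w -> M (z * w) by exact: vn_mul.
have Z (b : R[i]) z : M z -> M (b *: z) by exact: subspaceZ.
have B z w : M z -> M w -> M (z - w) by exact: subspaceB.
have := @func_sq_ge0 (x - a *: y) (x' - a^*%R *: y').
rewrite sq_expand (linear_on_D Ms fl) ?(linear_on_B Ms fl) ?(linear_on_Z _ Ms fl); try by auto.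
apply; try by auto.
by rewrite -!scaleNr addrC [in X in is_adjoint _ X]addrC -rmorphN; exact: is_adjoint_lin.
Qed.

(** Polarization: the values of [func_expand] at a = 1 and a = i are real, which relates the
    imaginary parts and the real parts. *)
Lemma func_hermitian x x' y y' : M x -> M x' -> M y -> M y' -> is_adjoint x x' -> is_adjoint y y' ->
  f (y' * x) = (f (x' * y))^*%R.
Proof.
move=> Mx Mx' My My' xx yy.
have hx := ge0c_Re (func_sq_ge0 Mx Mx' xx); have hy := ge0c_Re (func_sq_ge0 My My' yy).
have h1 := func_expand (1 : R[i]) Mx Mx' My My' xx yy.
have h2 := func_expand 'i%C Mx Mx' My My' xx yy.
move: h1 h2; rewrite hx hy conj_imag rmorph1 conjcE.
move: (f (x' * y)) (f (y' * x)) (Re _) (Re _) => [a b] [c d] p q.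
rewrite !lecE /= => /andP[/eqP h1 _] /andP[/eqP h2 _].
by apply/eqP; rewrite eq_complex /=; apply/andP; split; apply/eqP; lra.
Qed.

Lemma func_CS x x' y y' : M x -> M x' -> M y -> M y' -> is_adjoint x x' -> is_adjoint y y' ->
  normc (f (y' * x)) ^+ 2 <= Re (f (x' * x)) * Re (f (y' * y)).
Proof.
move=> Mx Mx' My My' xx yy.
apply: discriminant_bound => [|a]; first by have := func_sq_ge0 My My' yy; rewrite lecE => /andP[].
have := func_expand a Mx Mx' My My' xx yy; rewrite lecE => /andP[_].
rewrite (func_hermitian My My' Mx Mx' yy xx) mulJc ReD !ReB ReZ /=.
have -> : Re (a * (f (y' * x))^*%R) = Re (a^*%R * f (y' * x)).
  by rewrite -(complexRe_conj (a * _)) rmorphM/= conjCK.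
lra.
Qed.

(* Bounded Radon-Nikodym theorem: f is [x |-> <T x zeta, zeta>] with T in the
   commutant, hence the vector functional of [T^(1/2) zeta]. *)
Lemma vector_rep zeta (C : R) : 0 <= C ->
  (forall x x', M x -> M x' -> is_adjoint x x' -> Re (f (x' * x)) <= C ^+ 2 * nm (amp x zeta) ^+ 2) ->
  exists Om, closure (orbit_of M zeta) Om /\ forall x, M x -> f x = inner (amp x Om) Om.
Proof.
move=> C0 fC; have M1 := vn_one vM; have os := orbit_subspace zeta Ms.
have aM x : M x -> exists2 y, M y & is_adjoint x y by exact: vn_adj.
have f1 : 0 <= Re (f 1).
  have := func_sq_ge0 M1 M1 (@is_adjoint1 R H); rewrite mulr1 lecE => /andP[] //.
(* [ka] is the vector that T zeta has to be. *)
have [a x y Mx My|a x y Mx My|x Mx|ka [kac kaE]] :=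
  @Riesz _ _ _ M (fun x => amp x zeta) f (C * Num.sqrt (Re (f 1))) Ms.
- by rewrite amp_lin.
- by rewrite fl.
- have [x' Mx' xx] := aM x Mx.
  rewrite -ler_sqr ?nnegrE ?normc_ge0 ?mulr_ge0 ?sqrtr_ge0 ?nm_ge0//.
  have := func_CS Mx Mx' M1 M1 xx (@is_adjoint1 R H); rewrite !mul1r => /le_trans; apply.
  rewrite !exprMn sqr_sqrtr// mulrAC ler_wpM2r//; exact: fC.
have kaS x : M x -> closure (orbit_of M zeta) (amp x ka).
  by move=> Mx; apply: closure_stable kac => s Ss; apply: subset_closure; exact: orbit_stable.
(* Cauchy-Schwarz for [f], tested on the vectors y zeta; this bound makes x zeta |-> x ka a bounded
   operator. *)
have kab x : M x -> nm (amp x ka) <= C ^+ 2 * nm (amp x zeta).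
  move=> Mx; have [x' Mx' xx] := aM x Mx.
  apply: closure_bound (kaS x Mx) _; first by rewrite mulr_ge0 ?sqr_ge0 ?nm_ge0.
  move=> _ [y My <-]; have [y' My' yy] := aM y My.
  rewrite -ler_sqr ?nnegrE ?normc_ge0 ?mulr_ge0 ?sqr_ge0 ?nm_ge0//.
  have -> : inner (amp y zeta) (amp x ka) = f (x' * y).
    by rewrite kaE ?ampM ?BH_apM ?(is_adjoint_sym (amp_adjoint xx))//; exact: vn_mul.
  apply: le_trans (func_CS My My' Mx Mx' yy xx) _.
  rewrite (_ : (_ * _ * _) ^+ 2 = (C ^+ 2 * nm (amp y zeta) ^+ 2) * (C ^+ 2 * nm (amp x zeta) ^+ 2)); last by ring.
  apply: ler_pM; rewrite ?fC//.
    by have := func_sq_ge0 My My' yy; rewrite lecE => /andP[].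
  by have := func_sq_ge0 Mx Mx' xx; rewrite lecE => /andP[].
have [||x|T [TE T0]] := @operator_extension _ _ _ M (fun x => amp x zeta) (fun x => amp x ka) (C ^+ 2) Ms.
- by move=> a x y Mx My; rewrite amp_lin.
- by move=> a x y Mx My; rewrite amp_lin.
- exact: kab.
have {}T0 u : (forall s, orbit_of M zeta s -> inner u s = 0) -> T u = 0.
  by move=> uS; apply: T0 => x Mx; apply: uS; exists x.
have [Q QP] := projection_exists os.
have QM := orbit_proj_comm vM QP.
have TM : amp_comm M T.
  move=> x Mx; have [x' Mx' xx] := aM x Mx; apply: (op_eq_split os) => [_ [y My <-]|u uS].
    have E : amp x (amp y zeta) = amp (x * y) zeta by rewrite ampM.
    by rewrite !BH_apM E (TE y)// TE ?ampM//; exact: vn_mul.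
  rewrite !BH_apM T0 ?T0 ?BH_0//.
  by move=> s Ss; rewrite (amp_adjoint xx); apply: uS; exact: orbit_stable.
have TQ : T * Q = T.
  apply: (op_eq_split os) => [s Ss|u uS]; rewrite BH_apM.
    by rewrite (proj_id os QP)//; exact: subset_closure.
  by rewrite (proj_0 os QP uS) BH_0 T0.
have Tcl u : closure (orbit_of M zeta) (T u).
  rewrite -TQ BH_apM; apply: (@closure_stable _ _ (orbit_of M zeta) T); last exact: (proj_in QP).
  by move=> _ [x Mx <-]; rewrite TE//; exact: kaS.
have QT : Q * T = T by apply: BH_inj => u; rewrite BH_apM (proj_id os QP).
have Tin u v : inner (T u) v = inner (T (Q u)) (Q v).
  by rewrite -[T (Q u)]BH_apM TQ -{1}QT BH_apM (proj_selfadj QP).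
have fxy x y x' : M x -> M y -> M x' -> is_adjoint x x' -> inner (amp y zeta) (amp x ka) = f (x' * y).
  move=> Mx My Mx' xx.
  by rewrite kaE ?ampM ?BH_apM ?(is_adjoint_sym (amp_adjoint xx))//; exact: vn_mul.
have Torb s t : orbit_of M zeta s -> orbit_of M zeta t -> inner (T s) t = inner s (T t).
  move=> [x Mx <-] [y My <-]; have [x' Mx' xx] := aM x Mx; have [y' My' yy] := aM y My.
  by rewrite !TE// innerC (fxy x y x')// (fxy y x y')// -(func_hermitian Mx Mx' My My').
have Tsa : selfadj T.
  move=> u v; rewrite Tin; transitivity (inner (Q u) (T (Q v))); last by rewrite innerC -Tin -innerC.
  have /closure_seq[s [sS su]] := proj_in QP (u := u).
  have /closure_seq[t [tS tv]] := proj_in QP (u := v).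
  by apply: (inner_lim_eq (BH_cvg (x := T) su) tv su (BH_cvg (x := T) tv)) => n; exact: Torb.
have Tpos : positive_op T.
  move=> u; rewrite Tin; have /closure_seq[s [sS su]] := proj_in QP (u := u).
  apply: (inner_lim_ge0 (BH_cvg (x := T) su) su) => n /=.
  rewrite Torb//; have [x Mx <-] := sS n; have [x' Mx' xx] := aM x Mx.
  by rewrite TE// (fxy x x x')//; exact: func_sq_ge0.
have [s [ssa ss sc]] := sqrt_exists Tsa Tpos.
exists (s zeta); split.
  (* [Q] commutes with [T], hence with its root, so that s zeta stays in the closure of the
     orbit. *)
  have -> : s zeta = Q (s zeta).
    rewrite -BH_apM -sc ?BH_apM ?(proj_id os QP)//; last by rewrite TQ QT.
    by apply: subset_closure; exact: orbit_self.
  exact: (proj_in QP).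
move=> x Mx; rewrite -(amp_comm_ap _ (D := M) (x := x))//; last first.
  by move=> z Mz; apply: sc; exact: TM.
rewrite ssa -BH_apM ss -{2}[zeta]BH_ap1 -amp1 TE// amp1 BH_ap1.
exact: kaE.
Qed.

End CS.

(* On the orbit of zeta the commutant element b acts like the square root of the
   compression Q b^* b Q. *)
Lemma compress_sqrt D zeta Q b : von_neumann_algebra D -> projection_on (orbit_of D zeta) Q ->
  amp_comm D b -> exists s, [/\ selfadj s, amp_comm D s, s * Q = Q * s &
    forall u v, closure (orbit_of D zeta) u -> closure (orbit_of D zeta) v ->
      inner (b u) (b v) = inner (s u) (s v)].
Proof.
move=> vD QP bD; have os := orbit_subspace zeta (vn_subspace vD).
have [b' bb] := adjoint_exists b; have bD' := amp_comm_adj vD bD bb.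
have QD := orbit_proj_comm vD QP; pose T := Q * (b' * b) * Q.
have QQ : Q * Q = Q.
  by apply: BH_inj => u; rewrite BH_apM (proj_id os QP)//; exact: (proj_in QP).
have Tin u v : inner (T u) v = inner (b (Q u)) (b (Q v)).
  by rewrite /T !BH_apM (proj_selfadj QP) (is_adjoint_sym bb).
have Tsa : selfadj T by move=> u v; rewrite Tin innerC -Tin -innerC.
have Tpos : positive_op T by move=> u; rewrite Tin inner_nm ler0c sqr_ge0.
have [s [ssa ss sc]] := sqrt_exists Tsa Tpos.
have TD : amp_comm D T by do !apply: amp_commM => //.
exists s; split=> //.
- by move=> x Dx; apply: sc; exact: TD.
- by apply: sc; rewrite /T -mulrA QQ -!mulrA [RHS]mulrA QQ.
by move=> u v uo vo; rewrite -(ssa (s u)) -BH_apM ss Tin !(proj_id os QP).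
Qed.

(** Induction step of a weighted Cauchy-Schwarz inequality: [A] is the total of the weights so far
    and t^2 the next weight. *)
Lemma two_term_CS (A Q S a t : R) : 0 <= A -> 0 <= Q -> 0 <= a -> 0 <= t -> 0 <= S ->
  S ^+ 2 <= A * Q -> (S + t * a) ^+ 2 <= (A + t ^+ 2) * (Q + a ^+ 2).
Proof.
move=> A0 Q0 a0 t0 S0 SAQ; suff : 2 * (t * a * S) <= A * a ^+ 2 + t ^+ 2 * Q by lra.
rewrite -ler_sqr ?nnegrE ?addr_ge0 ?mulr_ge0 ?sqr_ge0//.
have h : (t * a) ^+ 2 * S ^+ 2 <= (t * a) ^+ 2 * (A * Q) by rewrite ler_wpM2l ?sqr_ge0.
have := sqr_ge0 (A * a ^+ 2 - t ^+ 2 * Q); lra.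
Qed.

(* Expand xi as the sum of a geometrically convergent series [p k zeta] in the
   commutant orbit; [b k = 2 ^ k p k] comes from Cauchy-Schwarz with weights [4 ^ -k]. *)
Lemma domination D zeta xi : von_neumann_algebra D -> separating D zeta ->
  exists (b : nat -> BH K) (c : R), [/\ 0 <= c, forall k, amp_comm D (b k),
    forall k, nm (b k zeta) ^+ 2 <= c / 2 ^+ k &
    forall x (B : R) N, bound_on x B -> nm (amp x xi) ^+ 2 <=
      2 * (\sum_(0 <= k < N) nm (amp x (b k zeta)) ^+ 2 + B ^+ 2 * (2 * c / 2 ^+ N))].
Proof.
(* The rate 4^-k is chosen so that, after multiplication by 2^k, the norms still decrease like
   2^-k. *)
move=> vD sep; pose q : R := 4^-1; have q0 k : 0 < q ^+ k by rewrite exprn_gt0// invr_gt0.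
have qS k : q ^+ k.+1 = q ^+ k / 4 by rewrite exprSr.
have /choice[a aE] k : exists a, amp_comm D a /\ nm (xi - a zeta) < q ^+ k / 8.
  have /closure_nm/(_ (q ^+ k / 8)) [|_ [a aD <-] h] := @separating_cyclic _ _ D zeta xi vD sep.
    by rewrite divr_gt0.
  by exists a.
pose p k := if k is k'.+1 then a k'.+1 - a k' else a 0%N.
have pD k : amp_comm D (p k).
  by case: k => [|k]; [exact: (aE _).1|apply: (subspaceB (amp_comm_subspace D)); exact: (aE _).1].
have psum n : \sum_(0 <= k < n.+1) p k zeta = a n zeta.
  elim: n => [|n IH]; first by rewrite big_nat1.
  by rewrite big_nat_recr//= IH addrC subrK.
have aux (r s t X Q : R) : r <= s + t -> s < Q / 4 / 8 -> t < Q / 8 -> 0 <= X -> 0 < Q ->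
    r <= (X + 1) * (Q / 4).
  by move=> h1 h2 h3 h4 h5; have := mulr_ge0 h4 (ltW h5); lra.
have pn k : nm (p k zeta) <= (nm xi + 1) * q ^+ k.
  case: k => [|k].
    have := (aE 0%N).2; have := nmD (a 0%N zeta - xi) xi; rewrite subrK nmBC expr0; lra.
  have h1 := (aE k.+1).2; have h2 := (aE k).2; rewrite BH_apB qS in h1 *.
  have h := nmD (a k.+1 zeta - xi) (xi - a k zeta); rewrite addrA subrK (nmBC _ xi) in h.
  exact: aux h h1 h2 (nm_ge0 xi) (q0 k).
pose b k := ((2 ^+ k : R)%:C : R[i]) *: p k.
have bn k : nm (b k zeta) = 2 ^+ k * nm (p k zeta).
  by rewrite BH_apZ nmZ normc_real ger0_norm// exprn_ge0.
pose c := (nm xi + 1) ^+ 2; have c0 : 0 <= c by exact: sqr_ge0.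
have bc k : nm (b k zeta) ^+ 2 <= c / 2 ^+ k.
  have h : nm (b k zeta) <= (nm xi + 1) * (2^-1) ^+ k.
    rewrite bn; have -> : (2^-1 : R) ^+ k = 2 ^+ k * q ^+ k.
      by rewrite -exprMn; congr (_ ^+ k); rewrite /q; field.
    by rewrite mulrCA ler_wpM2l// exprn_ge0.
  apply: le_trans (_ : ((nm xi + 1) * (2^-1) ^+ k) ^+ 2 <= _).
    by rewrite ler_sqr ?nnegrE ?nm_ge0// mulr_ge0 ?exprn_ge0// addr_ge0 ?nm_ge0.
  rewrite exprMn ler_wpM2l ?sqr_ge0// -exprVn expr2 ler_piMr ?exprn_ge0// exprn_ile1//; lra.
exists b, c; split=> // [k|x B N xB]; first exact: subspaceZ (amp_comm_subspace D) (pD k).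
have [B0 xB'] := amp_bound xB.
(* The terms from [N] on are at most B^2 c / 2^k, of total 2 B^2 c / 2^N. *)
have tail n : \sum_(0 <= k < N + n) nm (amp x (b k zeta)) ^+ 2 <=
    \sum_(0 <= k < N) nm (amp x (b k zeta)) ^+ 2 + B ^+ 2 * (2 * c / 2 ^+ N).
  have h m : \sum_(0 <= k < N + m) nm (amp x (b k zeta)) ^+ 2 <=
      \sum_(0 <= k < N) nm (amp x (b k zeta)) ^+ 2 + B ^+ 2 * (2 * c / 2 ^+ N - 2 * c / 2 ^+ (N + m)).
    elim: m => [|m IH]; first by rewrite addn0 subrr mulr0 addr0.
    rewrite addnS big_nat_recr//=.
    have e1 : 2 * c / 2 ^+ (N + m).+1 = c / 2 ^+ (N + m) by rewrite exprS; field; rewrite expf_neq0.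
    have e2 : nm (amp x (b (N + m)%N zeta)) ^+ 2 <= B ^+ 2 * (c / 2 ^+ (N + m)).
      apply: le_trans (_ : (B * nm (b (N + m)%N zeta)) ^+ 2 <= _).
        by rewrite ler_sqr ?nnegrE ?nm_ge0 ?mulr_ge0 ?nm_ge0.
      by rewrite exprMn ler_wpM2l ?sqr_ge0.
    rewrite e1; move: IH e2; rewrite -!mulrA; move: (c / 2 ^+ (N + m)) => r; lra.
  apply: le_trans (h n) _; rewrite lerD2l ler_wpM2l ?sqr_ge0// gerBl.
  by apply: divr_ge0; [exact: mulr_ge0|exact: exprn_ge0].
(* 2 - 2 * 4^-n majorizes the sum of the weights 4^-k for k < n, with room for the induction. *)
have partial n : nm (amp x (\sum_(0 <= k < n) p k zeta)) ^+ 2 <=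
    (2 - 2 * q ^+ n) * \sum_(0 <= k < n) nm (amp x (b k zeta)) ^+ 2.
  elim: n => [|n IH]; first by rewrite !big_geq// BH_0 nm0 expr0n mulr0.
  rewrite !big_nat_recr//= BH_D.
  set S := amp x (\sum_(0 <= k < n) _) in IH *; set Qs := \sum_(0 <= k < n) _ in IH *.
  have Qs0 : 0 <= Qs by apply: sumr_ge0 => k _; exact: sqr_ge0.
  have q1 : q ^+ n <= 1 by apply: exprn_ile1; rewrite /q; lra.
  have A0 : 0 <= 2 - 2 * q ^+ n by lra.
  have h := two_term_CS A0 Qs0 (nm_ge0 (amp x (b n zeta))) (ltac:(by rewrite exprn_ge0) : 0 <= (2^-1) ^+ n :> R) (nm_ge0 S) IH.
  have e : (2^-1 : R) ^+ n * nm (amp x (b n zeta)) = nm (amp x (p n zeta)).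
    by rewrite /b BH_apZ BH_Z nmZ normc_real ger0_norm ?exprn_ge0// exprVn mulrA mulVf ?mul1r// expf_neq0.
  rewrite e in h; apply: le_trans (_ : (nm S + nm (amp x (p n zeta))) ^+ 2 <= _).
    by rewrite ler_sqr ?nnegrE ?nm_ge0 ?addr_ge0 ?nm_ge0// nmD.
  apply: le_trans h _; rewrite ler_wpM2r ?addr_ge0 ?sqr_ge0//.
  have -> : ((2^-1 : R) ^+ n) ^+ 2 = q ^+ n.
    by rewrite -exprM mulnC exprM; congr (_ ^+ n); rewrite /q; field.
  by rewrite qS; have := q0 n; lra.
set L := _ + _ in tail *; rewrite -/L.
have L0 : 0 <= L.
  apply: addr_ge0; first by apply: sumr_ge0 => k _; exact: sqr_ge0.
  apply: mulr_ge0; first exact: sqr_ge0.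
  by apply: divr_ge0; [exact: mulr_ge0|exact: exprn_ge0].
have key n : (N <= n)%N -> nm (amp x (a n zeta)) ^+ 2 <= 2 * L.
  move=> Nn; rewrite -psum; apply: le_trans (partial _) _.
  have := tail (n.+1 - N)%N; rewrite subnKC ?(leq_trans Nn)// => t.
  have q1 := q0 n.+1; apply: ler_pM => //; first by have : q ^+ n.+1 <= 1; [apply: exprn_ile1; rewrite /q; lra|clear -q1; lra].
    by apply: sumr_ge0 => k _; exact: sqr_ge0.
  lra.
have azeta : (fun n => a (N + n)%N zeta) @ \oo --> xi.
  apply/cvg_nm => e e0; have [M MM] := exists_invS e0; exists M => n Mn.
  rewrite nmBC; apply: lt_trans (aE _).2 _; apply: le_lt_trans MM.
  have q2 m : q ^+ m <= m.+1%:R^-1.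
    elim: m => [|m IH]; first by rewrite expr0 invr1.
    rewrite qS; apply: le_trans (_ : m.+1%:R^-1 / 4 <= _); first by rewrite ler_wpM2r.
    rewrite -invfM lef_pV2 ?posrE ?mulr_gt0// -natrM ler_nat; lia.
  apply: le_trans (_ : q ^+ (N + n) <= _); first by rewrite ler_pdivrMr// ler_peMr ?(ltW (q0 _))//; lra.
  apply: le_trans (q2 _) _; rewrite lef_pV2 ?posrE// ler_nat ltnS.
  by apply: leq_trans Mn _; exact: leq_addl.
have -> : 2 * L = Num.sqrt (2 * L) ^+ 2 by rewrite sqr_sqrtr// mulr_ge0.
rewrite ler_sqr ?nnegrE ?nm_ge0 ?sqrtr_ge0//; apply: nm_cvg_le (BH_cvg (x := amp x) azeta) _ => n.
suff : nm (amp x (a (N + n)%N zeta)) <= Num.sqrt (2 * L) by [].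
rewrite -ler_sqr ?nnegrE ?nm_ge0 ?sqrtr_ge0// [leRHS]sqr_sqrtr ?mulr_ge0//.
by apply: key; exact: leq_addr.
Qed.

End PositiveFunctionals.

Lemma geometric_small {R : realType} (A e : R) : 0 <= A -> 0 < e -> exists N : nat, A / 2 ^+ N <= e.
Proof.
move=> A0 e0; have A1 : 0 < A + 1 by rewrite ltr_wpDl.
have [N hN] := exists_invS (divr_gt0 e0 A1); exists N.
have p2 : N.+1%:R <= 2 ^+ N :> R by rewrite -natrX ler_nat ltn_expl.
have i2 : (2 ^+ N)^-1 <= N.+1%:R^-1 :> R by rewrite lef_pV2 ?posrE ?exprn_gt0.
apply: le_trans (_ : A * N.+1%:R^-1 <= _); first by rewrite ler_wpM2l.
move: hN; rewrite ltr_pdivlMr// => /ltW; apply: le_trans.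
by rewrite mulrC ler_wpM2l// lerDl.
Qed.

(** * The expectation of a trace vector *)

Section TraceVector.
Context {R : realType} {H : hilbertType R}.
Local Notation K := (ell2 H).
Implicit Types (x y d : BH H) (xi eta u v : K) (D M : set (BH H)) (f : BH H -> R[i]).

(** Bessel's inequality for isometries with orthogonal ranges: [Z k] is the adjoint of [Viso k]
    applied to [z]. *)
Lemma Viso_bessel (Z : nat -> K) z N : (forall k w, inner z (Viso k w) = inner (Z k) w) ->
  \sum_(0 <= k < N) nm (Z k) ^+ 2 <= nm z ^+ 2.
Proof.
move=> Zz; pose s := \sum_(0 <= k < N) Viso k (Z k).
have ss : nm s ^+ 2 = \sum_(0 <= k < N) nm (Z k) ^+ 2 := Viso_sum_nm Z 0 N.
have zs : inner s z = (nm s ^+ 2)%:C.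
  rewrite ss rmorph_sum /s; elim/big_ind2: _ => [|a b a' b' h1 h2|k _].
  - by rewrite inner0l.
  - by rewrite innerDl h1 h2.
  - by rewrite innerC Zz inner_nm conj_real.
rewrite -ss; have [->|s0] := eqVneq (nm s) 0; first by rewrite expr0n sqr_ge0.
have {}s0 : 0 < nm s by rewrite lt_def s0 nm_ge0.
rewrite ler_sqr ?nnegrE ?nm_ge0// -(ler_pM2l s0) -expr2.
by have := inner_CS s z; rewrite zs normc_real ger0_norm ?sqr_ge0.
Qed.

Lemma vsum_partial (Z : nat -> K) z N : vsum Z z -> \sum_(0 <= k < N) nm (Z k) ^+ 2 <= nm z ^+ 2.
Proof. by move=> Zz; apply: Viso_bessel => k w; exact: vsum_coord. Qed.

Variables (M D : set (BH H)) (zeta : K) (Q : BH K).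
Hypotheses (vM : von_neumann_algebra M) (vD : von_neumann_algebra D) (DM : D `<=` M).
Hypothesis central : forall d x, D d -> M x ->
  inner (amp (d * x) zeta) zeta = inner (amp (x * d) zeta) zeta.
Hypothesis sep : separating D zeta.
Hypothesis QP : projection_on (orbit_of D zeta) Q.
Let Ds := vn_subspace vD.
Let os := orbit_subspace zeta Ds.
Let orb := closure (orbit_of D zeta).

Let QD : amp_comm D Q. Proof. exact: orbit_proj_comm QP. Qed.

Let orb_zeta : orb zeta. Proof. by apply: subset_closure; exact: orbit_self. Qed.

Let orb_amp d u : D d -> orb u -> orb (amp d u).
Proof.
move=> Dd; apply: (@closure_stable _ _ (orbit_of D zeta) (amp d)) => s Ss.
by apply: subset_closure; exact: orbit_stable.
Qed.

Let orb_D d : D d -> orb (amp d zeta).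
Proof. by move=> Dd; exact: orb_amp. Qed.

Let orb_comm (s : BH K) u : s * Q = Q * s -> orb u -> orb (s u).
Proof.
move=> sQ uo; have -> : s u = Q (s u) by rewrite -BH_apM -sQ BH_apM (proj_id os QP).
exact: (proj_in QP).
Qed.

(** Expand both squares: |d' zeta| = |d zeta| by centrality, and the cross terms are complex
    conjugate because [c] is selfadjoint and commutes with D. *)
Lemma trace_adjoint_dist (c : BH K) d d' : amp_comm D c -> selfadj c -> D d -> D d' -> is_adjoint d d' ->
  nm (amp d' zeta - c zeta) = nm (amp d zeta - c zeta).
Proof.
move=> cD csa Dd Dd' dd.
have h1 : nm (amp d' zeta) ^+ 2 = nm (amp d zeta) ^+ 2.
  apply: complexI; rewrite -!inner_nm.
  rewrite (is_adjoint_sym (amp_adjoint dd)) (amp_adjoint dd) innerC [RHS]innerC; congr (_^*%R).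
  by have := central Dd (DM Dd'); rewrite !ampM.
have h2 : inner (amp d' zeta) (c zeta) = (inner (amp d zeta) (c zeta))^*%R.
  rewrite (is_adjoint_sym (amp_adjoint dd)) -(amp_comm_ap _ cD)// -csa.
  exact: innerC.
have e (w : K) : nm (w - c zeta) ^+ 2 = nm w ^+ 2 - 2 * Re (inner w (c zeta)) + nm (c zeta) ^+ 2.
  by have := nm_expand w (c zeta) 1; rewrite scale1r rmorph1 mul1r normc1 expr1n mul1r.
have E : nm (amp d' zeta - c zeta) ^+ 2 = nm (amp d zeta - c zeta) ^+ 2.
  by rewrite (e (amp d' zeta)) (e (amp d zeta)) h1 h2 complexRe_conj.
by move/eqP: E; rewrite eqrXn2 ?nm_ge0// => /eqP.
Qed.

(* The commutation theorem for a trace vector: c zeta is a limit of vectors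
   [e n zeta] with e n in D, and so is the limit of the [e n^* zeta]. *)
Lemma compression_comm (c : BH K) x : amp_comm D c -> selfadj c -> c * Q = Q * c -> M x ->
  c (Q (amp x zeta)) = Q (amp x (c zeta)).
Proof.
move=> cD csa cQ Mx; apply: (closure_ext os).
- by apply: orb_comm => //; exact: (proj_in QP).
- exact: (proj_in QP).
move=> _ [d Dd <-]; have [d' Dd' dd] := vn_adj vD Dd.
rewrite csa (amp_comm_ap _ cD)// !(proj_innerl QP); last first.
- by apply: orb_amp => //; exact: orb_comm.
- exact: orb_D.
have /closure_seq[s [sS sc]] : orb (c zeta) by exact: orb_comm.
have /choice[e eE] n : exists e, D e /\ amp e zeta = s n by have [e De <-] := sS n; exists e.
have /choice[e' eE'] n : exists e', D e' /\ is_adjoint (e n) e'.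
  by have [y Dy ey] := vn_adj vD (eE n).1; exists y.
have sc' : (fun n => amp (e' n) zeta) @ \oo --> c zeta.
  apply/cvg_nm => eps eps0; have [N hN] := (cvg_nm _ _).1 sc _ eps0; exists N => n /hN.
  by rewrite -(eE n).2 (trace_adjoint_dist cD csa (eE n).1 (eE' n).1 (eE' n).2).
(* At each [n] the two sides are the values of the vector functional of zeta at e' d' x and at d' x
   e', equal by [central]. *)
apply: (@inner_lim_eq _ _ (fun=> amp x zeta) (amp d \o s) (amp x \o (fun n => amp (e' n) zeta)) (fun=> amp d zeta)).
- exact: cvg_cst.
- exact: BH_cvg.
- exact: BH_cvg.
- exact: cvg_cst.
move=> n /=; have ee := amp_adjoint (eE' n).2.
have := central (eE' n).1 (vn_mul vM (DM Dd') Mx).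
rewrite !ampM !BH_apM -(eE n).2 (is_adjoint_sym ee) !(is_adjoint_sym (amp_adjoint dd)) => ->.
by [].
Qed.

(** With k = Q x zeta, the operator b zeta |-> b k, for [b] in the commutant of D, commutes with
    that commutant, so only its boundedness is at stake. On the orbit closure [b] has the same norms
    as a selfadjoint [s] to which [compression_comm] applies, and s k = Q x s zeta. *)
Lemma compression_exists x : M x -> exists2 y, D y & amp y zeta = Q (amp x zeta).
Proof.
move=> Mx; pose k := Q (amp x zeta); have ko : orb k by exact: (proj_in QP).
have [B xB] := BH_bounded x; have [B0 xB'] := amp_bound xB.
have bk b : amp_comm D b -> nm (b k) <= B * nm (b zeta).
  move=> bD; have [s [ssa sD sQ sb]] := compress_sqrt vD QP bD.
  have nmE' u : orb u -> nm (b u) = nm (s u).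
    move=> uo; have := sb u u uo uo; rewrite !inner_nm => /complexI/eqP.
    by rewrite eqrXn2 ?nm_ge0// => /eqP.
  rewrite !nmE'// compression_comm//; apply: le_trans (xB' _).
  have := proj_selfadj QP; set w := amp x (s zeta) => sa.
  have [->|Qw] := eqVneq (nm (Q w)) 0; first exact: nm_ge0.
  have {}Qw : 0 < nm (Q w) by rewrite lt_def Qw nm_ge0.
  rewrite -(ler_pM2r Qw) -expr2; have := inner_CS w (Q w).
  by rewrite -(proj_innerl QP) ?inner_nm ?normc_real ?ger0_norm ?sqr_ge0//; exact: (proj_in QP).
have [||b|T [TE _]] := @operator_extension _ _ _ (amp_comm D) (fun b => b zeta) (fun b => b k) B (amp_comm_subspace D).
- by [].
- by [].
- exact: bk.
have [|y Dy Ty] := @double_commutant _ _ D T vD.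
  move=> b bD; apply: BH_inj => u.
  apply: (@op_eq_on_closure _ _ [set c zeta | c in amp_comm D]); last exact: separating_cyclic.
  move=> _ [c cD <-]; rewrite !BH_apM (TE c)//.
  by have := TE (b * c) (amp_commM bD cD); rewrite !BH_apM.
by exists y => //; have := TE 1 (@amp_comm1 _ _ D); rewrite !BH_ap1 -Ty.
Qed.

(** Psi x is determined by Psi(x) zeta = Q x zeta. Everything rests on [F]: on the orbit closure,
    Psi x and x have the same matrix coefficients. The commutant then carries this information to
    all of K. *)
Lemma trace_expectation : exists Psi : BH H -> BH H,
  normal_conditional_expectation M D Psi /\
  forall x d, M x -> D d -> inner (amp (Psi x) zeta) (amp d zeta) = inner (amp x zeta) (amp d zeta).
Proof.
have /choice[Psi PsiE] x : exists y, M x -> D y /\ amp y zeta = Q (amp x zeta).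
  have [Mx|nMx] := pselect (M x); last by exists 0.
  by have [y Dy yE] := compression_exists Mx; exists y.
have PD x : M x -> D (Psi x) by move=> /PsiE[].
have PQ x : M x -> amp (Psi x) zeta = Q (amp x zeta) by move=> /PsiE[].
have sep2 y z : D y -> D z -> amp y zeta = amp z zeta -> y = z.
  move=> Dy Dz yz; apply/eqP; rewrite -subr_eq0; apply/eqP; apply: sep; first exact: subspaceB.
  by rewrite ampB BH_apB yz subrr.
have Ms := vn_subspace vM.
have Psi_id d : D d -> Psi d = d.
  by move=> Dd; apply: sep2; rewrite ?PQ ?(proj_id os QP)//; [exact/PD/DM|exact: orb_D|exact: DM].
have F0 x : M x -> forall s t, orbit_of D zeta s -> orbit_of D zeta t ->
    inner (amp (Psi x) s) t = inner (amp x s) t.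
  move=> Mx _ _ [d Dd <-] [e De <-]; have [e' De' ee] := vn_adj vD De; have [d' Dd' dd] := vn_adj vD Dd.
  (* Centrality moves [d] from the right of e' z to its left, which reduces the claim to the first
     argument zeta. *)
  have key z : M z -> inner (amp z (amp d zeta)) (amp e zeta) = inner (amp z zeta) (amp (e * d') zeta).
    move=> Mz; have := central Dd (vn_mul vM (DM De') Mz).
    rewrite !ampM !BH_apM (is_adjoint_sym (amp_adjoint ee)) (amp_adjoint dd) => <-.
    by rewrite (is_adjoint_sym (amp_adjoint ee)).
  rewrite !key//; last exact/DM/PD.
  by rewrite PQ// (proj_innerl QP)//; apply: orb_D; exact: vn_mul.
have F x : M x -> forall s t, orb s -> orb t -> inner (amp (Psi x) s) t = inner (amp x s) t.
  move=> Mx s t /closure_seq[s' [sS ss]] /closure_seq[t' [tS tt]].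
  by apply: (inner_lim_eq (BH_cvg (x := amp (Psi x)) ss) tt (BH_cvg (x := amp x) ss) tt) => n; exact: F0.
exists Psi; split; last by move=> x d Mx Dd; apply: F => //; exact: orb_D.
split.
  split.
  - split; last by apply: Psi_id; exact: vn_one.
    apply/seteqP; split=> [_ [x Mx <-]|d Dd]; first exact: PD.
    by exists d; [exact: DM|exact: Psi_id].
  - move=> a x y Mx My; apply: sep2; first by apply: PD; exact: Ms.2.
      by apply: Ds.2; exact: PD.
    by rewrite PQ ?amp_lin ?BH_apD ?BH_apZ ?BH_D ?BH_Z ?PQ//; exact: Ms.2.
  - move=> x Mx xpos; apply: amp_positive_inv => u.
    (* Positivity is tested on the dense set of vectors b zeta with [b] in the commutant. Replacing
       [b] by the root [s] of its compression moves them into the orbit closure, where [F]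
       applies. *)
    have /closure_seq[w [wS wu]] := @separating_cyclic _ _ D zeta u vD sep.
    apply: (inner_lim_ge0 (BH_cvg (x := amp (Psi x)) wu) wu) => n /=.
    have [b bD <-] := wS n; have [s [ssa sD sQ sb]] := compress_sqrt vD QP bD.
    rewrite -(amp_comm_ap _ bD) ?sb//; [|by apply: orb_amp => //; exact: PD|exact: PD].
    rewrite (amp_comm_ap _ sD); last exact: PD.
    by rewrite F//; [exact: amp_positive|exact: orb_comm|exact: orb_comm].
  - by move=> x Mx; apply: Psi_id; exact: PD.
  - move=> d x Dd Mx; split; apply: sep2.
    + by apply: PD; apply: vn_mul => //; exact: DM.
    + by apply: vn_mul => //; exact: PD.
    + rewrite PQ ?ampM ?BH_apM ?PQ//; last by apply: vn_mul => //; exact: DM.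
      by rewrite (amp_comm_ap _ QD).
    + by apply: PD; apply: vn_mul => //; exact: DM.
    + by apply: vn_mul => //; exact: PD.
    + rewrite PQ; last by apply: vn_mul => //; exact: DM.
      rewrite !ampM !BH_apM; apply: (proj_uniq os QP).
        by apply: orb_amp; [exact: PD|exact: orb_D].
      by move=> t ot; rewrite F//; [exact: orb_D|exact: subset_closure].
apply: normal_map => xi eta.
(* Normality: on D the functional d |-> <d xi, eta> is bounded by a multiple of |d Z|, where Z packs
   vectors s k zeta of the orbit closure. Hence it is <d Z, eta2> with eta2 in the closure of D Z,
   and there [F] allows x in place of Psi x. *)
have [b [c [c0 bD bn dom]]] := domination xi vD sep.
have /choice[s sE] k := compress_sqrt vD QP (bD k).
have so k : orb (s k zeta) by apply: orb_comm => //; case: (sE k).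
have snm k d : D d -> nm (amp d (s k zeta)) = nm (amp d (b k zeta)).
  move=> Dd; have [_ sD _ sb] := sE k.
  rewrite -(amp_comm_ap _ sD)// -(amp_comm_ap _ (bD k))//.
  have := sb _ _ (orb_D Dd) (orb_D Dd); rewrite !inner_nm => /complexI/eqP.
  by rewrite eqrXn2 ?nm_ge0// => /eqP.
have geo n : \sum_(0 <= k < n) c / 2 ^+ k = 2 * c - 2 * c / 2 ^+ n.
  elim: n => [|n IH]; first by rewrite big_geq// expr0 divr1 subrr.
  by rewrite big_nat_recr//= IH exprS; field; rewrite expf_neq0.
have [n|Z sZ] := @vsum_exists _ _ (fun k => s k zeta) (2 * c).
  apply: le_trans (_ : \sum_(0 <= k < n) c / 2 ^+ k <= _).
    rewrite /series/=; apply: ler_sum => k _.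
    by have := snm k 1 (vn_one vD); rewrite amp1 !BH_ap1 => ->; exact: bn.
  by rewrite geo gerBl; apply: divr_ge0; [exact: mulr_ge0|exact: exprn_ge0].
have sZ' x : vsum (fun k => amp x (s k zeta)) (amp x Z) by exact: vsum_amp sZ.
have domZ d : D d -> nm (amp d xi) ^+ 2 <= 2 * nm (amp d Z) ^+ 2.
  move=> Dd; have [B dB] := BH_bounded d; apply: le_eps => e e0.
  have [N hN] : exists N : nat, 2 * (B ^+ 2 * (2 * c / 2 ^+ N)) <= e.
    have C0 : 0 <= 4 * B ^+ 2 * c by rewrite mulr_ge0// mulr_ge0// sqr_ge0.
    have [N hN] := geometric_small C0 e0; exists N; apply: le_trans hN.
    by rewrite le_eqVlt; apply/orP; left; apply/eqP; ring.
  apply: le_trans (dom d B N dB) _.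
  have : \sum_(0 <= k < N) nm (amp d (b k zeta)) ^+ 2 <= nm (amp d Z) ^+ 2.
    apply: le_trans (vsum_partial N (sZ' d)).
    by apply: ler_sum => k _; rewrite snm.
  by move=> h; rewrite mulrDr lerD// ler_wpM2l.
have [|a x y Dx Dy|a x y Dx Dy|x Dx|eta2 [eta2c eta2E]] :=
  @Riesz _ _ _ D (fun x => amp x Z) (fun x => inner (amp x xi) eta) (Num.sqrt 2 * nm eta).
- exact: Ds.
- by rewrite amp_lin.
- by rewrite amp_lin BH_apD BH_apZ innerDl innerZl.
- apply: le_trans (inner_CS _ _) _; rewrite mulrAC ler_wpM2r ?nm_ge0//.
  rewrite -ler_sqr ?nnegrE ?mulr_ge0 ?nm_ge0 ?sqrtr_ge0// exprMn [X in X * _]sqr_sqrtr//; exact: domZ.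
exists Z, eta2 => x Mx; rewrite eta2E; last exact: PD.
apply/eqP; rewrite -subr_eq0 -innerBl; apply/eqP; apply: orth_closure eta2c => _ [d Dd <-].
rewrite innerBl; apply/eqP; rewrite subr_eq0; apply/eqP.
have h1 := vsum_inner (sZ' (Psi x)) (sZ' d); have h2 := vsum_inner (sZ' x) (sZ' d).
apply: (cvgC_uniq h1); suff -> : series (fun k => inner (amp (Psi x) (s k zeta)) (amp d (s k zeta))) =
  series (fun k => inner (amp x (s k zeta)) (amp d (s k zeta))) by [].
congr series; apply/funext => k; apply: F => //; exact: orb_amp.
Qed.

End TraceVector.

(** * Invariant domination *)

Section HalfSpaces.
Context {R : realType} {K : hilbertType R}.
Implicit Types (P : set (R[i] * K)) (g h : K).

(** The order is that of R[i], so each condition also says that the expression is real. Such affine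
    conditions pass to midpoints and to limits. *)
Definition half_spaces P : set K := [set g | forall c, P c -> 0 <= c.1 + inner c.2 g].

Lemma half_spaces_closed P g : closure (half_spaces P) g -> half_spaces P g.
Proof.
move=> /closure_seq[u [uP ug]] c Pc.
apply: (@cvgC_ge0 _ (fun n => c.1 + inner c.2 (u n))) => [|n]; last exact: uP.
apply/cvg_normc => e e0; have [N hN] := inner_cvg e0 (cvg_cst c.2) ug.
by exists N => n /hN; rewrite opprD addrACA subrr add0r.
Qed.

Lemma half_spaces_min_norm P : half_spaces P !=set0 ->
  exists g, half_spaces P g /\ forall h, half_spaces P h -> nm h <= nm g -> h = g.
Proof.
move=> P0; have hz (z : R[i]) : (2^-1 : R)%:C * (z + z) = z.
  rewrite mulrDr -mulrDl; have -> : (2^-1 : R)%:C + (2^-1 : R)%:C = 1 :> R[i].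
    by apply/eqP; rewrite eq_complex/= addr0 eqxx andbT; apply/eqP; field.
  by rewrite mul1r.
have Pm : midpoint_closed (half_spaces P).
  move=> g h Pg Ph c Pc; rewrite innerZr conj_real innerDr.
  have -> : c.1 + (2^-1 : R)%:C * (inner c.2 g + inner c.2 h) =
      (2^-1 : R)%:C * ((c.1 + inner c.2 g) + (c.1 + inner c.2 h)).
    by rewrite addrACA [RHS]mulrDr hz.
  apply: mulr_ge0; first by rewrite ler0c.
  by apply: addr_ge0; [exact: Pg|exact: Ph].
have [g [gP gmin guniq]] := min_norm P0 Pm; exists g; split; first exact: half_spaces_closed.
by move=> h Ph; apply: guniq; exact: subset_closure.
Qed.

End HalfSpaces.

Section Averaging.
Context {R : realType} {H : hilbertType R}.
Local Notation K := (ell2 H).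
Implicit Types (x y d a : BH H) (xi eta zeta u v : K) (A D M : set (BH H)) (f : BH H -> R[i]).

Lemma vsum_nm_le (Z : nat -> K) z (B : R) : 0 <= B -> vsum Z z ->
  (forall n, \sum_(0 <= k < n) nm (Z k) ^+ 2 <= B ^+ 2) -> nm z <= B.
Proof.
move=> B0 Zz ZB; apply: (nm_cvg_le Zz) => n.
rewrite -ler_sqr ?nnegrE ?nm_ge0//; apply: le_trans (ZB n).
by rewrite Viso_sum_nm.
Qed.

Definition central_on D M f := forall d x, D d -> M x -> f (d * x) = f (x * d).

(** f (p y) = f (q (p y) p) = f (y p) settles the unitaries [p], which span D. *)
Lemma unitary_central D M f : von_neumann_algebra M -> von_neumann_algebra D -> D `<=` M ->
  linear_on M (f : BH H -> R[i]^o) ->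
  (forall x p q, unitary_in D p q -> M x -> f (q * x * p) = f x) -> central_on D M f.
Proof.
move=> vM vD DM fl fU d x Dd Mx; have Ms := vn_subspace vM.
have m y z : M y -> M z -> M (y * z) by exact: vn_mul.
pose P := [set d | M d /\ forall x, M x -> f (d * x) = f (x * d)].
suff [_ ->] : P d by [].
apply: (unitary_span vD (P := P)) => //.
  split; first by split=> [|y My]; [exact: Ms.1|rewrite mul0r mulr0].
  move=> b y z [My yP] [Mz zP]; split; first exact: Ms.2.
  move=> w Mw; have E1 : (b *: y + z) * w = b *: (y * w) + z * w by apply: BH_inj.
  have E2 : w * (b *: y + z) = b *: (w * y) + w * z.
    by apply: BH_inj => t; rewrite !BH_apM !BH_apD !BH_apZ BH_D BH_Z.
  rewrite E1 E2 fl ?[RHS]fl ?yP ?zP//; by apply: m.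
move=> p q U; have [Dp Dq _ pq qp] := U; split=> [|y My]; first exact: DM.
have := fU (p * y) p q U (m _ _ (DM _ Dp) My).
by rewrite !mulrA qp mul1r.
Qed.

Lemma unitary_vec_nm D M Om p q x : von_neumann_algebra M -> D `<=` M ->
  central_on D M (fun x => inner (amp x Om) Om) -> unitary_in D p q -> M x ->
  nm (amp (q * x * p) Om) = nm (amp x Om).
Proof.
move=> vM DM cen [Dp Dq pq pq1 qp1] Mx; have [x' Mx' xx] := vn_adj vM Mx.
have qq := is_adjoint_sym pq.
have h := is_adjointM (is_adjointM qq xx) pq.
have m y z : M y -> M z -> M (y * z) by exact: vn_mul.
have E : nm (amp (q * x * p) Om) ^+ 2 = nm (amp x Om) ^+ 2.
  apply: complexI; rewrite -(inner_sq _ (amp_adjoint h)) -(inner_sq _ (amp_adjoint xx)) -!ampM.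
  have -> : q * (x' * p) * (q * x * p) = q * (x' * x * p).
    by rewrite !mulrA -(mulrA (q * x')) pq1 mulr1.
  rewrite (cen q _ Dq); last exact: m _ _ (m _ _ Mx' Mx) (DM _ Dp).
  by rewrite -mulrA pq1 mulr1.
by move/eqP: E; rewrite eqrXn2 ?nm_ge0// => /eqP.
Qed.

(** One vector [g] encodes a whole sequence of functionals x |-> <x Om, g_k>, with g_k the component
    of [g] along the range of [Viso k]. Conditions linear in these functionals are linear in [g], up
    to conjugation. *)
Definition coeff Om g k x := inner (Viso k (amp x Om)) g.

Lemma coeff_linear M Om g k : linear_on M (coeff Om g k : BH H -> R[i]^o).
Proof. by move=> a x y _ _; rewrite /coeff amp_lin BH_apD BH_apZ BH_D BH_Z innerDl innerZl. Qed.

(** x Om |-> q x p Om is isometric by centrality of Om, so each conjugated functional has a Riesz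
    vector no longer than the component of [g]; [vsum] reassembles these vectors. *)
Lemma coeff_transfer D M Om g p q : von_neumann_algebra M -> D `<=` M ->
  central_on D M (fun x => inner (amp x Om) Om) -> unitary_in D p q ->
  exists2 h, nm h <= nm g & forall k x, M x -> coeff Om h k x = coeff Om g k (q * x * p).
Proof.
move=> vM DM cen U; have Ms := vn_subspace vM.
have m y z : M y -> M z -> M (y * z) by exact: vn_mul.
have Mqp x : M x -> M (q * x * p).
  by case: U => Dp Dq _ _ _ Mx; exact: m _ _ (m _ _ (DM _ Dq) Mx) (DM _ Dp).
have /choice[V VE] k := adjoint_exists (Viso k : BH K).
have /choice[h hE] k : exists hk, nm hk <= nm (V k g) /\
    forall x, M x -> inner (amp x Om) hk = inner (amp (q * x * p) Om) (V k g).
  have E (a : R[i]) x y : q * (a *: x + y) * p = a *: (q * x * p) + q * y * p.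
    by apply: BH_inj => t; rewrite !BH_apM !BH_apD !BH_apZ BH_D BH_Z.
  have nmE' x : M x -> nm (amp (q * x * p) Om) = nm (amp x Om).
    by move=> Mx; apply: (unitary_vec_nm vM DM cen U).
  have B x : M x -> normc (inner (amp (q * x * p) Om) (V k g)) <= nm (V k g) * nm (amp x Om).
    by move=> Mx; apply: le_trans (inner_CS _ _) _; rewrite nmE'// mulrC.
  have [a x y Mx My|a x y Mx My|x Mx|hk [hkc hkE]] :=
    @Riesz _ _ _ M (fun x => amp x Om) (fun x => inner (amp (q * x * p) Om) (V k g)) (nm (V k g)) Ms.
  - by rewrite amp_lin.
  - by rewrite E amp_lin BH_apD BH_apZ innerDl innerZl.
  - exact: B.
  exists hk; split=> [|x Mx]; last by rewrite hkE.
  apply: closure_bound hkc _ => [|_ [x Mx <-]]; first exact: nm_ge0.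
  by rewrite -hkE//; exact: B.
have Vb N : \sum_(0 <= k < N) nm (V k g) ^+ 2 <= nm g ^+ 2.
  by apply: Viso_bessel => k v; rewrite innerC VE -innerC.
have hb N : \sum_(0 <= k < N) nm (h k) ^+ 2 <= nm g ^+ 2.
  apply: le_trans (Vb N); apply: ler_sum => k _.
  by rewrite ler_sqr ?nnegrE ?nm_ge0//; case: (hE k).
have [z hz] := @vsum_exists _ _ h (nm g ^+ 2) hb.
exists z => [|k x Mx]; first by apply: vsum_nm_le hz hb; exact: nm_ge0.
rewrite /coeff innerC (vsum_coord k _ hz) -innerC (hE k).2//.
by rewrite VE.
Qed.

(* The vectors realizing a member of the class form an intersection of half spaces,
   hence contain a unique one of minimal norm, which inherits the invariance. *)
Lemma invariant_minimal D M Om (G : set (nat -> BH H -> R[i])) (P : set (R[i] * K)) :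
  von_neumann_algebra M -> von_neumann_algebra D -> D `<=` M ->
  central_on D M (fun x => inner (amp x Om) Om) ->
  (forall g, half_spaces P g <-> G (coeff Om g)) ->
  (forall F F' p q, unitary_in D p q -> G F ->
     (forall k x, M x -> F' k x = F k (q * x * p)) -> G F') ->
  (exists g, G (coeff Om g)) ->
  exists g, G (coeff Om g) /\ forall k, central_on D M (coeff Om g k).
Proof.
move=> vM vD DM cen PG GU [g0 /PG Pg0].
have [|g [/PG Gg gmin]] := @half_spaces_min_norm _ _ P; first by exists g0.
exists g; split=> // k; apply: (unitary_central vM vD DM) => [|x p q U Mx].
  exact: coeff_linear.
have [h hg hE] := coeff_transfer g vM DM cen U.
rewrite -(hE k)// (gmin h)//; apply/PG.
exact: GU U Gg hE.
Qed.

End Averaging.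

(** * Invariance of the dominating functionals *)

Section Domination.
Context {R : realType} {H : hilbertType R}.
Local Notation K := (ell2 H).
Implicit Types (x y d a : BH H) (xi eta zeta u v : K) (A D M : set (BH H)) (f : BH H -> R[i]).

Lemma unitary_bound D p q a (B : R) : unitary_in D p q -> bound_on a B -> bound_on (q * a * p) B.
Proof.
move=> [_ _ pq pq1 qp1] [B0 aB]; split=> // u; have qp := is_adjoint_sym pq.
have iso (s t : BH H) (v : H) : is_adjoint s t -> t * s = 1 -> nm (s v) = nm v.
  move=> st ts; have E : nm (s v) ^+ 2 = nm v ^+ 2.
    by apply: complexI; rewrite -(inner_sq _ st) ts -inner_nm.
  by move/eqP: E; rewrite eqrXn2 ?nm_ge0// => /eqP.
by rewrite !BH_apM (iso q p)//; apply: le_trans (aB _) _; rewrite (iso p q).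
Qed.

Lemma conj_positive p q x : is_adjoint p q -> positive_op x -> positive_op (q * x * p).
Proof. by move=> pq x0 u; rewrite !BH_apM (is_adjoint_sym pq). Qed.

Section Class.
Variables (A M : set (BH H)) (Om : K) (phi : BH H -> R[i]).
Variables (U m t : nat -> R) (r : R -> nat -> R).

(* The weights and bounds are those of the functionals
   [w k <x (b k Om), b k Om>] provided by [domination], for which the last condition
   bounds [|phi a| ^ 2] up to the error [r B N]. *)
Definition majorant (F : nat -> BH H -> R[i]) := [/\
  forall k x, M x -> positive_op x -> 0 <= F k x,
  forall k x x', M x -> M x' -> is_adjoint x x' ->
    0 <= (U k)%:C * inner (amp (x' * x) Om) Om - F k (x' * x),
  forall k, 0 <= (m k)%:C - F k 1 &
  forall a a' B N, A a -> M a' -> is_adjoint a a' -> bound_on a B ->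
    0 <= (r B N - normc (phi a) ^+ 2)%:C + \sum_(0 <= k < N) (t k)%:C * F k (a' * a)].

Lemma majorant_half_spaces : exists P, forall g, half_spaces P g <-> majorant (coeff Om g).
Proof.
pose P : set (R[i] * K) := [set cp |
  (exists k x, [/\ M x, positive_op x & cp = (0, Viso k (amp x Om))]) \/
  (exists k x x', [/\ M x, M x', is_adjoint x x' &
     cp = ((U k)%:C * inner (amp (x' * x) Om) Om, - Viso k (amp (x' * x) Om))]) \/
  (exists k, cp = ((m k)%:C, - Viso k (amp 1 Om))) \/
  (exists a a' B N, [/\ A a, M a', is_adjoint a a', bound_on a B &
     cp = ((r B N - normc (phi a) ^+ 2)%:C,
           \sum_(0 <= k < N) (t k)%:C *: Viso k (amp (a' * a) Om))])].
exists P => g.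
have sumE (a1 : BH H) N : inner (\sum_(0 <= k < N) (t k)%:C *: Viso k (amp a1 Om)) g =
    \sum_(0 <= k < N) (t k)%:C * coeff Om g k a1.
  by elim/big_ind2: _ => [|p q e s h1 h2|k _]; rewrite ?inner0l ?innerDl ?innerZl ?h1 ?h2.
split=> [gP|[g2 g3 g4 g5] cp].
  split.
  - move=> k x Mx x0; have := gP (0, Viso k (amp x Om)); rewrite add0r; apply.
    by left; exists k, x.
  - move=> k x x' Mx Mx' xx.
    have := gP ((U k)%:C * inner (amp (x' * x) Om) Om, - Viso k (amp (x' * x) Om)).
    by rewrite innerNl; apply; right; left; exists k, x, x'.
  - move=> k; have := gP ((m k)%:C, - Viso k (amp 1 Om)).
    by rewrite innerNl; apply; do 2!right; left; exists k.
  - move=> a a' B N Aa Ma' aa aB; rewrite -sumE.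
    have := gP ((r B N - normc (phi a) ^+ 2)%:C,
                \sum_(0 <= k < N) (t k)%:C *: Viso k (amp (a' * a) Om)).
    by apply; do 3!right; exists a, a', B, N.
case=> [[k [x [Mx x0 ->]]]|[[k [x [x' [Mx Mx' xx ->]]]]|[[k ->]|[a [a' [B [N [Aa Ma' aa aB ->]]]]]]]].
- by rewrite /= add0r; exact: g2.
- by rewrite /= innerNl; exact: g3.
- by rewrite /= innerNl; exact: g4.
- by rewrite /= sumE; exact: g5.
Qed.

(** Each condition for F' is one for F at a conjugate. In the second, x p replaces x and the
    centrality of Om removes the unitaries; in the last, [a] becomes q a p, which has the same bound
    and the same value under [phi]. *)
Lemma majorant_conj D F F' p q : von_neumann_algebra M -> D `<=` M -> A `<=` M -> D `<=` A ->
  (forall x y, A x -> A y -> A (x * y)) ->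
  central_on D M (fun x => inner (amp x Om) Om) ->
  (forall a p q, unitary_in D p q -> A a -> phi (q * a * p) = phi a) ->
  unitary_in D p q -> majorant F ->
  (forall k x, M x -> F' k x = F k (q * x * p)) -> majorant F'.
Proof.
move=> vM DM AM DA Am cen phiU UU [F1 F2 F3 F4] FE; have [Dp Dq pq pq1 qp1] := UU.
have qp := is_adjoint_sym pq.
have mM y z : M y -> M z -> M (y * z) by exact: vn_mul.
have Mp := DM _ Dp; have Mq := DM _ Dq.
split.
- move=> k x Mx x0; rewrite FE//; apply: F1; last exact: conj_positive.
  exact: mM _ _ (mM _ _ Mq Mx) Mp.
- move=> k x x' Mx Mx' xx; rewrite FE; last exact: mM.
  have := F2 k (x * p) (q * x') (mM _ _ Mx Mp) (mM _ _ Mq Mx') (is_adjointM xx pq).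
  have -> : q * x' * (x * p) = q * (x' * x * p) by rewrite !mulrA.
  rewrite (cen q _ Dq); last exact: mM _ _ (mM _ _ Mx' Mx) Mp.
  by rewrite -[in X in X -> _](mulrA _ p q) pq1 mulr1 mulrA.
- by move=> k; rewrite FE ?mulr1 ?qp1//; exact: vn_one.
- move=> a a' B N Aa Ma' aa aB.
  have Aq := DA _ Dq; have Ap := DA _ Dp; have Ma := AM _ Aa.
  have := F4 (q * a * p) (q * a' * p) B N (Am _ _ (Am _ _ Aq Aa) Ap)
     (mM _ _ (mM _ _ Mq Ma') Mp) _ (unitary_bound UU aB).
  have -> : q * a' * p * (q * a * p) = q * (a' * a) * p.
    by rewrite !mulrA -(mulrA (q * a')) pq1 mulr1.
  rewrite phiU// => h; rewrite (eq_bigr (fun k => (t k)%:C * F k (q * (a' * a) * p))).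
    by apply: h; have := is_adjointM (is_adjointM qp aa) pq; rewrite mulrA.
  by move=> k _; rewrite FE//; exact: mM.
Qed.

End Class.

Lemma geometric_sum n : \sum_(0 <= k < n) ((2 ^+ k)^-1 : R) <= 2.
Proof.
suff -> : \sum_(0 <= k < n) ((2 ^+ k)^-1 : R) = 2 - 2 * (2 ^+ n)^-1.
  by rewrite gerBl mulr_ge0// invr_ge0 exprn_ge0.
elim: n => [|n IH]; first by rewrite big_geq// expr0 invr1; ring.
rewrite big_nat_recr//= IH exprS invfM; set i := (2 ^+ n)^-1.
by rewrite mulrA divff ?pnatr_eq0//; ring.
Qed.

(** The conditions of [majorant] keep enough of [domination] to rebuild a vector after minimization,
    when the operators [b k] are lost and only functionals remain. *)
Lemma invariant_domination A D M Om xi eta (phi : BH H -> R[i]) :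
  von_neumann_algebra M -> von_neumann_algebra D -> D `<=` M -> separating M Om ->
  central_on D M (fun x => inner (amp x Om) Om) ->
  A `<=` M -> D `<=` A -> (forall x y, A x -> A y -> A (x * y)) ->
  (forall a, A a -> phi a = inner (amp a xi) eta) ->
  (forall a p q, unitary_in D p q -> A a -> phi (q * a * p) = phi a) ->
  exists zeta, central_on D M (fun x => inner (amp x zeta) zeta) /\
    exists C : R, forall a, A a -> normc (phi a) <= C * nm (amp a zeta).
Proof.
move=> vM vD DM sep cen AM DA Am phiE phiU.
have Ms := vn_subspace vM; have os := orbit_subspace Om Ms.
have mM y z : M y -> M z -> M (y * z) by exact: vn_mul.
have [b [c [c0 bM bn dom]]] := domination xi vM sep.
have [Q QP] := projection_exists os.
have /choice[b' bb] k := adjoint_exists (b k).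
have /choice[C0 bC] k := BH_bounded (b k).
(* As [b k] commutes with M, <x Om, ga k> is the vector functional of b k Om. *)
pose ga k := Q (b' k (b k Om)).
have gaE k x : M x -> inner (amp x Om) (ga k) = inner (amp x (b k Om)) (b k Om).
  move=> Mx; rewrite -(proj_selfadj QP) (proj_id os QP); last by apply: subset_closure; exists x.
  by rewrite -(bb k) (amp_comm_ap _ (bM k)).
(* The weights make the vectors w k ga k square summable, so that a single [g] encodes them all. *)
pose w k : R := (2 ^+ k * (1 + nm (ga k)))^-1.
have w0 k : 0 < w k by rewrite invr_gt0 mulr_gt0 ?exprn_gt0// ltr_pwDl ?nm_ge0.
(* |phi a|^2 <= |a xi|^2 |eta|^2, and 2 is the constant of [domination]. *)
pose E : R := 2 * nm eta ^+ 2; have E0 : 0 <= E by rewrite mulr_ge0// sqr_ge0.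
pose maj := majorant A M Om phi (fun k => C0 k ^+ 2 * w k) (fun k => w k * (c / 2 ^+ k))
  (fun k => E / w k) (fun B N => E * (B ^+ 2 * (2 * c / 2 ^+ N))).
have [P PE] : exists P, forall g, half_spaces P g <-> maj (coeff Om g).
  exact: majorant_half_spaces.
have ex : exists g, maj (coeff Om g).
  have zn k : nm ((w k)%:C *: ga k) ^+ 2 <= (2 ^+ k)^-1.
    rewrite nmZ normc_real ger0_norm ?(ltW (w0 k))//.
    have i0 : 0 < (2 ^+ k)^-1 :> R by rewrite invr_gt0 exprn_gt0.
    have i1 : (2 ^+ k)^-1 <= 1 :> R by rewrite invf_le1 ?exprn_gt0// exprn_ege1// ler1n.
    have gn0 := nm_ge0 (ga k).
    have h : w k * nm (ga k) <= (2 ^+ k)^-1.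
      rewrite /w invfM -mulrA ler_piMr ?(ltW i0)// mulrC ler_pdivrMr ?ltr_pwDl// mul1r.
      by rewrite lerDr.
    have h0 : 0 <= w k * nm (ga k) by rewrite mulr_ge0// ltW.
    rewrite expr2; apply: le_trans (ler_pM h0 h0 h h) _.
    by rewrite ler_piMl// ltW.
  have [|g gz] := @vsum_exists _ _ (fun k => (w k)%:C *: ga k) 2.
    by move=> n; apply: le_trans (geometric_sum n); apply: ler_sum => k _; exact: zn.
  have gE k x : M x -> coeff Om g k x = (w k)%:C * inner (amp x (b k Om)) (b k Om).
    move=> Mx; rewrite /coeff innerC (vsum_coord k _ gz) -innerC innerZr conj_real.
    by rewrite gaE.
  exists g; split.
  - move=> k x Mx x0; rewrite gE// mulr_ge0 ?ler0c ?(ltW (w0 k))//.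
    exact: amp_positive.
  - move=> k x x' Mx Mx' xx; rewrite gE; last exact: mM.
    rewrite ampM !(inner_sq _ (amp_adjoint xx)) -!rmorphM -rmorphB ler0c subr_ge0.
    rewrite [leRHS]mulrAC [leRHS]mulrC; apply: ler_wpM2l; first exact: ltW.
    rewrite -exprMn ler_sqr ?nnegrE ?mulr_ge0 ?nm_ge0//; last by case: (bC k).
    by rewrite -(amp_comm_ap _ (bM k))//; case: (bC k).
  - move=> k; rewrite gE; last exact: vn_one.
    rewrite amp1 BH_ap1 inner_nm -rmorphM -rmorphB ler0c subr_ge0.
    by apply: ler_wpM2l; [exact: ltW|exact: bn].
  - move=> a a' B N Aa Ma' aa aB; have Ma := AM _ Aa.
    have -> : \sum_(0 <= k < N) (E / w k)%:C * coeff Om g k (a' * a) =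
        (E * \sum_(0 <= k < N) nm (amp a (b k Om)) ^+ 2)%:C.
      rewrite mulr_sumr rmorph_sum; apply: eq_bigr => k _.
      rewrite gE; last exact: mM.
      rewrite ampM (inner_sq _ (amp_adjoint aa)) -!rmorphM mulrA.
      by rewrite mulfVK// gt_eqF.
    rewrite -rmorphD ler0c addrAC subr_ge0 -mulrDr.
    rewrite phiE//; apply: le_trans (_ : nm (amp a xi) ^+ 2 * nm eta ^+ 2 <= _).
      by rewrite -exprMn ler_sqr ?nnegrE ?mulr_ge0 ?nm_ge0 ?normc_ge0// inner_CS.
    rewrite [leLHS]mulrC /E (mulrC 2) -[leRHS]mulrA; apply: ler_wpM2l; first exact: sqr_ge0.
    by rewrite addrC; exact: dom.
have [|g [[g1 g2 g3 g4] gc]] := @invariant_minimal _ _ D M Om maj P vM vD DM cen PE _ ex.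
  by move=> F F' p q; apply: majorant_conj.
(* The first two conditions of [majorant], positivity and domination by Om, are the hypotheses of
   [vector_rep]. *)
have /choice[z zE] k : exists z, forall x, M x -> coeff Om g k x = (w k)%:C * inner (amp x z) z.
  pose f x := ((w k)^-1)%:C * coeff Om g k x.
  have wi : 0 <= (w k)^-1 by rewrite invr_ge0 ltW.
  have fl : linear_on M (f : BH H -> R[i]^o).
    by move=> a x y Mx My; rewrite /f (coeff_linear Om g k a Mx My) mulrDr [X in X + _]mulrCA.
  have fp : positive_on M f.
    by move=> x Mx x0; rewrite /f mulr_ge0 ?ler0c//; exact: g1.
  have [|x x' Mx Mx' xx|z [_ zE]] := @vector_rep _ _ M f vM fl fp Om (C0 k).
  - by case: (bC k).
  - have := g2 k x x' Mx Mx' xx; rewrite ampM (inner_sq _ (amp_adjoint xx)) -rmorphM.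
    rewrite lecE => /andP[_]; rewrite ReB ReC subr_ge0 => h.
    by rewrite /f ReZ mulrC ler_pdivrMr// [leRHS]mulrAC.
  - by exists z => x Mx; rewrite -zE// /f mulrA -rmorphM divff ?mul1r// gt_eqF.
(* The third condition keeps the new vectors square summable, so that they can be packed into
   zeta. *)
have zn k : nm (z k) ^+ 2 <= c * (2 ^+ k)^-1.
  have := g3 k; rewrite zE; last exact: vn_one.
  by rewrite amp1 BH_ap1 inner_nm -rmorphM -rmorphB ler0c subr_ge0 ler_pM2l.
have [|zeta zz] := @vsum_exists _ _ z (c * 2).
  move=> n; rewrite /series/=; apply: le_trans (ler_wpM2l c0 (geometric_sum n)).
  by rewrite mulr_sumr; apply: ler_sum => k _; exact: zn.
exists zeta; split.
  move=> d x Dd Mx; apply: cvgC_uniq (vsum_inner (vsum_amp zz) zz) _.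
  have -> : (fun k => inner (amp (d * x) (z k)) (z k)) = (fun k => inner (amp (x * d) (z k)) (z k)).
    apply/funext => k; have := gc k d x Dd Mx.
    rewrite !zE; [|exact: mM _ _ Mx (DM _ Dd)|exact: mM _ _ (DM _ Dd) Mx].
    by apply: mulfI; rewrite -[0]/(0%:C) (inj_eq (@complexI R)) gt_eqF.
  exact: vsum_inner (vsum_amp zz) zz.
exists (Num.sqrt E) => a Aa; have [a' Ma' aa] := vn_adj vM (AM _ Aa).
have [B aB] := BH_bounded a; have B0 : 0 <= B by case: aB.
rewrite -ler_sqr ?nnegrE ?normc_ge0 ?mulr_ge0 ?sqrtr_ge0 ?nm_ge0// exprMn sqr_sqrtr//.
apply: le_eps => e e0.
have X0 : 0 <= E * (B ^+ 2 * (2 * c)) by apply: mulr_ge0 => //; apply: mulr_ge0; [exact: sqr_ge0|exact: mulr_ge0].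
(* The error term depends on the bound [B] of this [a]; hence [N] is chosen after [a]. *)
have [N hN] := geometric_small X0 e0.
have := g4 a a' B N Aa Ma' aa aB.
have -> : \sum_(0 <= k < N) (E / w k)%:C * coeff Om g k (a' * a) =
    (E * \sum_(0 <= k < N) nm (amp a (z k)) ^+ 2)%:C.
  rewrite mulr_sumr rmorph_sum; apply: eq_bigr => k _.
  rewrite zE; last exact: mM _ _ Ma' (AM _ Aa).
  rewrite ampM (inner_sq _ (amp_adjoint aa)) -!rmorphM mulrA.
  by rewrite mulfVK// gt_eqF.
rewrite -rmorphD ler0c addrAC subr_ge0 => h; apply: le_trans h _.
rewrite addrC; apply: lerD.
  apply: ler_wpM2l => //; exact: vsum_partial (vsum_amp zz).
by rewrite !mulrA in hN *.
Qed.

End Domination.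

(** * Extension of the character *)

Section HoffmanRossi.
Context {R : realType} {H : hilbertType R}.
Local Notation K := (ell2 H).
Implicit Types (x y d a : BH H) (xi eta zeta u v : K) (A D M : set (BH H)) (f : BH H -> R[i]).

(** The form of V^* V - 1 vanishes on [S]; orthogonality extends this to the closure one argument at
    a time. *)
Lemma isometric_closure (S : set K) (V : BH K) :
  (forall s t, S s -> S t -> inner (V s) (V t) = inner s t) ->
  forall u v, closure S u -> closure S v -> inner (V u) (V v) = inner u v.
Proof.
move=> VS u v Su Sv; have [V' VV] := adjoint_exists V.
have E (a b : K) : inner (V' (V a) - a) b = inner (V a) (V b) - inner a b.
  by rewrite innerBl (is_adjoint_sym VV).
have E' (a b : K) : inner (V' (V a) - a) b = (inner (V' (V b) - b) a)^*%R.
  by rewrite !E rmorphB (innerC (V a)) (innerC a).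
have h s : S s -> inner (V' (V s) - s) v = 0.
  by move=> Ss; apply: (orth_closure _ Sv) => t St; rewrite E VS// subrr.
apply/eqP; rewrite -subr_eq0 -E E'; apply/eqP.
suff -> : inner (V' (V v) - v) u = 0 by rewrite rmorph0.
by apply: (orth_closure _ Su) => s Ss; rewrite E' h// rmorph0.
Qed.

(** Right multiplication by a unitary of D is isometric on M zeta because D is central for the
    functional of zeta, and it commutes with left multiplication. *)
Lemma right_mult M D zeta p q : von_neumann_algebra M -> D `<=` M ->
  central_on D M (fun x => inner (amp x zeta) zeta) -> unitary_in D p q ->
  exists V : BH K, [/\ forall x, M x -> V (amp x zeta) = amp (x * q) zeta,
    forall u v, closure (orbit_of M zeta) u -> closure (orbit_of M zeta) v ->
      inner (V u) (V v) = inner u v &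
    forall x u, M x -> closure (orbit_of M zeta) u -> V (amp x u) = amp x (V u)].
Proof.
move=> vM DM cen [Dp Dq pq pq1 qp1]; have Ms := vn_subspace vM.
have mM y z : M y -> M z -> M (y * z) by exact: vn_mul.
have Mq := DM _ Dq; have Mp := DM _ Dp.
have iso x y : M x -> M y ->
    inner (amp (x * q) zeta) (amp (y * q) zeta) = inner (amp x zeta) (amp y zeta).
  move=> Mx My; have [y' My' yy] := vn_adj vM My.
  have := is_adjointM yy (is_adjoint_sym pq) => yq.
  rewrite -(is_adjoint_sym (amp_adjoint yq)) -(is_adjoint_sym (amp_adjoint yy)) -!BH_apM -!ampM.
  rewrite -mulrA (cen p _ Dp); last exact: mM _ _ My' (mM _ _ Mx Mq).
  by rewrite -!mulrA qp1 mulr1.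
have [||x Mx|V [VE _]] := @operator_extension _ _ _ M (fun x => amp x zeta)
    (fun x => amp (x * q) zeta) 1 Ms.
- by move=> a x y Mx My; rewrite amp_lin.
- move=> a x y Mx My; have -> : (a *: x + y) * q = a *: (x * q) + y * q by apply: BH_inj.
  by rewrite amp_lin.
- rewrite mul1r; have := iso x x Mx Mx; rewrite !inner_nm => /complexI/eqP.
  by rewrite eqrXn2 ?nm_ge0// => /eqP->.
exists V; split=> // [u v|x u Mx].
  by apply: isometric_closure => _ _ [x Mx <-] [y My <-]; rewrite !VE// iso.
have := @op_eq_on_closure _ _ (orbit_of M zeta) (V * amp x) (amp x * V); rewrite /=.
move=> h uM; apply: (h _ u uM) => _ [y My <-].
by rewrite -[amp x (amp y zeta)]BH_apM -ampM !VE//; [rewrite -mulrA ampM|exact: mM].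
Qed.

(* The vector is zeta minus its projection on the closure of (ker Phi) zeta. For a
   unitary p of D, the isometry [x zeta |-> q x p zeta], q = p^*, fixes zeta and
   preserves that closure, hence fixes the new vector. *)
Lemma hoffman_rossi A D M (Phi : BH H -> BH H) zeta (omega : BH H -> R[i]) (C : R) :
  von_neumann_algebra M -> von_neumann_algebra D -> A `<=` M -> D `<=` A -> subalgebra A ->
  (forall a, A a -> D (Phi a)) -> linear_on A Phi ->
  (forall a b, A a -> A b -> Phi (a * b) = Phi a * Phi b) -> (forall d, D d -> Phi d = d) ->
  central_on D M (fun x => inner (amp x zeta) zeta) ->
  linear_on D (omega : BH H -> R[i]^o) ->
  (forall d d', D d -> D d' -> is_adjoint d d' -> omega (d' * d) = 0 -> d = 0) ->
  (forall a, A a -> normc (omega (Phi a)) <= C * nm (amp a zeta)) ->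
  exists xi, [/\ central_on D M (fun x => inner (amp x xi) xi), separating D xi &
    forall a d, A a -> D d -> inner (amp a xi) (amp d xi) = inner (amp (Phi a) xi) (amp d xi)].
Proof.
move=> vM vD AM DA [A0 Al Am] PD Pl Pm Pid cen ol of_ phiC.
have DM : D `<=` M by move=> d /DA/AM.
have Ms := vn_subspace vM; have os := orbit_subspace zeta Ms.
have mM y z : M y -> M z -> M (y * z) by exact: vn_mul.
have mD y z : D y -> D z -> D (y * z) by exact: vn_mul.
pose J := [set a | A a /\ Phi a = 0].
have Js : subspace J.
  split; first by split=> //; rewrite Pid//; exact: (vn_subspace vD).1.
  by move=> b x y [Ax xP] [Ay yP]; split; [exact: Al|rewrite Pl// xP yP scaler0 addr0].
have Jl a j : A a -> J j -> J (a * j).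
  by move=> Aa [Aj jP]; split; [exact: Am|rewrite Pm// jP mulr0].
have Jr a j : A a -> J j -> J (j * a).
  by move=> Aa [Aj jP]; split; [exact: Am|rewrite Pm// jP mul0r].
pose S := orbit_of J zeta; have Ss : subspace S := orbit_subspace zeta Js.
have SM u : closure S u -> closure (orbit_of M zeta) u.
  by apply: closure_subset => _ [j [/AM Mj _] <-]; exists j.
have Scl := subspace_closure Ss.
have [P SP] := projection_exists Ss.
pose xi := zeta - P zeta.
have xi_orth s : closure S s -> inner s xi = 0.
  by move=> s1; rewrite innerC (proj_orth SP)// rmorph0.
have zM : closure (orbit_of M zeta) zeta by apply: subset_closure; exact: orbit_self.
have xiM : closure (orbit_of M zeta) xi.
  by apply: (subspaceB (subspace_closure os)) => //; apply: SM; exact: (proj_in SP).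
have Scl_l a u : A a -> closure S u -> closure S (amp a u).
  move=> Aa; apply: closure_stable => _ [j Jj <-]; apply: subset_closure.
  by exists (a * j); [exact: Jl|rewrite ampM].
have Jxi j : J j -> closure S (amp j xi).
  move=> Jj; have [Aj _] := Jj; rewrite BH_B; apply: (subspaceB Scl).
    by apply: subset_closure; exists j.
  by apply: Scl_l => //; exact: (proj_in SP).
exists xi; split.
- apply: (unitary_central vM vD DM) => [a x y _ _|x p q U Mx].
    by rewrite amp_lin BH_apD BH_apZ innerDl innerZl.
  have [Dp Dq pq pq1 qp1] := U; have qp := is_adjoint_sym pq.
  have U' : unitary_in D q p by [].
  have [V [VE Viso' Vamp]] := right_mult vM DM cen U'.
  have qpK v : amp q (amp p v) = v by rewrite -BH_apM -ampM qp1 amp1.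
  have pqK v : amp p (amp q v) = v by rewrite -BH_apM -ampM pq1 amp1.
  have q_in u v : inner (amp q u) (amp q v) = inner u v.
    by rewrite (amp_adjoint qp) pqK.
  (* q V sends j zeta to q j p zeta, and ker Phi is a two-sided ideal of A. *)
  have WP : closure S (amp q (V (P zeta))).
    have := @closure_stable _ _ S (amp q * V); rewrite /= => h.
    have PS : closure S (P zeta) := SP.1 zeta.
    apply: (h _ _ PS) => _ [j Jj <-].
    apply: subset_closure; exists (q * (j * p)); first exact: (Jl _ _ (DA _ Dq) (Jr _ _ (DA _ Dp) Jj)).
    by rewrite VE ?ampM//; case: Jj => /AM.
  have Wz : amp q (V zeta) = zeta.
    have := VE 1 (vn_one vM); rewrite amp1 BH_ap1 mul1r => ->.
    exact: qpK.
  pose s := amp q (V xi) - xi.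
  have sS : closure S s.
    rewrite /s /xi !BH_B Wz opprB addrC addrA subrK.
    by apply: (subspaceB Scl) => //; exact: (proj_in SP).
  (* The isometry q V sends xi to xi + s with s orthogonal to xi; equality of norms forces s = 0. *)
  have s0 : s = 0.
    apply: inner_eq0; have e0 := xi_orth s sS.
    have sE : amp q (V xi) = s + xi by rewrite subrK.
    have e1 : inner s (amp q (V xi)) = inner s s by rewrite sE innerDr e0 addr0.
    by rewrite -e1 innerBl q_in Viso'// sE innerDr (innerC xi s) e0 rmorph0 add0r subrr.
  have Vxi : V xi = amp p xi.
    by move/eqP: s0; rewrite subr_eq0 => /eqP E; rewrite -[in RHS]E pqK.
  have xxi : closure (orbit_of M zeta) (amp x xi).
    by apply: closure_stable xiM => t tM; apply: subset_closure; exact: orbit_stable.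
  by rewrite !ampM !BH_apM (amp_adjoint qp) -Vxi -Vamp// Viso'.
(* The vector [eta] representing omega o Phi is orthogonal to (ker Phi) zeta, so that omega d = <d
   zeta, eta> = <d xi, eta> on D. Thus d xi = 0 gives omega (d' d) = 0. *)
- have [a x y Ax Ay|a x y Ax Ay|x Ax|eta [_ etaE]] := @Riesz _ _ _ A (fun x => amp x zeta)
    (fun a => omega (Phi a)) C (conj A0 Al).
  + by rewrite amp_lin.
  + by rewrite Pl// ol//; exact: PD.
  + exact: phiC.
  have eS s : closure S s -> inner s eta = 0.
    move=> sS; rewrite innerC (orth_closure _ sS) ?rmorph0// => _ [j [Aj jP] <-].
    rewrite innerC -etaE// jP.
    by rewrite -(subrr (1 : BH H)) (linear_on_B (vn_subspace vD) ol) ?subrr ?rmorph0//; exact: vn_one.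
  have oE d : D d -> omega d = inner (amp d xi) eta.
    move=> Dd; rewrite -[in LHS](Pid d Dd) etaE; last exact: DA.
    rewrite BH_B innerBl [X in _ - X]eS ?subr0//.
    by apply: Scl_l; [exact: DA|exact: (proj_in SP)].
  move=> d Dd d0; have [d' Dd' dd] := vn_adj vD Dd.
  by apply: (of_ d d') => //; rewrite oE ?ampM ?BH_apM ?d0 ?BH_0 ?inner0l//; exact: mD.
- move=> a d Aa Dd; have [d' Dd' dd] := vn_adj vD Dd.
  have Ap := DA _ (PD _ Aa); have Ad' := DA _ Dd'.
  (* a - Phi a lies in ker Phi, hence so does d' (a - Phi a), and (ker Phi) xi is orthogonal to
     xi. *)
  apply/eqP; rewrite -subr_eq0 -innerBl -BH_apB -ampB; apply/eqP.
  rewrite -(is_adjoint_sym (amp_adjoint dd)) -BH_apM -ampM; apply: xi_orth; apply: Jxi.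
  have E : a - Phi a = -1 *: Phi a + a by rewrite scaleN1r addrC.
  apply: Jl => //; rewrite E; split; first exact: Al.
  by rewrite Pl// (Pid (Phi a)) ?scaleN1r ?addNr//; exact: PD.
Qed.

End HoffmanRossi.

(** * Vectors of states and the final assembly *)

Section States.
Context {R : realType} {H : hilbertType R}.
Local Notation K := (ell2 H).
Implicit Types (x y d a : BH H) (xi eta zeta u v : K) (A D M : set (BH H)) (f : BH H -> R[i]).

(** A vector [zeta] that dominates both vectors of [normal_rep] satisfies omega (x' x) <= |x
    zeta|^2, so that [vector_rep] applies with constant 1. *)
Lemma state_vector M omega : von_neumann_algebra M -> normal_state M omega ->
  exists Om, forall x, M x -> omega x = inner (amp x Om) Om.
Proof.
move=> vM [ol op _ oc]; have [xi [eta oE]] := normal_rep (vn_subspace vM) ol oc.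
have [zeta zE] := merge xi eta.
have [|x x' Mx Mx' xx|Om [_ OmE]] := @vector_rep _ _ M omega vM ol op zeta 1.
- exact: ler01.
- apply: le_trans (Re_le_normc _) _; rewrite oE; last exact: vn_mul.
  rewrite ampM BH_apM (is_adjoint_sym (amp_adjoint xx)) expr1n mul1r expr2.
  apply: le_trans (inner_CS _ _) _; have [h1 h2] := zE x.
  by apply: ler_pM => //; exact: nm_ge0.
- by exists Om.
Qed.

Lemma sq_eq0 x x' : is_adjoint x x' -> x' * x = 0 -> x = 0.
Proof.
move=> xx x0; apply: BH_inj => u; apply: inner_eq0.
by rewrite xx -BH_apM x0 BH_ap0 inner0r.
Qed.

Lemma faithful_separating M omega Om : von_neumann_algebra M -> faithful M omega ->
  (forall x, M x -> omega x = inner (amp x Om) Om) -> separating M Om.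
Proof.
move=> vM fM oE x Mx x0; have [x' Mx' xx] := vn_adj vM Mx.
apply: (sq_eq0 xx); apply: fM; [exact: vn_mul|exact: positive_sq|].
by rewrite oE ?ampM ?BH_apM ?x0 ?BH_0 ?inner0l//; exact: vn_mul.
Qed.

Lemma wstar_comp (S : set (BH H)) (F : BH H -> BH H) Om : wstar_continuous S F ->
  wstar_continuous_functional S (fun x => inner (amp (F x) Om) Om).
Proof.
move=> Fc; pose g : weakstar H -> R[i]^o := fun y => inner (amp y Om) Om.
have gc : continuous g by exact: amp_functional_continuous.
apply/continuousP => U oU.
have oV : open (g @^-1` U) by move/continuousP: gc; apply.
by move/continuousP: Fc => /(_ _ oV).
Qed.

End States.

Theorem theorem6p5 (R : realType) (H : hilbertType R) (M A D : set (BH H))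
    (omega : BH H -> R[i]) (Phi : BH H -> BH H) :
  von_neumann_algebra M ->
  normal_state M omega -> faithful M omega -> in_centralizer M D omega ->
  A `<=` M -> subalgebra A -> wstar_closed A ->
  D `<=` A -> von_neumann_algebra D ->
  D_character A D Phi -> wstar_continuous A Phi ->
  (exists Psi : BH H -> BH H,
     normal_conditional_expectation M D Psi /\ {in A, Psi =1 Phi}) /\
  exists rho : BH H -> R[i],
    [/\ normal_state M rho, {in A, rho =1 omega \o Phi} &
      exists Psi : BH H -> BH H,
        [/\ normal_conditional_expectation M D Psi, {in A, Psi =1 Phi},
            {in M, rho \o Psi =1 rho} &
            forall Psi' : BH H -> BH H,
              normal_conditional_expectation M D Psi' -> {in A, Psi' =1 Phi} ->
              {in M, rho \o Psi' =1 rho} -> {in M, Psi' =1 Psi}]].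
Proof.
move=> vM So fM cen AM sA _ DA vD [PD Pl Pm P1 [_ Pbi]] Pc.
have [A0 Al Am] := sA; have [ol op o1 oc] := So.
have DM : D `<=` M by move=> d /DA/AM.
have Ms := vn_subspace vM; have Ds := vn_subspace vD.
have mM y z : M y -> M z -> M (y * z) by exact: vn_mul.
have mD y z : D y -> D z -> D (y * z) by exact: vn_mul.
have A1 : A 1 by apply: DA; exact: vn_one.
have Pid d : D d -> Phi d = d.
  by move=> Dd; have [+ _] := Pbi d 1 Dd A1; rewrite mulr1 P1 mulr1.
have [Om oE] := state_vector vM So.
have sep := faithful_separating vM fM oE.
have cenO : central_on D M (fun x => inner (amp x Om) Om).
  move=> d x Dd Mx; have := cen d x Dd Mx.
  by rewrite !oE//; [exact: mM _ _ Mx (DM _ Dd)|exact: mM _ _ (DM _ Dd) Mx].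
have olD : linear_on D (omega : BH H -> R[i]^o).
  by move=> a x y /DM Mx /DM My; exact: ol.
have ofD d d' : D d -> D d' -> is_adjoint d d' -> omega (d' * d) = 0 -> d = 0.
  move=> Dd Dd' dd o0; apply: (sq_eq0 dd); apply: fM o0; last exact: positive_sq.
  by apply: DM; exact: mD.
have PM a : A a -> M (Phi a) by move=> /PD/DM.
have [xi [eta phiE]] : exists xi eta, forall a, A a -> omega (Phi a) = inner (amp a xi) eta.
  have [|xi [eta xeE]] := @normal_rep _ _ A _ (conj A0 Al) _ (wstar_comp (Om := Om) Pc).
    by move=> a x y Ax Ay; rewrite Pl// amp_lin BH_apD BH_apZ innerDl innerZl.
  by exists xi, eta => a Aa; rewrite -xeE// oE//; exact: PM.
have phiU a p q : unitary_in D p q -> A a -> omega (Phi (q * a * p)) = omega (Phi a).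
  move=> [Dp Dq _ pq1 _] Aa.
  have [_ ->] := Pbi p _ Dp (Am _ _ (DA _ Dq) Aa).
  have [-> _] := Pbi q _ Dq Aa.
  rewrite -mulrA cen//; last by apply: mM; [exact: PM|exact: DM].
  by rewrite -mulrA pq1 mulr1.
have [zeta [cenz [C zC]]] :=
  invariant_domination vM vD DM sep cenO AM DA Am phiE phiU.
have [ze [cenze sepze zeE]] :=
  hoffman_rossi vM vD AM DA sA PD Pl Pm Pid cenz olD ofD zC.
have [Q QP] := projection_exists (orbit_subspace ze Ds).
have [Psi [nPsi PsiE]] := trace_expectation vM vD DM cenze sepze QP.
have [[[PsiI Psi1] Psil Psip PsiPsi Psibi] Psic] := nPsi.
have PsiD x : M x -> D (Psi x) by move=> Mx; rewrite -PsiI; exists x.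
(* For d = Psi a - Phi a in D, |d ze|^2 is the difference of two inner products that both equal <a
   ze, d ze>. *)
have PsiA : {in A, Psi =1 Phi}.
  move=> a /set_mem Aa; apply/eqP; rewrite -subr_eq0; apply/eqP; apply: sepze.
    by apply: (subspaceB Ds); [exact/PsiD/AM|exact: PD].
  apply: inner_eq0; set d := Psi a - Phi a.
  have Dd : D d by apply: (subspaceB Ds); [exact/PsiD/AM|exact: PD].
  have dE : amp d ze = amp (Psi a) ze - amp (Phi a) ze by rewrite /d ampB BH_apB.
  by rewrite {1}dE innerBl (PsiE a d (AM _ Aa) Dd) (zeE a d Aa Dd) subrr.
have Psid d : D d -> Psi d = d.
  by rewrite -PsiI => -[x Mx <-]; exact: PsiPsi.
split; first by exists Psi.
exists (omega \o Psi); split.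
- split.
  + by move=> a x y Mx My; rewrite /= Psil// ol//; apply: DM; exact: PsiD.
  + by move=> x Mx x0; apply: op; [exact/DM/PsiD|exact: Psip].
  + by rewrite /= Psi1.
  + have [|xi' [eta' xeE]] := @normal_rep _ _ M _ Ms _ (wstar_comp (Om := Om) Psic).
      by move=> a x y Mx My; rewrite Psil// amp_lin BH_apD BH_apZ innerDl innerZl.
    apply: (@normal_functional _ _ M _ xi' eta') => x Mx.
    by rewrite -xeE//= oE//; exact/DM/PsiD.
- by move=> a Aa; rewrite /= PsiA.
exists Psi; split=> //.
  by move=> x /set_mem Mx; rewrite /= PsiPsi.
move=> Psi' [[[PI' _] l' _ _ bi'] _] _ rho' x /set_mem Mx.
have D' z : M z -> D (Psi' z) by move=> Mz; rewrite -PI'; exists z.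
(* rho (Psi' z) = omega (Psi (Psi' z)), and Psi fixes Psi' z, which lies in D. *)
have oPsi z : M z -> omega (Psi' z) = omega (Psi z).
  by move=> Mz; have := rho' z (mem_set Mz); rewrite /= Psid//; exact: D'.
apply/eqP; rewrite -subr_eq0; apply/eqP; set d := Psi' x - Psi x.
have Dd : D d by apply: (subspaceB Ds); [exact: D'|exact: PsiD].
(* By the module property d' d = Psi' (d' x) - Psi (d' x), on which omega vanishes by [oPsi]. *)
have [d' Dd' dd] := vn_adj vD Dd; apply: (ofD _ _ Dd Dd' dd).
rewrite {1}/d mulrBr (linear_on_B Ds olD); [|exact: mD (D' _ Mx)|exact: mD (PsiD _ Mx)].
have [<- _] := bi' d' x Dd' Mx; have [<- _] := Psibi d' x Dd' Mx.
by rewrite oPsi ?subrr//; apply: mM => //; exact: DM.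
Qed.
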